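(* Let $t>0$, let $H\subset\mathbb{R}^d$ be measurable and let $\eta_t$ be a Poisson process in $H$ whose intensity measure is $t$ times the restriction of Lebesgue measure $\ell_d$ to $H$. Let $F\in L^2_{\eta_t}$ and let $f:\mathbf{N}_H\to\mathbb{R}$ be a representative of $F$. Let $k\in\mathbb{N}$ and $I_1,I_2\subset\{1,\ldots,k\}$ with $I_1\cup I_2=\{1,\ldots,k\}$ and define $$g(x_1,\ldots,x_k):=\bigg|\mathbb{E}\bigg[f\Big(\eta_t+\sum_{i\in I_1}\delta_{x_i}\Big)-f\Big(\eta_t+\sum_{i\in I_2}\delta_{x_i}\Big)\bigg]\bigg|,\quad x_1,\ldots,x_k\in H.$$ Assume that there are $\hat x_1,\ldots,\hat x_k$ such that $g$ is continuous in $(\hat x_1,\ldots,\hat x_k)$ and that there is a constant $c>0$ such that $g(\hat x_1,\ldots,\hat x_k)\ge c$. Moreover, let $A\subset\mathbb{R}^d$ (measurable) and $\varepsilon>0$ be such that $$g(\hat x_1+z,\hat x_2+y_2+z,\ldots,\hat x_k+y_k+z)=g(\hat x_1,\hat x_2+y_2,\ldots,\hat x_k+y_k)$$ for all $z\in A$ and $y_2,\ldots,y_k\in B^d_\varepsilon$ (where all points occurring as arguments of $g$ are assumed to lie in $H$). Then $$\tau:=\sup\{r\in(0,\varepsilon):g(\hat x_1,\hat x_2+y_2,\ldots,\hat x_k+y_k)>c/2\text{ for all }y_2,\ldots,y_k\in B^d_r\}>0$$ and $$\operatorname{Var}F\ge\frac{c^2}{4\cdot8^{k+1}k!}\min_{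j=1,\ldots,k}2^{-d(k-j)}(t\kappa_d\tau^d)^{j-1}\,t\,\ell_d(A).$$
   Context: $\mathbf{N}_H$ is the set of all locally finite point configurations (counting measures) in $H$, with the usual $\sigma$-field generated by the counting maps $\mu\mapsto\mu(B)$. $L^2_{\eta_t}$ is the set of square-integrable random variables $F$ with $F=f(\eta_t)$ a.s. for a measurable $f:\mathbf{N}_H\to\mathbb{R}$ (a representative). $B^d_r$ is the closed ball in $\mathbb{R}^d$ centred at the origin with radius $r$, and $\kappa_d$ is the volume of the unit ball $B_1^d$. *)

(* Defs.v *)
From HB Require Import structures.
From mathcomp Require Import all_boot all_order all_algebra.
From mathcomp Require Import all_classical all_reals all_analysis.
From mathcomp Require Import measurable_realfun.

Set Implicit Arguments.
Unset Strict Implicit.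
Unset Printing Implicit Defensive.

Import Order.TTheory GRing.Theory Num.Theory.
Import numFieldNormedType.Exports.

Local Open Scope classical_set_scope.
Local Open Scope ring_scope.

(* ['rV[R]_d] is the Euclidean space of dimension d, with the topology of the
   library (matrices carry the sup norm) and the Borel sigma-field below, which
   is generated by the coordinate maps. *)

Definition matrix_display : measure_display. Proof. by constructor. Qed.

Section measurable_matrix.
Context {R : realType} (m n : nat).

Definition measurable_matrix : set_system 'M[R]_(m, n) :=
  <<s \bigcup_(ij in [set: 'I_m * 'I_n])
        preimage_set_system setT (fun M : 'M[R]_(m, n) => M ij.1 ij.2)
          measurable >>.

Let measurable_matrix0 : measurable_matrix set0.
Proof. exact: sigma_algebra0. Qed.

Let measurable_matrixC A : measurable_matrix A -> measurable_matrix (~` A).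
Proof. exact: sigma_algebraC. Qed.

Let measurable_matrix_bigcup (F : (set 'M[R]_(m, n))^nat) :
  (forall i, measurable_matrix (F i)) -> measurable_matrix (\bigcup_i F i).
Proof. exact: sigma_algebra_bigcup. Qed.

HB.instance Definition _ := @isMeasurable.Build matrix_display 'M[R]_(m, n)
  measurable_matrix
  measurable_matrix0 measurable_matrixC measurable_matrix_bigcup.

Lemma measurable_entry i j :
  measurable_fun setT (fun M : 'M[R]_(m, n) => M i j).
Proof.
move=> _ Y mY; apply: sub_sigma_algebra; exists (i, j) => //.
by exists Y.
Qed.

Lemma measurable_fun_matrixP d (T : measurableType d) (f : T -> 'M[R]_(m, n)) :
  (forall i j, measurable_fun setT (fun x => f x i j)) ->
  measurable_fun setT f.
Proof.
move=> mf; apply: (@measurability _ _ _ _ setT f) => //.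
move=> _ [_ [[i j] _ [Y mY <-] <-]]; rewrite !setTI.
by have := mf i j measurableT Y mY; rewrite setTI.
Qed.

End measurable_matrix.

Section lebesgue_rV.
Context {R : realType}.

Definition rV_cons n (p : R * 'rV[R]_n) : 'rV[R]_n.+1 :=
  row_mx (const_mx p.1 : 'rV_1) p.2.

Lemma rV_cons0 n p : @rV_cons n p ord0 ord0 = p.1.
Proof.
by rewrite /rV_cons mxE; case: splitP => // j _; rewrite mxE.
Qed.

Lemma rV_consS n p j : @rV_cons n p ord0 (lift ord0 j) = p.2 ord0 j.
Proof.
rewrite /rV_cons mxE; case: splitP => [i|i] /=; first by rewrite (ord1 i).
by move=> [ji]; congr (p.2 _ _); apply/val_inj.
Qed.

Lemma measurable_rV_cons n : measurable_fun setT (@rV_cons n).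
Proof.
apply: measurable_fun_matrixP => i j; rewrite (ord1 i).
have [j'->|->] := unliftP ord0 j.
  under eq_fun do rewrite rV_consS.
  exact: (measurableT_comp (measurable_entry ord0 j') measurable_snd).
by under eq_fun do rewrite rV_cons0; exact: measurable_fst.
Qed.

Section step.
Context n (mu : {sigma_finite_measure set 'rV[R]_n -> \bar R}).

Definition lebesgue_rVS : set 'rV[R]_n.+1 -> \bar R :=
  pushforward (@lebesgue_measure R \x mu)%E (@rV_cons n).

Let cons_preim A : measurable A -> measurable (@rV_cons n @^-1` A).
Proof.
by move=> mA; have := @measurable_rV_cons n measurableT A mA; rewrite setTI.
Qed.

Let lebesgue_rVS0 : lebesgue_rVS set0 = 0%E.
Proof. by rewrite /lebesgue_rVS /pushforward preimage_set0 measure0. Qed.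

Let lebesgue_rVS_ge0 A : (0 <= lebesgue_rVS A)%E.
Proof. by rewrite /lebesgue_rVS /pushforward; apply: measure_ge0. Qed.

Let lebesgue_rVS_sigma_additive : semi_sigma_additive lebesgue_rVS.
Proof.
move=> F mF tF mUF; rewrite /lebesgue_rVS /pushforward preimage_bigcup.
apply: measure_semi_sigma_additive.
- by move=> i; exact: cons_preim.
- apply/trivIsetP => i j _ _ ij; rewrite -preimage_setI.
  by move/trivIsetP : tF => /(_ _ _ _ _ ij) ->//; rewrite preimage_set0.
- by rewrite -preimage_bigcup; exact: cons_preim.
Qed.

HB.instance Definition _ := isMeasure.Build _ _ _ lebesgue_rVS
  lebesgue_rVS0 lebesgue_rVS_ge0 lebesgue_rVS_sigma_additive.

Let lebesgue_rVS_sigma_finite : sigma_finite setT lebesgue_rVS.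
Proof.
have /sigma_finiteP[F [TF ndF Foo]] := sigma_finiteT (@lebesgue_measure R).
have /sigma_finiteP[G [TG ndG Goo]] := sigma_finiteT mu.
pose uncons (v : 'rV[R]_n.+1) : R * 'rV[R]_n :=
  (v ord0 ord0, \row_j v ord0 (lift ord0 j)).
have consK : cancel (@rV_cons n) uncons.
  move=> [x v]; rewrite /uncons rV_cons0; congr pair.
  by apply/rowP => j; rewrite mxE rV_consS.
have muncons : measurable_fun setT uncons.
  apply/measurable_fun_pairP; split => /=; first exact: measurable_entry.
  apply: measurable_fun_matrixP => i j.
  by under eq_fun do rewrite mxE; exact: measurable_entry.
exists (fun i => uncons @^-1` (F i `*` G i)).
  rewrite predeqE => v; split=> // _.
  have [i _ Fi] : (\bigcup_i F i) (uncons v).1 by rewrite -TF.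
  have [j _ Gj] : (\bigcup_i G i) (uncons v).2 by rewrite -TG.
  exists (maxn i j) => //; split.
    by move: Fi; apply/subsetPset/ndF/leq_maxl.
  by move: Gj; apply/subsetPset/ndG/leq_maxr.
move=> i; have [mFi Fioo] := Foo i; have [mGi Gioo] := Goo i; split.
  have mFG : measurable (F i `*` G i) by exact: measurableX.
  by have := muncons measurableT _ mFG; rewrite setTI.
rewrite /lebesgue_rVS /pushforward -comp_preimage.
rewrite (_ : uncons \o _ = id); last by apply/funext => p /=; rewrite consK.
by rewrite preimage_id product_measure1E// lte_mul_pinfty// ge0_fin_numE.
Qed.

HB.instance Definition _ := Measure_isSigmaFinite.Build _ _ _ lebesgue_rVS
  lebesgue_rVS_sigma_finite.

End step.

Fixpoint lebesgue_rV d : {sigma_finite_measure set 'rV[R]_d -> \bar R} :=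
  match d with
  | 0 => \d_(0 : 'rV[R]_0)
  | n.+1 => lebesgue_rVS (lebesgue_rV n)
  end.

Lemma lebesgue_rV_prod d (B : 'I_d -> set R) : (forall i, measurable (B i)) ->
  lebesgue_rV d [set x | forall i, B i (x ord0 i)] =
  (\prod_(i < d) lebesgue_measure (B i))%E.
Proof.
elim: d B => [|d IH] B mB /=.
  by rewrite big_ord0 diracE mem_set// => -[].
have mBS : measurable [set x : 'rV[R]_d | forall i, B (lift ord0 i) (x ord0 i)].
  rewrite [X in measurable X](_ : _ = \bigcap_(i in [set: 'I_d])
      ((fun x : 'rV[R]_d => x ord0 i) @^-1` B (lift ord0 i))); last first.
    by apply/seteqP; split => [x /= Bx i _|x /= Bx i]; exact: Bx.
  apply: fin_bigcap_measurable => // i _.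
  by rewrite -[X in measurable X]setTI; exact: measurable_entry.
rewrite big_ord_recl -IH// -product_measure1E//=; last exact: (mB ord0).
rewrite /lebesgue_rVS /pushforward.
congr (_ _); apply/seteqP; split=> [[x v] /= Bxv|[x v] /= [Bx Bv] i].
  split; first by have := Bxv ord0; rewrite rV_cons0.
  by move=> i; have := Bxv (lift ord0 i); rewrite rV_consS.
by have [j ->|->] := unliftP ord0 i; rewrite ?rV_consS ?rV_cons0.
Qed.

End lebesgue_rV.
Arguments lebesgue_rV {R} d.

Section euclidean_balls.
Context {R : realType}.

(* The norm of the library on matrices is the sup norm, hence this one. *)
Definition eucl_norm d (x : 'rV[R]_d) : R :=
  Num.sqrt (\sum_(i < d) x ord0 i ^+ 2).

Definition eucl_ball d (r : R) : set 'rV[R]_d := [set x | eucl_norm x <= r].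
Arguments eucl_ball : clear implicits.

Definition unit_ball_volume d : R := fine (lebesgue_rV d (eucl_ball d 1)).

Lemma measurable_eucl_ball d r : measurable (eucl_ball d r).
Proof.
have mn : measurable_fun setT (@eucl_norm d).
  apply: (@measurableT_comp _ _ _ _ _ _ (@Num.sqrt R)).
    by apply: continuous_measurable_fun; exact: sqrt_continuous.
  apply: measurable_sum => i; apply: measurable_funX; exact: measurable_entry.
rewrite (_ : eucl_ball d r = @eucl_norm d @^-1` [set` `]-oo, r]]).
  by rewrite -[X in measurable X]setTI; apply: mn => //; exact: measurable_itv.
by apply/seteqP; split => x; rewrite /eucl_ball /= in_itv.
Qed.

Lemma eucl_ball_fin_num d r : lebesgue_rV d (eucl_ball d r) \is a fin_num.
Proof.
rewrite ge0_fin_numE ?measure_ge0//.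
have sub : eucl_ball d r `<=` [set x | forall i : 'I_d, `[- r, r]%classic (x ord0 i)].
  move=> x /= xr i; rewrite in_itv /= -ler_norml; apply: le_trans xr.
  rewrite /eucl_norm -sqrtr_sqr ler_wsqrtr// (bigD1 i)//= lerDl.
  by apply: sumr_ge0 => j _; exact: sqr_ge0.
have mB : measurable [set x : 'rV[R]_d | forall i, `[- r, r]%classic (x ord0 i)].
  rewrite [X in measurable X](_ : _ = \bigcap_(i in [set: 'I_d])
      ((fun x : 'rV[R]_d => x ord0 i) @^-1` [set` `[- r, r]])); last first.
    by apply/seteqP; split => [x /= Bx i _|x /= Bx i]; exact: Bx.
  apply: fin_bigcap_measurable => // i _.
  by rewrite -[X in measurable X]setTI; exact: measurable_entry.
apply: le_lt_trans (le_measure _ _ _ sub) _; rewrite ?inE//.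
  exact: measurable_eucl_ball.
rewrite [X in (X < _)%E](@lebesgue_rV_prod R d (fun=> `[- r, r]%classic))//.
rewrite -ge0_fin_numE; last by apply: prode_ge0.
by rewrite lebesgue_measure_itv /=; apply: prode_fin_num => i _; case: ifP.
Qed.

End euclidean_balls.
Arguments eucl_ball {R} d r.
Arguments unit_ball_volume {R} d.

Section configurations.
Context {R : realType} (d : nat).

(* A locally finite point configuration is encoded as the counting measure with
   these points (multiplicities are allowed). A measure of the library may take
   arbitrary values on non-measurable sets; these values are invisible to the
   sigma-field defined below, and therefore to measurable functions. *)
Record configuration := Configuration {
  configuration_measure :> {measure set 'rV[R]_d -> \bar R} ;
  configurationP : forall B : set 'rV[R]_d, measurable B -> bounded_set B ->
    exists n : nat, configuration_measure B = n%:R%:E }.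

Program Definition empty_configuration : configuration :=
  @Configuration mzero _.
Next Obligation. by move=> B _ _; exists 0%N. Qed.

HB.instance Definition _ := gen_eqMixin configuration.
HB.instance Definition _ := gen_choiceMixin configuration.
HB.instance Definition _ := isPointed.Build configuration empty_configuration.

Definition configuration_display : measure_display.
Proof. by constructor. Qed.

Definition measurable_configuration : set_system configuration :=
  <<s \bigcup_(B in measurable)
        preimage_set_system setT (fun mu : configuration => mu B)
          measurable >>.

Let measurable_configuration0 : measurable_configuration set0.
Proof. exact: sigma_algebra0. Qed.

Let measurable_configurationC A :
  measurable_configuration A -> measurable_configuration (~` A).
Proof. exact: sigma_algebraC. Qed.

Let measurable_configuration_bigcup (F : (set configuration)^nat) :
  (forall i, measurable_configuration (F i)) ->
  measurable_configuration (\bigcup_i F i).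
Proof. exact: sigma_algebra_bigcup. Qed.

HB.instance Definition _ := @isMeasurable.Build configuration_display
  configuration measurable_configuration measurable_configuration0
  measurable_configurationC measurable_configuration_bigcup.

(* The space N_H; as a measurable space it carries the trace sigma-field. *)
Definition configurations_in (H : set 'rV[R]_d) : set configuration :=
  [set mu | mu (~` H) = 0%E].

Section add_points.
Context k (mu : configuration) (I : {set 'I_k}) (x : 'M[R]_(k, d)).

Definition add_points_measure (B : set 'rV[R]_d) : \bar R :=
  (mu B + \sum_(i in I) \d_(row i x) B)%E.

Let add_points0 : add_points_measure set0 = 0%E.
Proof.
by rewrite /add_points_measure measure0 add0e big1// => i _; exact: measure0.
Qed.

Let add_points_ge0 B : (0 <= add_points_measure B)%E.
Proof. by rewrite adde_ge0// sume_ge0. Qed.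

Let add_points_sigma_additive : semi_sigma_additive add_points_measure.
Proof.
move=> F mF tF mUF; rewrite /add_points_measure.
under eq_fun do rewrite big_split/=.
apply: cvgeD.
- by apply: ge0_adde_def; rewrite inE ?measure_ge0 ?sume_ge0.
- exact: measure_semi_sigma_additive.
under eq_fun do rewrite exchange_big/=.
apply: cvg_nnesum => i _; first by apply: nearW => n; exact: sume_ge0.
exact: measure_semi_sigma_additive.
Qed.

HB.instance Definition _ := isMeasure.Build _ _ _ add_points_measure
  add_points0 add_points_ge0 add_points_sigma_additive.

Let add_points_locally_finite (B : set 'rV[R]_d) : measurable B -> bounded_set B ->
  exists n : nat, add_points_measure B = n%:R%:E.
Proof.
move=> mB bB; have [n muB] := configurationP mu mB bB.
exists (n + \sum_(i in I) (row i x \in B))%N.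
rewrite /add_points_measure muB natrD EFinD; congr (_ + _)%E.
rewrite natr_sum -sumEFin; apply: eq_bigr => i _.
by rewrite diracE.
Qed.

Definition add_points : configuration :=
  Configuration add_points_locally_finite.

End add_points.
End configurations.
Arguments configuration R d : clear implicits.

Section poisson_process.
Context dO {Omega : measurableType dO} {R : realType} (P : probability Omega R).

Definition mutually_independent dT (T : measurableType dT) (I : finType)
    (X : I -> Omega -> T) :=
  forall A : I -> set T, (forall i, measurable (A i)) ->
    P (\bigcap_i (X i @^-1` A i)) = (\prod_i P (X i @^-1` A i))%E.

(* The parameter of a Poisson distribution may be 0 (the library's
   [poisson_pmf] is not meant for this case) or +oo (unit mass at +oo). *)
Definition poisson_distributed (rate : \bar R) (X : Omega -> \bar R) :=
  if rate is r%:E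
  then forall n : nat,
    P (X @^-1` [set n%:R%:E]) = (expR (- r) * r ^+ n / n`!%:R)%:E
  else P (X @^-1` [set +oo%E]) = 1%E.

Definition poisson_process d (H : set 'rV[R]_d) (Lambda : set 'rV[R]_d -> \bar R)
    (eta : {RV P >-> configuration R d}) :=
  [/\ forall w, configurations_in H (eta w),
      forall B, measurable B -> poisson_distributed (Lambda B) (fun w => eta w B)
    & forall m (B : 'I_m -> set 'rV[R]_d), (forall i, measurable (B i)) ->
        trivIset setT B ->
        mutually_independent (fun i w => eta w (B i)) ].

(* The points x_1, ..., x_k are the rows of the matrix [x]. *)
Definition add_cost_diff d k (f : configuration R d -> R)
    (eta : {RV P >-> configuration R d}) (I1 I2 : {set 'I_k})
    (x : 'M[R]_(k, d)) : R :=
  `| fine 'E_P[fun w => f (add_points (eta w) I1 x) -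
                        f (add_points (eta w) I2 x)] |.

End poisson_process.

Section perturbations.
Context {R : realType} (k d : nat).

Definition points_in (H : set 'rV[R]_d) : set 'M[R]_(k, d) :=
  [set x | forall i, H (row i x)].

(* (0, y_2, ..., y_k) with y_2, ..., y_k in the closed ball of radius r;
   the first point has index 0. *)
Definition perturbations (r : R) : set 'M[R]_(k, d) :=
  [set y | forall i : 'I_k, if i == 0 :> nat then row i y = 0
                            else eucl_ball d r (row i y)].

Definition translate (x : 'M[R]_(k, d)) (z : 'rV[R]_d) : 'M[R]_(k, d) :=
  \matrix_(i < k) (row i x + z).

End perturbations.
Arguments points_in {R} k {d} H.
Arguments perturbations {R} k d r.

(* Main.v *)
From HB Require Import structures.
Require Import Defs.
From mathcomp Require Import all_boot all_order all_algebra perm.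
From mathcomp Require Import all_classical all_reals all_analysis.
From mathcomp Require Import measurable_realfun.
From mathcomp Require Import ring lra.

(** The idea is duality: Var F is at least Cov(F, G)^2 / E[G^2] for every
    centred square integrable G, so that it is enough to find one test variable
    G whose covariance with F is large and whose second moment is small.

    Let U be the set of the k-tuples x for which x_1 - xhat_1 lies in A and the
    other points are within distance r < tau of the same translate of xhat. On
    U the function g exceeds c / 2. Approximate U by a union of products
    D_(i 1) x ... x D_(i k) of small disjoint cells, the indices of a tuple i
    being distinct, and let G be the sum over these tuples i of
      prod_(a in I1) N(D_(i a)) prod_(a notin I1) lam(D_(i a))
      - prod_(a in I2) N(D_(i a)) prod_(a notin I2) lam(D_(i a)),
    where N(D) is the number of points of the process in D and lam(D) its mean.

    Covariance. The Mecke formula, iterated in [multivariate_mecke], turns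
    Cov(F, G) into the integral over the union of the cells of the expectation
    in the definition of g without its absolute value
    ([test_variable_covariance]).

    Second moment. Writing each count as (N - lam) + lam expands G into
    products of centred counts of the cells in the places J, for the non-empty
    sets J of places; the terms with J empty cancel between the two products.
    Products of centred counts over two sets of disjoint cells are orthogonal
    unless the sets are equal ([chaos_orthogonal]). Hence only pairs of tuples
    that have the same set of cells in the places J contribute. Given the first
    tuple of such a pair, the cells of the second in the places J are those of
    the first in another order, which leaves at most k! possibilities, and its
    k - |J| other points lie in balls of radius 2 tau around known points,
    which gives a factor (t kappa_d (2 tau)^d)^(k - |J|) ([fibre_sum_le]).
    Altogether E[G^2] is at most 4^k k! nu(U) max_j (t kappa_d (2 tau)^d)^(k-j),
    where nu is the k-th power of the intensity measure
    ([test_variable_second_moment], [discrete_variance_bound]).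

    Conclusion. Since nu(U) = t l_d(A) (t kappa_d r^d)^(k-1)
    ([cluster_measure]) and r may be taken close to tau, the quotient
      (t kappa_d tau^d)^(k-1) / (t kappa_d (2 tau)^d)^(k-j)
      = 2^(-d(k-j)) (t kappa_d tau^d)^(j-1)
    produces the minimum over j in the theorem.

    Three reductions make this rigorous. Measurable sets of tuples are
    approximated by products of cells of distinct indices because the
    generators of the sigma-field are such products and the diagonals are null
    ([cell_approximation]). The Mecke formula is applied to bounded nonnegative
    functionals; truncation is a contraction, hence does not increase the
    variance, and the expectations of the truncated functionals converge
    ([shift_gap_truncated_cvg], [truncated_variance]). Finally the expectation
    may have both signs on U, so that U is divided into two parts
    ([variance_bound]); this costs a factor 2, as does the choice of r, and
    both are covered by the difference between 4^k and 8^(k+1) in the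
    constant. *)

Set Implicit Arguments.
Unset Strict Implicit.
Unset Printing Implicit Defensive.

Import Order.TTheory GRing.Theory Num.Theory.
Import numFieldNormedType.Exports.

Local Open Scope classical_set_scope.
Local Open Scope ring_scope.

(** * Adding points to configurations *)

Section configuration_basics.
Context {R : realType} {d : nat}.
Implicit Types mu nu : configuration R d.

(** Two configurations with the same values differ at most in their proofs of
    local finiteness. *)
Lemma configuration_eq mu nu : (forall B, mu B = nu B) -> mu = nu.
Proof.
case: mu nu => [m Hm] [n Hn] /= mn.
have e : m = n by apply: eq_measure; apply/funext.
by subst n; congr Configuration; exact: Prop_irrelevance.
Qed.

Lemma measurable_count (B : set 'rV[R]_d) : measurable B ->
  measurable_fun setT (fun mu : configuration R d => mu B).
Proof.
move=> mB _ Y mY; apply: sub_sigma_algebra; exists B => //.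
by exists Y.
Qed.

Lemma measurable_fun_configuration dT (T : measurableType dT)
    (F : T -> configuration R d) :
  (forall B, measurable B -> measurable_fun setT (fun x => F x B)) ->
  measurable_fun setT F.
Proof.
move=> mF; apply: (@measurability _ _ _ _ setT F) => //.
move=> _ [_ [B mB [Y mY <-] <-]]; rewrite !setTI.
by have := mF B mB measurableT Y mY; rewrite setTI.
Qed.

Lemma measurable_row k (i : 'I_k) :
  measurable_fun setT (fun x : 'M[R]_(k, d) => row i x).
Proof.
apply: measurable_fun_matrixP => a j; under eq_fun do rewrite mxE.
exact: measurable_entry.
Qed.

Lemma add_pointsE k mu (I : {set 'I_k}) (x : 'M[R]_(k, d)) B :
  add_points mu I x B = (mu B + \sum_(i in I) \d_(row i x) B)%E.
Proof. by []. Qed.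

Lemma measurable_add_points k (I : {set 'I_k}) :
  measurable_fun setT
    (fun p : 'M[R]_(k, d) * configuration R d => add_points p.2 I p.1).
Proof.
apply: measurable_fun_configuration => B mB.
apply: emeasurable_funD.
  exact: (measurableT_comp (measurable_count mB) measurable_snd).
under eq_fun do rewrite big_mkcond/=.
apply: emeasurable_sum => i.
case: (i \in I); last exact: measurable_cst.
under eq_fun do rewrite diracE.
apply/measurable_EFinP.
rewrite (_ : (fun x => _) = (\1_B : _ -> R) \o (fun p : 'M[R]_(k, d) * configuration R d => row i p.1)) //.
apply: measurableT_comp; first exact: measurable_indic.
exact: (measurableT_comp (measurable_row i) measurable_fst).
Qed.

Definition add_point mu (x : 'rV[R]_d) := add_points mu [set: 'I_1]%SET x.

Lemma row_rV (x : 'rV[R]_d) i : row i x = x.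
Proof. by apply/rowP => j; rewrite mxE (ord1 i). Qed.

Lemma add_pointE mu x B : add_point mu x B = (mu B + \d_x B)%E.
Proof.
rewrite add_pointsE; congr (_ + _)%E.
rewrite (eq_bigl xpredT); last by move=> i; rewrite inE.
by rewrite big_ord1 row_rV.
Qed.

Lemma measurable_add_point :
  measurable_fun setT
    (fun p : 'rV[R]_d * configuration R d => add_point p.2 p.1).
Proof. exact: measurable_add_points. Qed.

Lemma add_point_in mu x B : B x -> add_point mu x B = (mu B + 1)%E.
Proof. by move=> Bx; rewrite add_pointE diracE mem_set. Qed.

Lemma add_point_notin mu x B : ~ B x -> add_point mu x B = mu B.
Proof. by move=> Bx; rewrite add_pointE diracE memNset// adde0. Qed.

End configuration_basics.

(** * Bounded sets and the cylinder events of the counts *)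

Lemma ge0_integral_mrestr dT (T : measurableType dT) (R : realType)
    (m : {measure set T -> \bar R}) (D : set T) (mD : measurable D)
    (f : T -> \bar R) : measurable_fun setT f -> (forall x, 0 <= f x)%E ->
  (\int[mrestr m mD]_x f x = \int[m]_(x in D) f x)%E.
Proof.
move=> mf f0.
rewrite -(setUv D) ge0_integral_setU//; last 3 first.
- exact: measurableC.
- exact: measurable_funTS.
- by rewrite disj_set2E setICr.
rewrite [X in (_ + X)%E](_ : _ = 0%E) ?adde0; last first.
  apply: null_set_integral => //; first exact: measurableC.
  - exact: measurable_funTS.
  - by rewrite /= /mrestr setICl measure0.
apply: eq_measure_integral => A mA AD; rewrite /= /mrestr.
by congr (m _); apply/setIidPl.
Qed.

Section boxes.
Context {R : realType}.

Lemma bounded_subset m n (A B : set 'M[R]_(m, n)) :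
  A `<=` B -> bounded_set B -> bounded_set A.
Proof.
move=> AB; rewrite /= /bounded_near; apply: filterS => M HM x Ax.
by apply: HM; exact: AB.
Qed.

Definition box m n (r : R) : set 'M[R]_(m, n) :=
  [set x | forall i j, `|x i j| <= r].

Lemma measurable_box m n r : measurable (@box m n r).
Proof.
rewrite [X in measurable X](_ : _ = \bigcap_(ij in [set: 'I_m * 'I_n])
    ((fun x : 'M[R]_(m, n) => x ij.1 ij.2) @^-1` [set` `[- r, r]])); last first.
  apply/seteqP; split => [x /= Bx [i j] _ /=|x /= Bx i j].
    by rewrite in_itv /= -ler_norml.
  by have := Bx (i, j) Logic.I; rewrite /= in_itv/= -ler_norml.
apply: fin_bigcap_measurable => // i _.
by rewrite -[X in measurable X]setTI; exact: measurable_entry.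
Qed.

Lemma bounded_box m n r : bounded_set (@box m n r).
Proof.
rewrite /= /bounded_near; exists (Num.max r 0); split; first exact: num_real.
move=> M; rewrite gt_max => /andP[rM M0] x /= Bx.
rewrite /Num.norm/= mx_normrE; apply: bigmax_le => [|[i j] _ /=]; first exact: ltW.
by apply: le_trans (Bx i j) _; exact: ltW.
Qed.

Lemma bigcup_box m n : \bigcup_k @box m n k%:R = setT.
Proof.
rewrite -subTset => x _.
pose M := \sum_i \sum_j `|x i j|.
have M0 : 0 <= M by apply: sumr_ge0 => i _; apply: sumr_ge0.
exists (Num.bound M) => // i j; apply: le_trans (ltW (archi_boundP M0)).
rewrite /M (bigD1 i)//= (bigD1 j)//= -addrA lerDl addr_ge0//.
  by apply: sumr_ge0.
by apply: sumr_ge0 => i' _; apply: sumr_ge0.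
Qed.

Lemma nondecreasing_box m n : nondecreasing_seq (fun k => @box m n k%:R).
Proof.
move=> a b ab; apply/subsetPset => x /= Bx i j.
by apply: le_trans (Bx i j) _; rewrite ler_nat.
Qed.

Lemma cvg_measure_box m n (mu : {measure set 'M[R]_(m, n) -> \bar R}) A :
  measurable A -> mu (A `&` box k%:R) @[k --> \oo] --> mu A.
Proof.
move=> mA; have := @nondecreasing_cvg_mu _ _ _ mu (fun k => A `&` box k%:R).
rewrite -setI_bigcupr bigcup_box setIT; apply => //.
  by move=> k; apply: measurableI => //; exact: measurable_box.
by move=> a b ab; apply/subsetPset; apply: setIS; apply/subsetPset/nondecreasing_box.
Qed.

End boxes.

Section generators.
Context {R : realType} {d : nat}.
Notation X := 'rV[R]_d.
Notation conf := (configuration R d).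

Definition good_set (B : set X) := measurable B /\ bounded_set B.

Lemma good_subset (A B : set X) : measurable A -> A `<=` B -> good_set B -> good_set A.
Proof. by move=> mA AB [_ bB]; split => //; exact: bounded_subset bB. Qed.

Lemma good_set0 : good_set set0.
Proof.
by split => //; rewrite /= /bounded_near; exists 0; split => // M _ x [].
Qed.

Lemma good_setI_box (A : set X) r : measurable A -> good_set (A `&` box r).
Proof.
move=> mA; split; first by apply: measurableI => //; exact: measurable_box.
by apply: bounded_subset (@bounded_box _ _ _ r) => x [].
Qed.

Definition counts_event (T : finType) (D : T -> set X) (v : T -> nat) : set conf :=
  [set mu | forall s, mu (D s) = (v s)%:R%:E].

Lemma measurable_counts_event (T : finType) (D : T -> set X) v :
  (forall s, measurable (D s)) -> measurable (counts_event D v).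
Proof.
move=> mD; rewrite [X in measurable X](_ : _ = \bigcap_(s in [set: T])
    ((fun mu : conf => mu (D s)) @^-1` [set (v s)%:R%:E])); last first.
  by apply/seteqP; split => [mu /= Bx i _ /=|mu /= Bx i]; exact: Bx.
apply: fin_bigcap_measurable => // i _.
rewrite -[X in measurable X]setTI; apply: measurable_count => //.
Qed.

(** Only bounded sets are used: their counts are natural numbers and have
    Poisson distributions with finite parameters. *)
Definition count_cylinders : set_system conf :=
  [set E | exists m (C : 'I_m -> set X) v, (forall i, good_set (C i)) /\ E = counts_event C v].

Lemma count_cylinders_measurable : count_cylinders `<=` measurable.
Proof.
move=> _ [m [C [v [gC ->]]]]; apply: measurable_counts_event => i; exact: (gC i).1.
Qed.

Lemma count_cylindersI : setI_closed count_cylinders.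
Proof.
move=> _ _ [m [C [v [gC ->]]]] [m' [C' [v' [gC' ->]]]].
exists (m + m')%N, (fun i => match fintype.split i with inl j => C j | inr j => C' j end).
exists (fun i => match fintype.split i with inl j => v j | inr j => v' j end); split.
  by move=> i; case: splitP => j _.
apply/seteqP; split => [mu /= [Hv Hv'] i /=|mu /= H].
  by case: splitP => j _.
split => i /=.
  have := H (lshift m' i); case: splitP => j /=; first by move=> /ord_inj ->.
  by move=> e; have := ltn_ord i; rewrite e ltnNge leq_addr.
have := H (rshift m i); case: splitP => j /=; last by move=> /addnI/ord_inj ->.
by move=> e; have := ltn_ord j; rewrite -e ltnNge leq_addr.
Qed.

Lemma count_cylindersT : count_cylinders setT.
Proof.
exists 0%N, (fun=> set0), (fun=> 0%N); split; first by move=> [].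
by apply/seteqP; split => // mu _ [].
Qed.

(** The count of a bounded set takes values in nat, so that its level sets are
    cylinders; the count of any other set is the limit of the counts of its
    bounded parts. *)
Lemma measurable_sub_count_cylinders : measurable `<=` <<s count_cylinders >>.
Proof.
pose CT := g_sigma_algebraType count_cylinders.
have m1 (B : set X) : good_set B -> measurable_fun [set: CT] (fun mu : CT => (mu : conf) B).
  move=> gB _ Y mY; rewrite setTI.
  rewrite [X in measurable X](_ : _ = \bigcup_(n in [set n | Y n%:R%:E])
      counts_event (fun _ : 'I_1 => B) (fun=> n)); last first.
    apply/seteqP; split => [mu /= Ymu|mu [n /= Yn]].
      have [n muB] := configurationP mu gB.1 gB.2.
      by exists n => //=; rewrite -muB.
    by move=> /(_ ord0) /= ->.
  apply: bigcup_measurable => n _; apply: sub_sigma_algebra.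
  by exists 1%N, (fun=> B), (fun=> n).
have m2 (B : set X) : measurable B -> measurable_fun [set: CT] (fun mu : CT => (mu : conf) B).
  move=> mB.
  apply: (emeasurable_fun_cvg (fun n (mu : CT) => (mu : conf) (B `&` box n%:R))).
    by move=> n; apply: m1; exact: good_setI_box.
  by move=> mu _; exact: cvg_measure_box.
move=> E mE; apply: (@smallest_sub _ _ _ _ _ _ _ mE); first exact: (@sigma_algebra_measurable _ CT).
move=> _ [B mB [Y mY <-]].
by have := m2 B mB measurableT Y mY.
Qed.

End generators.

Section finite_unions.
Context dT (Y : measurableType dT) (R : realType) (m : {measure set Y -> \bar R}).
Variables (T : finType) (S : pred T) (D : T -> set Y).
Hypotheses (mD : forall s, measurable (D s)) (tD : trivIset setT D).

Lemma measurable_finite_bigcup : measurable (\bigcup_(s in [set s | S s]) D s).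
Proof. exact: fin_bigcup_measurable. Qed.

Lemma ge0_integral_finite_bigcup (f : Y -> \bar R) : measurable_fun setT f ->
  (forall x, 0 <= f x)%E ->
  (\int[m]_(x in \bigcup_(s in [set s | S s]) D s) f x =
   \sum_(s | S s) \int[m]_(x in D s) f x)%E.
Proof.
move=> mf f0.
have -> : \bigcup_(s in [set s | S s]) D s = \big[setU/set0]_(s <- enum S) D s.
  by rewrite -bigcup_seq; apply: eq_bigcupl; split => s /=; rewrite mem_enum.
rewrite ge0_integral_bigsetU ?enum_uniq//; last 2 first.
- by apply: sub_trivIset tD.
- exact: measurable_funTS.
by rewrite big_enum.
Qed.

Lemma measure_finite_bigcup :
  (m (\bigcup_(s in [set s | S s]) D s) = \sum_(s | S s) m (D s))%E.
Proof.
have e A : measurable A -> (m A = \int[m]_(x in A) 1)%E.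
  by move=> mA; rewrite integral_cst// mul1e.
rewrite e; last exact: measurable_finite_bigcup.
by rewrite ge0_integral_finite_bigcup//; apply: eq_bigr => s _; rewrite -e.
Qed.

End finite_unions.

(** * The Mecke formula *)

Definition poisson_weight (R : realType) (r : R) (n : nat) : R :=
  expR (- r) * r ^+ n / n`!%:R.

(** The recursion that characterizes the Poisson distribution; all of the Mecke
    formula comes from it. *)
Lemma poisson_weightS (R : realType) (r : R) n :
  n.+1%:R * poisson_weight r n.+1 = r * poisson_weight r n.
Proof.
rewrite /poisson_weight factS natrM exprS.
have n0 : (n.+1%:R : R) != 0 by rewrite pnatr_eq0.
have f0 : (n`!%:R : R) != 0 by rewrite pnatr_eq0 -lt0n fact_gt0.
move: n0 f0; move: (n.+1%:R) (n`!%:R) => a b a0 b0.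
by field; rewrite a0 b0.
Qed.

Lemma nneseries_ltn (R : realType) (a : \bar R) (N : nat) : (0 <= a)%E ->
  (\sum_(0 <= n <oo) (if (n < N)%N then a else 0) = N%:R%:E * a)%E.
Proof.
move=> a0.
rewrite (nneseries_split 0%N N)//; last by move=> n _; case: ifP.
rewrite add0n [X in (_ + X)%E]eseries0 ?adde0; last first.
  by move=> i Ni _; rewrite ltnNge Ni.
rewrite big_mkord (eq_bigr (fun=> a)); last by move=> i _; rewrite ltn_ord.
elim: N => [|N IH]; first by rewrite big_ord0 mul0e.
by rewrite big_ord_recr/= IH -natr1 EFinD ge0_muleDl ?mul1e// lee_fin.
Qed.

Section mecke.
Context {R : realType} {d : nat}.
Notation X := 'rV[R]_d.
Notation conf := (configuration R d).
Variables (Q : probability conf R) (Lam : {measure set X -> \bar R}).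

(** The law of a Poisson process with intensity measure [Lam], read off on
    disjoint bounded sets: the product formula expresses at once the
    independence of the counts and their Poisson distributions. *)
Definition poisson_law := (forall B, good_set B -> Lam B < +oo)%E /\
  forall (T : finType) (D : T -> set X) (v : T -> nat),
    (forall s, good_set (D s)) -> trivIset setT D ->
    Q (counts_event D v) = (\prod_s poisson_weight (fine (Lam (D s))) (v s))%:E.

Hypothesis QP : poisson_law.

Variables (B : set X) (gB : good_set B).
Let mB : measurable B := gB.1.

Let mlt n : measurable [set mu : conf | n%:R%:E < mu B]%E.
Proof.
rewrite (_ : [set mu | _] = setT `&` [set mu : conf | n%:R%:E < mu B]%E); last first.
  by rewrite setTI.
exact: (emeasurable_fun_o_infty measurableT (measurable_count mB)).
Qed.

(** The law of the process weighted by the count of B, as the sum over n of its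
    restrictions to the events that B has more than n points. *)
Let weighted_law : {measure set conf -> \bar R} := mseries (fun n => mrestr Q (mlt n)) 0.

Let integral_weighted (f : conf -> \bar R) : measurable_fun setT f -> (forall mu, 0 <= f mu)%E ->
  (\int[weighted_law]_mu f mu = \int[Q]_mu (f mu * mu B))%E.
Proof.
move=> mf f0; rewrite ge0_integral_measure_series//.
under eq_eseriesr do rewrite (ge0_integral_mrestr _ (mlt _))//.
under eq_eseriesr do rewrite integral_mkcond.
rewrite -integral_nneseries//; last 2 first.
- move=> n; apply/(measurable_restrictT _ (mlt n)); exact: measurable_funTS.
- by move=> n x _; apply: erestrict_ge0.
apply: eq_integral => mu _.
have [N muB] := configurationP mu gB.1 gB.2.
rewrite muB muleC -nneseries_ltn//; apply: eq_eseriesr => n _.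
rewrite patchE; case: ifPn; rewrite ?inE ?notin_setE /= muB lte_fin ltr_nat.
  by move->.
by move/negP/negbTE ->.
Qed.

Let LamB : {finite_measure set X -> \bar R} := mfrestr mB (QP.1 B gB).

Let phi (p : X * conf) := add_point p.2 p.1.

(** The law of the process with one more point, drawn from the intensity
    measure on B. *)
Let shifted_law : {measure set conf -> \bar R}.
Proof.
refine (pushforward (LamB \x Q)%E phi : {measure set conf -> \bar R}).
exact: measurable_add_point.
Defined.

Let shifted_lawE E : shifted_law E = (LamB \x Q)%E (phi @^-1` E).
Proof. by []. Qed.

Let integral_shifted (f : conf -> \bar R) : measurable_fun setT f -> (forall mu, 0 <= f mu)%E ->
  (\int[shifted_law]_mu f mu = \int[Lam]_(x in B) \int[Q]_mu f (add_point mu x))%E.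
Proof.
move=> mf f0; have mphi : measurable_fun setT phi := measurable_add_point.
have mfphi : measurable_fun setT (f \o phi) by exact: measurableT_comp.
rewrite [LHS](ge0_integral_pushforward mphi)// preimage_setT.
rewrite fubini_tonelli1//; last by move=> x; exact: f0.
rewrite [LHS]ge0_integral_mrestr//.
  by apply: measurable_fun_fubini_tonelli_F => // x; exact: f0.
by move=> x; apply: integral_ge0 => mu _; exact: f0.
Qed.

Lemma count_finite_bigcup (mu : conf) (T : finType) (S : pred T) (D : T -> set X) :
  (forall s, measurable (D s)) -> trivIset setT D ->
  (mu (\bigcup_(s in [set s | S s]) D s) = \sum_(s | S s) mu (D s))%E.
Proof. by move=> mD tD; rewrite measure_finite_bigcup. Qed.

(** When B is a union of some of the disjoint sets whose counts are prescribed,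
    an additional point in D s raises the count of D s by one, and the claim is
    [poisson_weightS] for this set. *)
Let weighted_shifted_partition (T : finType) (S : pred T) (D : T -> set X) (v : T -> nat) :
  (forall s, good_set (D s)) -> trivIset setT D -> B = \bigcup_(s in [set s | S s]) D s ->
  weighted_law (counts_event D v) = shifted_law (counts_event D v).
Proof.
move=> gD tD BE; pose E := counts_event D v.
have mD s : measurable (D s) := (gD s).1.
have mE : measurable E by exact: measurable_counts_event.
have m1E : measurable_fun setT (fun mu => (\1_E mu)%:E : \bar R).
  by apply/measurable_EFinP; exact: measurable_indic.
have pE mu : (0 <= (\1_E mu)%:E :> \bar R)%E by rewrite lee_fin.
have e (m : {measure set conf -> \bar R}) E' : measurable E' ->
    m E' = (\int[m]_mu (\1_E' mu)%:E)%E.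
  by move=> mE'; rewrite integral_indic// setIT.
rewrite -/E e// [RHS]e// integral_weighted// integral_shifted//.
transitivity (Q E * (\sum_(s | S s) (v s)%:R)%:E)%E.
  rewrite (e Q)// -(ge0_integralZr Q measurableT m1E)//; last first.
    by rewrite lee_fin sumr_ge0.
  apply: eq_integral => mu _; rewrite indicE; case: (boolP (mu \in E)) => [|_]; last by rewrite !mul0e.
  rewrite inE => Emu; rewrite !mul1e BE count_finite_bigcup// -sumEFin.
  by apply: eq_bigr => s _; exact: Emu.
rewrite [in RHS]BE ge0_integral_finite_bigcup//; last 2 first.
- apply: (measurable_fun_fubini_tonelli_F (fun p : X * conf => (\1_E (phi p))%:E)) => //.
  exact: (measurableT_comp m1E measurable_add_point).
- by move=> x; exact: integral_ge0.
rewrite -sumEFin ge0_sume_distrr//.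
apply: eq_bigr => s Ss; rewrite muleC.
have disj x s' : D s x -> D s' x -> s' = s.
  by move=> Dx Dx'; apply: tD => //; exists x.
pose v' s' := if s' == s then (v s').-1 else v s'.
transitivity (\int[Lam]_(x in D s) (if v s == 0%N then 0 else Q (counts_event D v')))%E.
  rewrite integral_cst//; case: ifPn => [/eqP ->|v0]; first by rewrite !mul0e.
  rewrite !QP.2// -[Lam (D s)]fineK; last by rewrite ge0_fin_numE// QP.1.
  rewrite -!EFinM; congr EFin; rewrite (bigD1 s)//= [in RHS](bigD1 s)//= /v' eqxx.
  rewrite [in RHS](eq_bigr (fun i => poisson_weight (fine (Lam (D i))) (v i))); last first.
    by move=> i /negbTE ->.
  rewrite mulrA -[v s]prednK ?lt0n//= poisson_weightS; ring.
apply: eq_integral => x; rewrite inE => Dx.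
case: ifPn => v0.
  rewrite integral0_eq// => mu _; rewrite indicE memNset// => /(_ s).
  rewrite add_point_in// (eqP v0).
  have [n ->] := configurationP mu (gD s).1 (gD s).2.
  by rewrite -EFinD natr1 => -[] /eqP; rewrite eqr_nat.
rewrite (e Q); last exact: measurable_counts_event.
apply: eq_integral => mu _; congr (_%:E); rewrite !indicE; congr (_%:R).
congr nat_of_bool; apply/idP/idP; rewrite !inE => H s'; have := H s'; rewrite /v'.
  case: eqVneq => [->|ss'].
    by rewrite add_point_in// => ->; rewrite -EFinD natr1 prednK// lt0n.
  by rewrite add_point_notin// => Dx'; move: ss'; rewrite (disj x s')// eqxx.
case: eqVneq => [->|ss'].
  rewrite add_point_in//; have [n ->] := configurationP mu (gD s).1 (gD s).2.
  by rewrite -EFinD natr1 => -[] /eqP; rewrite eqr_nat => /eqP <-.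
by rewrite add_point_notin// => Dx'; move: ss'; rewrite (disj x s')// eqxx.
Qed.

(** A general cylinder event is a countable disjoint union of events of the
    previous kind: cut B and the given sets into the atoms D of the algebra
    that they generate, and sum over the numbers of points in the atoms. *)
Let weighted_shifted_cylinder E : count_cylinders E -> weighted_law E = shifted_law E.
Proof.
move=> [m [C [n [gC ->]]]].
pose C' (o : option 'I_m) := if o is Some i then C i else B.
have gC' o : good_set (C' o) by case: o.
(* The cell of x is the set of the given sets that contain x; None stands for
   B. *)
pose cell x : {set option 'I_m} := [set o | `[< C' o x >]]%SET.
pose D (a : {set option 'I_m}) : set X := [set x | a != finset.set0 /\ cell x = a].
have CD o : C' o = \bigcup_(a in [set a : {set option 'I_m} | o \in a]) D a.
  apply/seteqP; split => [x Cx|x [a /= oa] [_ xa]].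
    have ox : o \in cell x by rewrite inE; apply/asboolP.
    by exists (cell x) => //=; split => //; apply/finset.set0Pn; exists o.
  by move: oa; rewrite -xa inE => /asboolP.
have gD a : good_set (D a).
  have [->|/finset.set0Pn[ o oa]] := eqVneq a finset.set0.
    rewrite [D _](_ : _ = set0); first exact: good_set0.
    by apply/seteqP; split => [x [/eqP]|x []].
  apply: (@good_subset _ _ _ (C' o)) => //; last first.
    by rewrite CD => x Dx; exists a.
  rewrite [D _](_ : _ = \bigcap_(o in [set: option 'I_m])
      (if o \in a then C' o else ~` C' o)); last first.
    apply/seteqP; split => [x [_ xa] o' _|x H].
      by rewrite -xa inE; case: asboolP.
    split; first by apply/finset.set0Pn; exists o.
    apply/setP => o'; rewrite inE; have := H o' Logic.I.
    by case: ifPn => o'a; case: asboolP.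
  apply: fin_bigcap_measurable => // o' _.
  by case: ifPn => _; [|apply: measurableC]; exact: (gC' o').1.
have mD a : measurable (D a) := (gD a).1.
have tD : trivIset setT D by move=> a b _ _ [x [[_ <-] [_ <-]]].
pose V := [set v : {ffun {set option 'I_m} -> nat} |
  forall i, (\sum_(a : {set option 'I_m} | Some i \in a) v a)%N = n i].
(* The vectors v of counts of the atoms are enumerated by [pickle] to obtain a
   sequence of events. *)
pose F (k : nat) : set conf := if @pickle_inv {ffun {set option 'I_m} -> nat} k is Some v then
  (if v \in V then counts_event D v else set0) else set0.
have -> : counts_event C n = \bigcup_k F k.
  apply/seteqP; split => [mu Emu|mu [k _]].
    pose v := [ffun a => projT1 (cid (configurationP mu (gD a).1 (gD a).2))].
    have vE a : mu (D a) = (v a)%:R%:E.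
      by rewrite ffunE; case: cid.
    exists (pickle v) => //; rewrite /F pickleK_inv mem_set//= => i; apply/eqP.
    rewrite -(eqr_nat R) natr_sum -eqe -sumEFin -(Emu i).
    have := CD (Some i); rewrite /= => ->.
    by rewrite count_finite_bigcup//; apply/eqP/eq_bigr => a _; rewrite vE.
  rewrite /F; case: pickle_inv => // v; case: ifPn => //.
  rewrite inE => Vv Dmu i; have := CD (Some i); rewrite /= => ->.
  rewrite count_finite_bigcup// -(Vv i) natr_sum -sumEFin.
  by apply: eq_bigr => a _; exact: Dmu.
have mF k : measurable (F k).
  rewrite /F; case: pickle_inv => // v; case: ifP => // _.
  exact: measurable_counts_event.
have tF : trivIset setT F.
  move=> k l _ _ [mu []]; rewrite /F.
  have := @pickle_invK {ffun {set option 'I_m} -> nat} k.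
  have := @pickle_invK {ffun {set option 'I_m} -> nat} l.
  case: pickle_inv => [w /= <-|//]; case: pickle_inv => [v /= <-|//].
  case: ifP => // _ vmu; case: ifP => // _ wmu.
  congr pickle; apply/ffunP => a; apply/eqP; rewrite -(eqr_nat R); apply/eqP.
  by have := vmu a; rewrite (wmu a) => -[].
rewrite !measure_semi_bigcup//; last 2 first.
- exact: bigcupT_measurable.
- exact: bigcupT_measurable.
apply: eq_eseriesr => k _; rewrite /F; case: pickle_inv => [v|]; last by rewrite !measure0.
case: ifP => _; last by rewrite !measure0.
by apply: (weighted_shifted_partition (S := fun a : {set option 'I_m} => None \in a)) => //; exact: (CD None).
Qed.

Let weighted_shifted E : measurable E -> weighted_law E = shifted_law E.
Proof.
move=> mE; apply: (g_sigma_algebra_measure_unique count_cylinders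
  count_cylinders_measurable (fun=> setT)).
- by move=> _; exact: count_cylindersT.
- by rewrite bigcup_const//; exists 0%N.
- exact: count_cylindersI.
- exact: weighted_shifted_cylinder.
- move=> _; rewrite (weighted_shifted_cylinder count_cylindersT) shifted_lawE preimage_setT -setXTT.
  rewrite product_measure1E//= probability_setT mule1.
  by rewrite /mfrestr/= /mrestr setTI; exact: QP.1.
- exact: measurable_sub_count_cylinders.
Qed.

(** Both sides are integrals of f, on the left for the law of the process
    weighted by the count of B, on the right for the law of the process with an
    extra point drawn from the intensity measure on B. The two measures agree
    on cylinder events, which form a pi-system. *)
Lemma mecke (f : conf -> \bar R) : measurable_fun setT f -> (forall mu, 0 <= f mu)%E ->
  (\int[Q]_mu (f mu * mu B) = \int[Lam]_(x in B) \int[Q]_mu f (add_point mu x))%E.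
Proof.
move=> mf f0; rewrite -integral_weighted// -integral_shifted//.
by apply: eq_measure_integral => E mE _; exact: weighted_shifted.
Qed.

End mecke.

(** * The multivariate Mecke formula *)

Section rows_cons.
Context {R : realType} {d : nat}.
Notation X := 'rV[R]_d.

(** Tuples of points are built from the front, so that sums over tuples and
    product measures can be treated by induction on the number of points. *)
Definition rows_cons k (p : X * 'M[R]_(k, d)) : 'M[R]_(k.+1, d) := col_mx p.1 p.2.

Lemma row_cons0 k p : row ord0 (@rows_cons k p) = p.1.
Proof.
by rewrite /rows_cons; apply/rowP => j; rewrite !mxE; case: splitP => // i _; rewrite (ord1 i).
Qed.

Lemma row_consS k p i : row (lift ord0 i) (@rows_cons k p) = row i p.2.
Proof.
rewrite /rows_cons; apply/rowP => j; rewrite !mxE; case: splitP => [l|l] /=.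
  by rewrite (ord1 l).
by move=> [il]; congr (p.2 _ _); apply/val_inj.
Qed.

Lemma measurable_rows_cons k : measurable_fun setT (@rows_cons k).
Proof.
apply: measurable_fun_matrixP => i j.
under eq_fun do rewrite /rows_cons mxE.
case: (fintype.split _) => l.
  exact: (measurableT_comp (measurable_entry l j) measurable_fst).
exact: (measurableT_comp (measurable_entry l j) measurable_snd).
Qed.

End rows_cons.

Section power_measure.
Context {R : realType} {d : nat}.
Notation X := 'rV[R]_d.
Variable m : {finite_measure set X -> \bar R}.

Section step.
Context k (mu : {finite_measure set 'M[R]_(k, d) -> \bar R}).

Definition power_measureS := pushforward (m \x mu)%E (@rows_cons R d k).

Let power_measureS_measure : {measure set 'M[R]_(k.+1, d) -> \bar R}.
Proof.
refine (pushforward (m \x mu)%E (@rows_cons R d k) : {measure set 'M[R]_(k.+1, d) -> \bar R}).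
exact: measurable_rows_cons.
Defined.

HB.instance Definition _ := Measure.copy power_measureS power_measureS_measure.

Let power_measureS_fin : fin_num_fun power_measureS.
Proof.
apply: lty_fin_num_fun.
change ((m \x mu)%E (@rows_cons R d k @^-1` setT) < +oo)%E.
rewrite preimage_setT -setXTT.
rewrite product_measure1E// lte_mul_pinfty ?measure_ge0//.
  exact: fin_num_measure.
by rewrite ltey_eq fin_num_measure.
Qed.

HB.instance Definition _ := Measure_isFinite.Build _ _ _ power_measureS power_measureS_fin.

End step.

Fixpoint power_measure k : {finite_measure set 'M[R]_(k, d) -> \bar R} :=
  match k with
  | 0 => \d_(0 : 'M[R]_(0, d))
  | n.+1 => power_measureS (power_measure n)
  end.

Lemma ge0_integral_power k (f : 'M[R]_(k.+1, d) -> \bar R) : measurable_fun setT f ->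
  (forall x, 0 <= f x)%E ->
  (\int[power_measure k.+1]_z f z =
   \int[m]_x \int[power_measure k]_y f (rows_cons (x, y)))%E.
Proof.
move=> mf f0 /=.
rewrite [LHS](ge0_integral_pushforward (@measurable_rows_cons R d k))// preimage_setT.
rewrite fubini_tonelli1//; last by move=> x; exact: f0.
exact: (measurableT_comp mf (@measurable_rows_cons R d k)).
Qed.

Definition rect k (B : 'I_k -> set X) : set 'M[R]_(k, d) :=
  [set x | forall i, B i (row i x)].

Lemma measurable_rect k (B : 'I_k -> set X) : (forall i, measurable (B i)) ->
  measurable (rect B).
Proof.
move=> mB; rewrite [X in measurable X](_ : _ = \bigcap_(i in [set: 'I_k])
    ((fun x : 'M[R]_(k, d) => row i x) @^-1` B i)); last first.
  by apply/seteqP; split => [x /= Bx i _ /=|x /= Bx i]; exact: Bx.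
apply: fin_bigcap_measurable => // i _.
by rewrite -[X in measurable X]setTI; apply: measurable_row.
Qed.

Lemma rect_cons k (B : 'I_k.+1 -> set X) x y :
  rect B (rows_cons (x, y)) <-> B ord0 x /\ rect (fun i => B (lift ord0 i)) y.
Proof.
split=> [H|[H0 H] i].
  split; first by have := H ord0; rewrite row_cons0.
  by move=> i; have := H (lift ord0 i); rewrite row_consS.
have [j ->|->] := unliftP ord0 i; last by rewrite row_cons0.
by rewrite row_consS; exact: H.
Qed.

Lemma ge0_integral_rect k (B : 'I_k.+1 -> set X) (f : 'M[R]_(k.+1, d) -> \bar R) :
  (forall i, measurable (B i)) -> measurable_fun setT f ->
  (forall x, 0 <= f x)%E ->
  (\int[power_measure k.+1]_(z in rect B) f z =
   \int[m]_(x in B ord0)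
     \int[power_measure k]_(y in rect (fun i => B (lift ord0 i))) f (rows_cons (x, y)))%E.
Proof.
move=> mB mf f0; rewrite integral_mkcond ge0_integral_power; last 2 first.
- apply/(measurable_restrictT _ (measurable_rect mB)); exact: measurable_funTS.
- by move=> x; apply: erestrict_ge0.
rewrite [RHS]integral_mkcond; apply: eq_integral => x _; rewrite patchE.
case: ifPn => [|] xB; rewrite ?inE ?notin_setE in xB.
  rewrite [RHS]integral_mkcond; apply: eq_integral => y _; rewrite !patchE.
  by congr (if _ then _ else _); apply/idP/idP; rewrite !inE rect_cons; [case|].
apply: integral0_eq => y _; rewrite patchE memNset// => /rect_cons[] //.
Qed.

Lemma power_measure_rect k (B : 'I_k -> set X) : (forall i, measurable (B i)) ->
  power_measure k (rect B) = (\prod_(i < k) m (B i))%E.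
Proof.
elim: k B => [|k IH] B mB.
  by rewrite big_ord0 /= diracE mem_set// => -[].
have e j (mu : {measure set 'M[R]_(j, d) -> \bar R}) A : measurable A -> mu A = (\int[mu]_(x in A) 1)%E.
  by move=> mA; rewrite integral_cst// mul1e.
rewrite e ?ge0_integral_rect//; last exact: measurable_rect.
rewrite (eq_integral (fun=> (\prod_(i < k) m (B (lift ord0 i)))%E)); last first.
  move=> x _; rewrite -[RHS]IH; last by move=> i; exact: mB.
  by rewrite [RHS]e//; apply: measurable_rect => i; exact: mB.
by rewrite integral_cst// big_ord_recl muleC.
Qed.

End power_measure.

Lemma emeasurable_prod dT (T : measurableType dT) (R : realType) (J : Type)
    (s : seq J) (P : pred J) (h : J -> T -> \bar R) :
  (forall j, measurable_fun setT (h j)) ->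
  measurable_fun setT (fun x => \prod_(j <- s | P j) h j x)%E.
Proof.
move=> mh; elim: s => [|j s IH].
  by under eq_fun do rewrite big_nil; exact: measurable_cst.
under eq_fun do rewrite big_cons; case: (P j) => //.
exact: emeasurable_funM.
Qed.

Section multivariate_mecke.
Context {R : realType} {d : nat}.
Notation X := 'rV[R]_d.
Notation conf := (configuration R d).

Lemma add_points_cons k (mu : conf) (I : {set 'I_k.+1}) x (y : 'M[R]_(k, d)) :
  add_points mu I (rows_cons (x, y)) =
  let nu := add_points mu [set i | lift ord0 i \in I]%SET y in
  if ord0 \in I then add_point nu x else nu.
Proof.
apply: configuration_eq => C /=.
transitivity (mu C + ((if ord0 \in I then \d_x C else 0) +
    \sum_(i in [set i | lift ord0 i \in I]%SET) \d_(row i y) C))%E.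
  rewrite add_pointsE; congr (_ + _)%E.
  rewrite big_mkcond big_ord_recl row_cons0; congr (_ + _)%E.
  rewrite [RHS]big_mkcond; apply: eq_bigr => i _.
  by rewrite row_consS inE.
case: ifP => _; rewrite ?add_pointE add_pointsE ?add0e//.
by rewrite -addeA; congr (_ + _)%E; rewrite addeC.
Qed.

Lemma big_ord_set_recl k (V : Type) (idx : V) (op : Monoid.law idx) (I : {set 'I_k.+1}) (F : 'I_k.+1 -> V) :
  \big[op/idx]_(i in I) F i =
  op (if ord0 \in I then F ord0 else idx)
     (\big[op/idx]_(i in [set i | lift ord0 i \in I]%SET) F (lift ord0 i)).
Proof.
rewrite big_mkcond big_ord_recl; congr (op _ _).
by rewrite [RHS]big_mkcond; apply: eq_bigr => i _; rewrite inE.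
Qed.

Variables (Q : probability conf R) (Lam : {measure set X -> \bar R}).
Hypothesis QP : poisson_law Q Lam.
Variables (W : set X) (gW : good_set W).

(** The intensity measure of the whole space may be infinite; product measures
    are formed on a bounded window. *)
Definition window_measure : {finite_measure set X -> \bar R} := mfrestr gW.1 (QP.1 W gW).

Lemma window_measureE A : A `<=` W -> window_measure A = Lam A.
Proof. by move=> AW; rewrite /window_measure/= /mfrestr/= /mrestr; congr (Lam _); apply/setIidPl. Qed.

(** Induction on k. If the first point is added, [mecke] integrates it out: as
    the sets are disjoint, it changes none of the other counts. Otherwise it
    contributes the intensity of its set. *)
Lemma multivariate_mecke k (I : {set 'I_k}) (B : 'I_k -> set X) (f : conf -> \bar R) :
  (forall i, measurable (B i)) -> (forall i, B i `<=` W) -> trivIset setT B ->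
  measurable_fun setT f -> (forall mu, 0 <= f mu)%E ->
  (\int[power_measure window_measure k]_(x in rect B) \int[Q]_mu f (add_points mu I x) =
   (\int[Q]_mu (f mu * \prod_(i in I) mu (B i))) * \prod_(i in ~: I) Lam (B i))%E.
Proof.
have mint j (J : {set 'I_j}) (g : conf -> \bar R) : measurable_fun setT g ->
    (forall mu, 0 <= g mu)%E ->
    measurable_fun setT (fun x => \int[Q]_mu g (add_points mu J x))%E.
  move=> mg g0; apply: (measurable_fun_fubini_tonelli_F
    (fun p : 'M[R]_(j, d) * conf => g (add_points p.2 J p.1))) => //.
  exact: (measurableT_comp mg (@measurable_add_points R d j J)).
elim: k I B f => [|k IH] I B f mB BW tB mf f0.
  rewrite [X in (_ * X)%E]big1 ?mule1; last by move=> [].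
  rewrite [rect B](_ : _ = setT); last by apply/seteqP; split => // x _ [].
  rewrite integral_dirac//; last exact: mint.
  rewrite diracT mul1e; apply: eq_integral => mu _.
  rewrite big1 ?mule1; last by move=> [].
  congr f; apply: configuration_eq => C.
  by rewrite add_pointsE big1 ?adde0// => -[].
pose I' := [set i | lift ord0 i \in I]%SET.
pose B' i := B (lift ord0 i).
have mB' i : measurable (B' i) by exact: mB.
have tB' : trivIset setT B'.
  by move=> i j _ _ /tB - /(_ Logic.I Logic.I)/lift_inj.
have IHg g : measurable_fun setT g -> (forall mu, 0 <= g mu)%E ->
  (\int[power_measure window_measure k]_(x in rect B') \int[Q]_mu g (add_points mu I' x) =
   (\int[Q]_mu (g mu * \prod_(i in I') mu (B' i))) * \prod_(i in ~: I') Lam (B' i))%E.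
  by move=> mg g0; apply: IH => // i; exact: BW.
have cI' : [set i | lift ord0 i \in ~: I]%SET = ~: I'.
  by apply/setP => i; rewrite !inE.
rewrite ge0_integral_rect//; last 2 first.
- exact: mint.
- by move=> x; exact: integral_ge0.
have cN0 : (0 <= \prod_(i in ~: I') Lam (B' i))%E by apply: prode_ge0.
have mu0 (mu : conf) : (0 <= \prod_(i in I') mu (B' i))%E by apply: prode_ge0.
rewrite [X in (_ * X)%E]big_ord_set_recl cI' inE.
under [X in _ = (X * _)%E]eq_integral do rewrite big_ord_set_recl.
case: (boolP (ord0 \in I)) => I0 /=.
  rewrite mul1e.
  pose Psi (mu : conf) := (f mu * \prod_(i in I') mu (B' i))%E.
  have mPsi : measurable_fun setT Psi.
    apply: emeasurable_funM => //; apply: emeasurable_prod => i; exact: measurable_count.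
  have Psi0 mu : (0 <= Psi mu)%E by rewrite mule_ge0.
  transitivity (\int[Lam]_(x in B ord0) (\int[Q]_mu Psi (add_point mu x) * \prod_(i in ~: I') Lam (B' i)))%E.
    transitivity (\int[window_measure]_(x in B ord0) (\int[Q]_mu Psi (add_point mu x) * \prod_(i in ~: I') Lam (B' i)))%E; last first.
      apply: eq_measure_integral => C mC CB; apply: window_measureE.
      exact: subset_trans (BW ord0).
    apply: eq_integral => x; rewrite inE => Bx.
    transitivity (\int[power_measure window_measure k]_(y in rect B') \int[Q]_mu f (add_point (add_points mu I' y) x))%E.
      apply: eq_integral => y _; apply: eq_integral => mu _.
      by rewrite add_points_cons I0.
    rewrite (IHg (fun mu => f (add_point mu x))).
    - congr (_ * _)%E; apply: eq_integral => mu _; rewrite /Psi; congr (_ * _)%E.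
      apply: eq_bigr => i _; rewrite add_point_notin// => B'x.
      by have /tB -/(_ Logic.I Logic.I) : B ord0 `&` B (lift ord0 i) !=set0 by exists x.
    - apply: (measurableT_comp mf).
      exact: (measurableT_comp measurable_add_point (@measurable_pair1 _ _ _ _ x)).
    - by [].
  have mPsiQ : measurable_fun setT (fun x => \int[Q]_mu Psi (add_point mu x))%E.
    apply: (measurable_fun_fubini_tonelli_F
      (fun p : X * conf => Psi (add_point p.2 p.1))) => //.
    exact: (measurableT_comp mPsi measurable_add_point).
  have PsiQ0 x : (0 <= \int[Q]_mu Psi (add_point mu x))%E by exact: integral_ge0.
  rewrite ge0_integralZr//; last exact: measurable_funTS.
  rewrite -(mecke QP (good_subset (mB ord0) (BW ord0) gW))//.
  by congr (_ * _)%E; apply: eq_integral => mu _; rewrite /Psi -muleA (muleC (mu _)).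
rewrite (eq_integral (fun=> (\int[Q]_mu (f mu * \prod_(i in I') mu (B' i))) *
    \prod_(i in ~: I') Lam (B' i))%E); last first.
  move=> x _; rewrite -IHg//; apply: eq_integral => y _; apply: eq_integral => mu _.
  by rewrite add_points_cons (negbTE I0).
rewrite integral_cst// [X in (_ * X = _)%E](window_measureE (BW ord0)) -muleA [(_ * Lam _)%E]muleC.
by congr (_ * _)%E; apply: eq_integral => mu _; rewrite mul1e.
Qed.

End multivariate_mecke.

(** * Orthogonality of products of centred counts *)

Section moments.
Context {R : realType} {d : nat}.
Notation X := 'rV[R]_d.
Notation conf := (configuration R d).
Variables (Q : probability conf R) (Lam : {measure set X -> \bar R}).
Hypothesis QP : poisson_law Q Lam.

Definition npoints (B : set X) (mu : conf) : R := fine (mu B).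
Definition mean (B : set X) : R := fine (Lam B).

(** A function of the points outside B only. This replaces independence from
    the count of B in the computation of moments. *)
Definition insensitive (V : Type) (B : set X) (g : conf -> V) :=
  forall mu x, B x -> g (add_point mu x) = g mu.

Lemma npointsE B (mu : conf) : good_set B -> mu B = (npoints B mu)%:E.
Proof. by move=> gB; rewrite /npoints; have [n ->] := configurationP mu gB.1 gB.2. Qed.

Lemma npoints_ge0 B mu : 0 <= npoints B mu.
Proof. by rewrite /npoints fine_ge0. Qed.

Lemma mean_ge0 B : 0 <= mean B.
Proof. by rewrite /mean fine_ge0. Qed.

Lemma meanE B : good_set B -> Lam B = (mean B)%:E.
Proof. by move=> gB; rewrite /mean fineK// ge0_fin_numE// QP.1. Qed.

Lemma measurable_npoints B : measurable B -> measurable_fun setT (npoints B).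
Proof. by move=> mB; apply: measurableT_comp (measurable_count mB). Qed.

Lemma npoints_insensitive B B' : B `&` B' = set0 -> insensitive B (npoints B').
Proof.
move=> BB mu x Bx; rewrite /npoints add_point_notin// => B'x.
by have : (B `&` B') x by []; rewrite BB.
Qed.

Section one_set.
Variables (B : set X) (gB : good_set B).

(** By [mecke], since the added point does not change g. *)
Lemma ge0_moment1 (g : conf -> \bar R) : measurable_fun setT g ->
  (forall mu, 0 <= g mu)%E -> insensitive B g ->
  (\int[Q]_mu (g mu * mu B) = (mean B)%:E * \int[Q]_mu g mu)%E.
Proof.
move=> mg g0 ig; rewrite (mecke QP gB)//.
rewrite (eq_integral (fun=> \int[Q]_mu g mu)%E).
  rewrite integral_cst; last exact: gB.1.
  by rewrite muleC meanE.
by move=> x; rewrite inE => Bx; apply: eq_integral => mu _; exact: ig.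
Qed.

(** By [mecke] applied to [g mu * mu B]: the added point raises the remaining
    factor [mu B] by one. *)
Lemma ge0_moment2 (g : conf -> \bar R) : measurable_fun setT g ->
  (forall mu, 0 <= g mu)%E -> insensitive B g ->
  (\int[Q]_mu (g mu * (mu B * mu B)) = (mean B * (mean B + 1))%:E * \int[Q]_mu g mu)%E.
Proof.
move=> mg g0 ig; have mB := measurable_count gB.1.
under eq_integral do rewrite muleA.
rewrite (mecke QP gB)//; last 2 first.
- exact: emeasurable_funM.
- by move=> mu; rewrite mule_ge0.
rewrite (eq_integral (fun=> (mean B + 1)%:E * \int[Q]_mu g mu)%E).
  rewrite integral_cst; last exact: gB.1.
  by rewrite muleC meanE// muleA -EFinM.
move=> x; rewrite inE => Bx.
rewrite EFinD ge0_muleDl ?lee_fin ?mean_ge0// mul1e -ge0_moment1//.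
rewrite -ge0_integralD//; last 2 first.
- by move=> mu _; rewrite mule_ge0.
- exact: emeasurable_funM.
apply: eq_integral => mu _; rewrite ig// add_point_in// ge0_muleDr//.
by rewrite mule1.
Qed.

(** A moment formula for nonnegative insensitive functions extends to
    integrable ones: their positive and negative parts are insensitive too. *)
Lemma moment_integrable (h : conf -> R) (c : R) :
  measurable_fun setT h -> (forall mu, 0 <= h mu) -> 0 <= c ->
  (forall g : conf -> \bar R, measurable_fun setT g ->
    (forall mu, 0 <= g mu)%E -> insensitive B g ->
    (\int[Q]_mu (g mu * (h mu)%:E) = c%:E * \int[Q]_mu g mu)%E) ->
  forall Psi : conf -> R, Q.-integrable setT (EFin \o Psi) -> insensitive B Psi ->
  Q.-integrable setT (EFin \o (fun mu => Psi mu * h mu)) /\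
  \int[Q]_mu (Psi mu * h mu) = c * \int[Q]_mu Psi mu.
Proof.
move=> mh h0 c0 H.
have pos (g : conf -> R) : Q.-integrable setT (EFin \o g) -> (forall mu, 0 <= g mu) ->
    insensitive B g -> Q.-integrable setT (EFin \o (fun mu => g mu * h mu)) /\
    \int[Q]_mu (g mu * h mu) = c * \int[Q]_mu g mu.
  move=> /integrableP[/measurable_EFinP mg gfin] g0 ig.
  have e : (\int[Q]_mu (g mu * h mu)%:E = c%:E * \int[Q]_mu (g mu)%:E)%E.
    rewrite -H; first by apply: eq_integral => mu _; rewrite EFinM.
    - exact/measurable_EFinP.
    - by move=> mu; rewrite lee_fin.
    - by move=> mu x Bx; rewrite ig.
  split.
    apply/integrableP; split; first by apply/measurable_EFinP; exact: measurable_funM.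
    rewrite (eq_integral (fun mu => (g mu * h mu)%:E)); last first.
      by move=> mu _ /=; rewrite ger0_norm// mulr_ge0.
    rewrite e lte_mul_pinfty//.
    by rewrite (eq_integral (fun mu => `|(g mu)%:E|))%E// => mu _ /=; rewrite ger0_norm.
  rewrite /Rintegral e fineM// ge0_fin_numE.
    by rewrite (eq_integral (fun mu => `|(g mu)%:E|))%E// => mu _ /=; rewrite ger0_norm.
  by apply: integral_ge0 => mu _; rewrite lee_fin.
move=> Psi iPsi ins.
pose p mu := Num.max (Psi mu) 0; pose n mu := Num.max (- Psi mu) 0.
have /integrableP[/measurable_EFinP mPsi _] := iPsi.
have mp : measurable_fun setT p by exact: measurable_maxr.
have mn : measurable_fun setT n by apply: measurable_maxr => //; exact: measurableT_comp.
have Ip : Q.-integrable setT (EFin \o p).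
  apply: (le_integrable measurableT _ _ iPsi); first exact/measurable_EFinP.
  by move=> mu _ /=; rewrite lee_fin /p; case: (leP (Psi mu) 0) => _ //; rewrite normr0.
have In : Q.-integrable setT (EFin \o n).
  apply: (le_integrable measurableT _ _ iPsi); first exact/measurable_EFinP.
  by move=> mu _ /=; rewrite lee_fin /n; case: (leP (- Psi mu) 0) => _; rewrite ?normr0 ?normrN.
have p0 mu : 0 <= p mu by rewrite /p le_max lexx orbT.
have n0 mu : 0 <= n mu by rewrite /n le_max lexx orbT.
have sp : insensitive B p by move=> mu x Bx; rewrite /p ins.
have sn : insensitive B n by move=> mu x Bx; rewrite /n ins.
have [ip Ep] := pos p Ip p0 sp.
have [iN En] := pos n In n0 sn.
have pn mu : Psi mu = p mu - n mu.
  by rewrite /p /n; case: (leP (Psi mu) 0); case: (leP (- Psi mu) 0) => ? ?; lra.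
have e : (fun mu => Psi mu * h mu) = (fun mu => p mu * h mu - n mu * h mu).
  by apply/funext => mu; rewrite pn mulrBl.
split.
  by rewrite e; exact: (integrableB measurableT ip iN).
rewrite e RintegralB// Ep En -mulrBr; congr (_ * _).
by rewrite -RintegralB//; apply: eq_Rintegral => mu _; rewrite pn.
Qed.

Lemma centered_moment1 (Psi : conf -> R) :
  Q.-integrable setT (EFin \o Psi) -> insensitive B Psi ->
  Q.-integrable setT (EFin \o (fun mu => Psi mu * (npoints B mu - mean B))) /\
  \int[Q]_mu (Psi mu * (npoints B mu - mean B)) = 0.
Proof.
move=> iPsi ins.
have [i1 E1] : Q.-integrable setT (EFin \o (fun mu => Psi mu * npoints B mu)) /\
    \int[Q]_mu (Psi mu * npoints B mu) = mean B * \int[Q]_mu Psi mu.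
  apply: moment_integrable => //.
  - exact: measurable_npoints gB.1.
  - exact: npoints_ge0.
  - exact: mean_ge0.
  - move=> g mg g0 ig; rewrite -ge0_moment1//.
    by apply: eq_integral => mu _; rewrite npointsE.
have i0 : Q.-integrable setT (EFin \o (fun mu => mean B * Psi mu)).
  exact: (integrableZl measurableT (mean B) iPsi).
have e : (fun mu => Psi mu * (npoints B mu - mean B)) =
    (fun mu => Psi mu * npoints B mu - mean B * Psi mu).
  by apply/funext => mu; rewrite mulrBr (mulrC (mean B)).
rewrite e; split.
  exact: (integrableB measurableT i1 i0).
by rewrite RintegralB// E1 RintegralZl// subrr.
Qed.

Lemma centered_moment2 (Psi : conf -> R) :
  Q.-integrable setT (EFin \o Psi) -> insensitive B Psi ->
  Q.-integrable setT (EFin \o (fun mu => Psi mu * (npoints B mu - mean B) ^+ 2)) /\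
  \int[Q]_mu (Psi mu * (npoints B mu - mean B) ^+ 2) = mean B * \int[Q]_mu Psi mu.
Proof.
move=> iPsi ins; have [i1 E1] := centered_moment1 iPsi ins.
have [i2 E2] : Q.-integrable setT (EFin \o (fun mu => Psi mu * (npoints B mu) ^+ 2)) /\
    \int[Q]_mu (Psi mu * (npoints B mu) ^+ 2) = mean B * (mean B + 1) * \int[Q]_mu Psi mu.
  apply: moment_integrable => //.
  - by apply: measurable_funX; exact: measurable_npoints gB.1.
  - by move=> mu; exact: sqr_ge0.
  - by rewrite mulr_ge0 ?mean_ge0// addr_ge0 ?mean_ge0.
  - move=> g mg g0 ig; rewrite -ge0_moment2//.
    by apply: eq_integral => mu _; rewrite npointsE// -EFinM expr2.
(* (N - lam)^2 = N^2 - 2 lam (N - lam) - lam^2 *)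
pose a := 2 * mean B; pose b := mean B ^+ 2.
have ia := integrableZl measurableT a i1.
have ib := integrableZl measurableT b iPsi.
have iab := integrableD measurableT ia ib.
have e : (fun mu => Psi mu * (npoints B mu - mean B) ^+ 2) =
    (fun mu => Psi mu * npoints B mu ^+ 2 -
      (a * (Psi mu * (npoints B mu - mean B)) + b * Psi mu)).
  by apply/funext => mu; rewrite /a /b; ring.
rewrite e; split.
  exact: (integrableB measurableT i2 iab).
rewrite RintegralB// RintegralD// !RintegralZl// E1 E2 mulr0 add0r /b; ring.
Qed.

End one_set.

Section family.
Variables (T : finType) (D : T -> set X).
Hypotheses (gD : forall s, good_set (D s)) (tD : trivIset setT D).

Let centered s mu := npoints (D s) mu - mean (D s).

(** One factor at a time: the product of the others does not depend on the
    points in its set, so that [centered_moment1] or [centered_moment2]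
    applies. *)
Lemma centered_product_moment (r : seq T) (e : T -> nat) : uniq r ->
  (forall s, (e s <= 2)%N) ->
  Q.-integrable setT (EFin \o (fun mu => \prod_(s <- r) centered s mu ^+ e s)) /\
  \int[Q]_mu (\prod_(s <- r) centered s mu ^+ e s) =
  \prod_(s <- r) (if e s == 0%N then 1 else if e s == 1%N then 0 else mean (D s)).
Proof.
move=> ur e2; elim: r ur => [_|s r IH /= /andP[sr ur]].
  rewrite big_nil (_ : (fun mu => _) = cst 1); last first.
    by apply/funext => mu; rewrite big_nil.
  split; first exact: finite_measure_integrable_cst.
  by rewrite [LHS](Rintegral_cst Q measurableT) mul1r; exact: (congr1 fine (probability_setT Q)).
have [iP EP] := IH ur.
pose Psi mu := \prod_(s <- r) centered s mu ^+ e s.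
have ins : insensitive (D s) Psi.
  move=> mu x Dx; rewrite /Psi !big_seq; apply: eq_bigr => s' s'r; congr (_ ^+ _).
  rewrite /centered (npoints_insensitive (B := D s))//.
  apply: contrapT => /eqP/set0P ss'; have := tD Logic.I Logic.I ss' => ess'.
  by move: sr; rewrite ess' s'r.
rewrite big_cons -EP -/Psi (_ : (fun mu => _) = (fun mu => Psi mu * centered s mu ^+ e s)); last first.
  by apply/funext => mu; rewrite big_cons mulrC.
case es : (e s) => [|[|[|n]]] /=; last by have := e2 s; rewrite es.
- rewrite (_ : (fun mu => _) = Psi); first by rewrite mul1r.
  by apply/funext => mu; rewrite mulr1.
- by rewrite mul0r; exact: centered_moment1.
- exact: centered_moment2.
Qed.

Definition chaos (S : {set T}) (mu : conf) := \prod_(s in S) centered s mu.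

(** A set in exactly one of S and S' contributes a centred count to the first
    power, whose mean vanishes; a set in both contributes the variance of a
    Poisson count, which is its mean. *)
Lemma chaos_orthogonal (S S' : {set T}) :
  Q.-integrable setT (EFin \o (fun mu => chaos S mu * chaos S' mu)) /\
  \int[Q]_mu (chaos S mu * chaos S' mu) =
  if S == S' then \prod_(s in S) mean (D s) else 0.
Proof.
pose e s := ((s \in S) + (s \in S'))%N.
have e2 s : (e s <= 2)%N by rewrite /e; case: (s \in S); case: (s \in S').
have [iP EP] := centered_product_moment (index_enum_uniq T) e2.
have E : (fun mu => chaos S mu * chaos S' mu) =
    (fun mu => \prod_(s <- index_enum T) centered s mu ^+ e s).
  apply/funext => mu; rewrite /chaos big_mkcond [X in _ * X]big_mkcond -big_split.
  by apply: eq_bigr => s _; rewrite /e; case: (s \in S); case: (s \in S');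
    rewrite /= ?mulr1 ?mul1r// -expr2.
rewrite E; split; first exact: iP.
rewrite EP; case: eqVneq => [SS'|/eqP SS'].
  rewrite [RHS]big_mkcond; apply: eq_bigr => s _.
  by rewrite /e -SS'; case: (s \in S).
have [s ss'] : exists s, (s \in S) != (s \in S').
  apply: contrapT => H; apply: SS'; apply/setP => s.
  by apply: contrapT => /eqP ss; apply: H; exists s.
apply/eqP; rewrite prodf_seq_eq0; apply/hasP; exists s; first exact: mem_index_enum.
by rewrite /e; move: ss'; case: (s \in S); case: (s \in S') => //=; rewrite eqxx.
Qed.

Lemma chaos_mean0 S : S != finset.set0 ->
  Q.-integrable setT (EFin \o chaos S) /\ \int[Q]_mu chaos S mu = 0.
Proof.
move=> S0; have [iP EP] := chaos_orthogonal S finset.set0.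
have e : (fun mu => chaos S mu * chaos finset.set0 mu) = chaos S.
  by apply/funext => mu; rewrite {2}/chaos big_set0 mulr1.
by move: iP EP; rewrite e (negbTE S0).
Qed.

End family.
End moments.

(** * The second moment of the test variable *)

(** The Cauchy-Schwarz inequality against the constant 1. *)
Lemma sqr_sum_le (R : realDomainType) (T : finType) (P : pred T) (x : T -> R) :
  (\sum_(i | P i) x i) ^+ 2 <= #|P|%:R * \sum_(i | P i) x i ^+ 2.
Proof.
rewrite -(ler_pM2l (ltr0Sn R 1)) expr2 big_distrlr/= mulr_sumr.
have -> : 2 * (#|P|%:R * \sum_(i | P i) x i ^+ 2) =
    \sum_(i | P i) \sum_(j | P j) (x i ^+ 2 + x j ^+ 2).
  under [RHS]eq_bigr do rewrite big_split/= sumr_const.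
  rewrite [RHS]big_split/= sumr_const sumrMnl.
  by rewrite -[X in _ = X + _]mulr_natl -[X in _ = _ + X]mulr_natl mulr2n mulrDl mul1r.
apply: ler_sum => i _; rewrite mulr_sumr; apply: ler_sum => j _.
have := sqr_ge0 (x i - x j); lra.
Qed.

Lemma Rintegral_sum dT (Y : measurableType dT) (R : realType) (m : {measure set Y -> \bar R})
    (J : Type) (s : seq J) (P : pred J) (h : J -> Y -> R) :
  (forall j, P j -> m.-integrable setT (EFin \o h j)) ->
  m.-integrable setT (EFin \o (fun x => \sum_(j <- s | P j) h j x)) /\
  \int[m]_x (\sum_(j <- s | P j) h j x) = \sum_(j <- s | P j) \int[m]_x h j x.
Proof.
move=> ih; elim: s => [|j s [IHi IHe]].
  rewrite (_ : (fun x => _) = cst 0); last by apply/funext => x; rewrite big_nil.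
  split; first exact: integrable0.
  by rewrite big_nil /Rintegral integral0.
have -> : (fun x => \sum_(j <- j :: s | P j) h j x) = (fun x =>
    if P j then h j x + \sum_(j <- s | P j) h j x else \sum_(j <- s | P j) h j x).
  by apply/funext => x; rewrite big_cons.
rewrite big_cons; case: ifPn => Pj //.
split; first exact: (integrableD measurableT (ih j Pj) IHi).
by rewrite RintegralD// ?IHe//; exact: ih.
Qed.

Section second_moment.
Context {R : realType} {d : nat}.
Notation X := 'rV[R]_d.
Notation conf := (configuration R d).
Variables (Q : probability conf R) (Lam : {measure set X -> \bar R}).
Hypothesis QP : poisson_law Q Lam.
Variables (T : finType) (D : T -> set X).
Hypotheses (gD : forall s, good_set (D s)) (tD : trivIset setT D).
Variables (k : nat) (Psi : {set {ffun 'I_k -> T}}).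
Hypothesis Psi_inj : forall i, i \in Psi -> injective i.

Let lam s := mean Lam (D s).

Definition mixed_product (I : {set 'I_k}) (i : {ffun 'I_k -> T}) (mu : conf) : R :=
  \prod_a (if a \in I then npoints (D (i a)) mu else lam (i a)).

Definition outer_product (J : {set 'I_k}) (i : {ffun 'I_k -> T}) : R :=
  \prod_(a in ~: J) lam (i a).

(** Each count is written as its centred version plus its mean; J collects the
    places where the centred version is chosen. *)
Lemma mixed_productE I (i : {ffun 'I_k -> T}) mu : injective i ->
  mixed_product I i mu =
  \sum_(J : {set 'I_k} | J \subset I) chaos Lam D (i @: J) mu * outer_product J i.
Proof.
move=> ii; rewrite /mixed_product.
pose Fa a := if a \in I then npoints (D (i a)) mu - lam (i a) else 0.
rewrite (eq_bigr (fun a => Fa a + lam (i a))); last first.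
  by move=> a _; rewrite /Fa; case: ifP; rewrite ?subrK ?add0r.
rewrite bigA_distr [RHS]big_mkcond; apply: eq_bigr => J _.
case: ifPn => [/fintype.subsetP JI|/fintype.subsetPn[a aJ aI]]; last first.
  by rewrite (bigD1 a)//= aJ /Fa (negbTE aI) mul0r.
rewrite (bigID (mem J))/= /chaos big_imset/=; last by move=> a b _ _; exact: ii.
congr (_ * _).
  by apply: eq_bigr => a aJ; rewrite aJ /Fa JI.
rewrite /outer_product; apply: eq_big => a; rewrite ?inE//.
by move=> /negbTE ->.
Qed.

Definition sgn_subset (I1 I2 J : {set 'I_k}) : R := (J \subset I1)%:R - (J \subset I2)%:R.

Definition chaos_sum (J : {set 'I_k}) mu :=
  \sum_(i in Psi) chaos Lam D (i @: J) mu * outer_product J i.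

(** By [test_variable_covariance], pairing a functional with this variable
    averages the effect of adding the points in the places I1 instead of those
    in the places I2. *)
Definition test_variable (I1 I2 : {set 'I_k}) mu :=
  \sum_(i in Psi) (mixed_product I1 i mu - mixed_product I2 i mu).

(** The terms with J empty are the products of the means of all cells, which
    are the same for I1 and I2. *)
Lemma test_variableE I1 I2 mu : test_variable I1 I2 mu =
  \sum_(J : {set 'I_k} | J != finset.set0) sgn_subset I1 I2 J * chaos_sum J mu.
Proof.
rewrite /test_variable sumrB.
have e I : \sum_(i in Psi) mixed_product I i mu =
    \sum_(J : {set 'I_k}) (J \subset I)%:R * chaos_sum J mu.
  rewrite (eq_bigr (fun i : {ffun 'I_k -> T} => \sum_(J : {set 'I_k})
    (J \subset I)%:R * (chaos Lam D (i @: J) mu * outer_product J i))); last first.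
    move=> i iP; rewrite mixed_productE; last exact: Psi_inj.
    rewrite big_mkcond; apply: eq_bigr => J _.
    by case: ifP; rewrite ?mul1r ?mul0r.
  by rewrite exchange_big; apply: eq_bigr => J _; rewrite mulr_sumr.
rewrite !e -sumrB [RHS]big_mkcond; apply: eq_bigr => J _.
rewrite -mulrBl -/(sgn_subset I1 I2 J); case: eqVneq => // ->.
by rewrite /sgn_subset !finset.sub0set subrr mul0r.
Qed.

Definition cell_mass := \sum_(i in Psi) \prod_a lam (i a).

Let lam_ge0 s : 0 <= lam s. Proof. exact: mean_ge0. Qed.

(** By orthogonality only pairs of tuples with the same set of cells in the
    places J contribute. The variance of the common cells and the means in the
    other places of i combine to the mass of the tuple i. *)
Lemma chaos_sum_second_moment (J : {set 'I_k}) (K : R) :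
  (forall i, i \in Psi ->
    \sum_(i' in Psi | i' @: J == i @: J) outer_product J i' <= K) ->
  Q.-integrable setT (EFin \o (fun mu => chaos_sum J mu ^+ 2)) /\
  \int[Q]_mu (chaos_sum J mu ^+ 2) <= K * cell_mass.
Proof.
move=> HK.
pose h (i i' : {ffun 'I_k -> T}) mu := outer_product J i * outer_product J i' *
  (chaos Lam D (i @: J) mu * chaos Lam D (i' @: J) mu).
have ih i i' : Q.-integrable setT (EFin \o h i i').
  exact: (integrableZl measurableT _ (chaos_orthogonal QP gD tD (i @: J) (i' @: J)).1).
have E : (fun mu => chaos_sum J mu ^+ 2) =
    (fun mu => \sum_(i in Psi) \sum_(i' in Psi) h i i' mu).
  apply/funext => mu; rewrite expr2 /chaos_sum big_distrlr/=.
  by apply: eq_bigr => i _; apply: eq_bigr => i' _; rewrite /h; ring.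
have S i := Rintegral_sum (index_enum _) (P := mem Psi) (fun i' _ => ih i i').
have [iS ES] := Rintegral_sum (index_enum _) (P := mem Psi) (fun i _ => (S i).1).
rewrite E; split; first exact: iS.
rewrite ES /cell_mass mulr_sumr; apply: ler_sum => i iP.
rewrite (S i).2 (eq_bigr (fun i' : {ffun 'I_k -> T} => \prod_a lam (i a) *
   (if i' @: J == i @: J then outer_product J i' else 0))); last first.
  move=> i' i'P; rewrite /h RintegralZl//; last first.
    exact: (chaos_orthogonal QP gD tD (i @: J) (i' @: J)).1.
  rewrite (chaos_orthogonal QP gD tD (i @: J) (i' @: J)).2 eq_sym.
  case: ifP => _; last by rewrite !mulr0.
  rewrite big_imset/=; last by move=> a b _ _; exact: Psi_inj.
  rewrite mulrAC (mulrC (outer_product J i)); congr (_ * _).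
  rewrite [RHS](bigID (mem J))/=; congr (_ * _).
  by apply: eq_bigl => a; rewrite inE.
rewrite -mulr_sumr -big_mkcondr mulrC ler_wpM2r ?prodr_ge0//.
exact: HK.
Qed.

Lemma chaos_sum_mean0 J : J != finset.set0 ->
  Q.-integrable setT (EFin \o chaos_sum J) /\ \int[Q]_mu chaos_sum J mu = 0.
Proof.
move=> J0; pose h (i : {ffun 'I_k -> T}) mu := outer_product J i * chaos Lam D (i @: J) mu.
have ih i : Q.-integrable setT (EFin \o h i) /\ \int[Q]_mu h i mu = 0.
  have [] := chaos_mean0 QP gD tD (S := i @: J).
    by rewrite imset_eq0.
  move=> ic Ec; split; first exact: (integrableZl measurableT _ ic).
  by rewrite /h RintegralZl// Ec mulr0.
have -> : chaos_sum J = (fun mu => \sum_(i in Psi) h i mu).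
  by apply/funext => mu; apply: eq_bigr => i _; rewrite mulrC.
have [iS ES] := Rintegral_sum (index_enum _) (P := mem Psi) (fun i _ => (ih i).1).
split; first exact: iS.
by rewrite ES big1// => i _; rewrite (ih i).2.
Qed.

Variables (I1 I2 : {set 'I_k}) (K : R).
Hypothesis K0 : 0 <= K.
Hypothesis HK : forall J : {set 'I_k}, J != finset.set0 -> forall i, i \in Psi ->
    \sum_(i' in Psi | i' @: J == i @: J) outer_product J i' <= K.

Notation G := (test_variable I1 I2).

Lemma test_variable_mean0 :
  Q.-integrable setT (EFin \o G) /\ \int[Q]_mu G mu = 0.
Proof.
have ih (J : {set 'I_k}) : J != finset.set0 ->
    Q.-integrable setT (EFin \o (fun mu => sgn_subset I1 I2 J * chaos_sum J mu)) /\
    \int[Q]_mu (sgn_subset I1 I2 J * chaos_sum J mu) = 0.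
  move=> /chaos_sum_mean0[ic Ec]; split; first exact: (integrableZl measurableT _ ic).
  by rewrite RintegralZl// Ec mulr0.
have -> : G = (fun mu => \sum_(J : {set 'I_k} | J != finset.set0) sgn_subset I1 I2 J * chaos_sum J mu).
  by apply/funext => mu; rewrite test_variableE.
have [iS ES] := Rintegral_sum (index_enum _) (fun J J0 => (ih J J0).1).
split; first exact: iS.
by rewrite ES big1// => J J0; rewrite (ih J J0).2.
Qed.

(** Of the factor 4^k, one factor 2^k is the loss in the Cauchy-Schwarz
    inequality over the sets J, and the other one counts these sets. *)
Lemma test_variable_second_moment :
  Q.-integrable setT (EFin \o (fun mu => G mu ^+ 2)) /\
  \int[Q]_mu (G mu ^+ 2) <= 4 ^+ k * K * cell_mass.
Proof.
have cardS : #|{: {set 'I_k}}| = (2 ^ k)%N.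
  by rewrite -cardsT -powersetT card_powerset cardsT card_ord.
pose P := [pred J : {set 'I_k} | J != finset.set0].
have ih (J : {set 'I_k}) : P J -> _ := fun J0 => @chaos_sum_second_moment J K (HK J0).
have [iS ES] := Rintegral_sum (index_enum _) (fun J J0 => (ih J J0).1).
have iS2 := integrableZl measurableT (2 ^+ k) iS.
have le mu : G mu ^+ 2 <= 2 ^+ k * \sum_(J | P J) chaos_sum J mu ^+ 2.
  rewrite test_variableE; apply: (le_trans (sqr_sum_le _ _)).
  apply: ler_pM; rewrite ?ler0n ?sumr_ge0//.
  - by move=> J _; exact: sqr_ge0.
  - by rewrite -natrX ler_nat (leq_trans (max_card _))// cardS.
  - apply: ler_sum => J _; rewrite exprMn ler_piMl ?sqr_ge0//.
    by rewrite /sgn_subset; case: (_ \subset _); case: (_ \subset _); rewrite /=; lra.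
have iG : Q.-integrable setT (EFin \o (fun mu => G mu ^+ 2)).
  apply: (le_integrable measurableT _ _ iS2).
    apply/measurable_EFinP; apply: measurable_funX.
    by apply/measurable_EFinP; exact: (measurable_int _ test_variable_mean0.1).
  move=> mu _ /=; rewrite lee_fin ger0_norm ?sqr_ge0//.
  by apply: (le_trans (le mu)); exact: ler_norm.
split => //.
apply: (le_trans (le_Rintegral measurableT iG iS2 _)); first by move=> mu _; exact: le.
rewrite RintegralZl// ES.
have -> : (4 : R) ^+ k * K * cell_mass = 2 ^+ k * (2 ^+ k * (K * cell_mass)).
  by rewrite !mulrA -exprMn; congr (_ ^+ _ * _ * _); ring.
rewrite ler_wpM2l ?exprn_ge0//.
have c0 : 0 <= cell_mass by apply: sumr_ge0 => i _; exact: prodr_ge0.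
apply: (@le_trans _ _ (\sum_(J | P J) K * cell_mass)).
  by apply: ler_sum => J J0; exact: (ih J J0).2.
rewrite sumr_const -[X in X <= _]mulr_natl ler_wpM2r//.
  by rewrite mulr_ge0.
by rewrite -natrX ler_nat (leq_trans (max_card _))// cardS.
Qed.

End second_moment.

(** * Counting tuples of cells with a common set of cells *)

Section fibres.
Context {R : realType} {T : finType} (k : nat) (lam : T -> R).
Hypothesis lam_ge0 : forall s, 0 <= lam s.

(** Outside J the permutation is the identity, which makes it one of only |J|!
    permutations. *)
Lemma imset_eq_perm (i i' : {ffun 'I_k -> T}) (J : {set 'I_k}) :
  injective i' -> i' @: J = i @: J ->
  exists2 sg : {perm 'I_k}, perm_on J sg & forall a, a \in J -> i' a = i (sg a).
Proof.
move=> inj' e.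
have pick_a a : a \in J -> exists2 b, b \in J & i b = i' a.
  move=> aJ; have : i' a \in i @: J by rewrite -e imset_f.
  by case/imsetP => b bJ ->; exists b.
pose f a := if a \in J then odflt a [pick b in J | i b == i' a] else a.
have fP a : a \in J -> f a \in J /\ i (f a) = i' a.
  move=> aJ; rewrite /f aJ; case: pickP => [b /andP[bJ /eqP ib]|H] //=.
  by have [b bJ ib] := pick_a a aJ; have := H b; rewrite bJ ib eqxx.
have finj : injective f.
  move=> a b; have [aJ|aJ] := boolP (a \in J); have [bJ|bJ] := boolP (b \in J).
  - move=> fab; have [_ ea] := fP a aJ; have [_ eb] := fP b bJ.
    by apply: inj'; rewrite -ea fab eb.
  - move=> fab; have [fa _] := fP a aJ; move: fa; rewrite fab.
    by rewrite {1}/f (negbTE bJ) (negbTE bJ).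
  - move=> fab; have [fb _] := fP b bJ; move: fb; rewrite -fab.
    by rewrite {1}/f (negbTE aJ) (negbTE aJ).
  - by rewrite /f (negbTE aJ) (negbTE bJ).
exists (perm finj).
  apply/fintype.subsetP => a; rewrite !inE permE /f.
  by case: ifP => // _; rewrite eqxx.
by move=> a aJ; rewrite permE; have [] := fP a aJ.
Qed.

Variables (Psi : {set {ffun 'I_k -> T}}).
Hypothesis Psi_inj : forall i, i \in Psi -> injective i.
Variable near : 'I_k -> 'I_k -> rel T.
Hypothesis nearP : forall i a b, i \in Psi -> near a b (i a) (i b).
Variables (M K : R).
Hypothesis M0 : 0 <= M.
Hypothesis nearM : forall a b s, \sum_(s' | near a b s' s) lam s' <= M.
Hypothesis MK : forall j, (0 < j <= k)%N -> M ^+ (k - j) <= K.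

(** A tuple i' in the sum agrees on J with i up to a permutation of J, and there
    are at most k! of these. Its entries outside J are near to i' b, where b is
    a fixed place in J, and i' b is one of the entries of i. Each of them thus
    contributes at most M. *)
Lemma fibre_sum_le (J : {set 'I_k}) i : J != finset.set0 -> i \in Psi ->
  \sum_(i' in Psi | i' @: J == i @: J) \prod_(a in ~: J) lam (i' a) <= k`!%:R * K.
Proof.
move=> /finset.set0Pn[b bJ] iP.
(* The weight of s in place a: it forces s = i (sg a) in the places J, and s
   near to i (sg b) elsewhere; the sum over all tuples then factors over the
   places. *)
pose w (sg : {perm 'I_k}) a s := if a \in J then (s == i (sg a))%:R
  else if near a b s (i (sg b)) then lam s else 0.
have w0 sg a s : 0 <= w sg a s by rewrite /w; case: ifP => _; [|case: ifP].
have cardJ : (0 < #|J| <= k)%N.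
  rewrite card_gt0; apply/andP; split; first by apply/finset.set0Pn; exists b.
  by rewrite -[X in (_ <= X)%N](card_ord k) max_card.
have K0 : 0 <= K by apply: le_trans (MK cardJ); exact: exprn_ge0.
apply: (@le_trans _ _ (\sum_(i' : {ffun 'I_k -> T})
    \sum_(sg : {perm 'I_k} | perm_on J sg) \prod_a w sg a (i' a))).
  rewrite big_mkcond; apply: ler_sum => i' _; case: ifPn => [/andP[i'P /eqP e]|_]; last first.
    by apply: sumr_ge0 => sg _; apply: prodr_ge0.
  have [sg sgJ sgE] := imset_eq_perm (Psi_inj i'P) e.
  rewrite (bigD1 sg)//= [X in _ <= X + _](_ : _ = \prod_(a in ~: J) lam (i' a)).
    by rewrite lerDl; apply: sumr_ge0 => sg' _; apply: prodr_ge0.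
  rewrite (bigID (mem J))/= big1 ?mul1r; last first.
    by move=> a aJ; rewrite /w aJ sgE// eqxx.
  apply: eq_big => a; first by rewrite inE.
  by move=> aJ; rewrite /w (negbTE aJ) -sgE// nearP.
rewrite exchange_big/=.
apply: (@le_trans _ _ (\sum_(sg : {perm 'I_k} | perm_on J sg) K)).
  apply: ler_sum => sg sgJ; rewrite -(bigA_distr_bigA (w sg)) /=.
  apply: le_trans (MK cardJ).
  rewrite (bigID (mem J))/= [X in X * _]big1 ?mul1r; last first.
    move=> a aJ; rewrite (bigD1 (i (sg a)))//= big1 ?addr0; first by rewrite /w aJ eqxx.
    by move=> s /negbTE sa; rewrite /w aJ sa.
  have -> : M ^+ (k - #|J|) = \prod_(a | a \notin J) M.
    rewrite prodr_const; congr (_ ^+ _).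
    rewrite -[X in (X - _)%N](card_ord k) -(cardC (mem J)) addKn.
    by apply: eq_card => a; rewrite !inE.
  apply: ler_prod => a aJ; rewrite sumr_ge0//=.
  apply: le_trans (nearM a b (i (sg b))); rewrite [X in _ <= X]big_mkcond.
  by apply: ler_sum => s _; rewrite /w (negbTE aJ).
rewrite sumr_const -[X in X <= _]mulr_natl ler_wpM2r// ler_nat.
rewrite card_perm; have /andP[_ Jk] := cardJ.
exact: leq_fact.
Qed.

End fibres.

(** The discriminant of a nonnegative quadratic polynomial in s; this form
    of the Cauchy-Schwarz inequality serves both for the variance and for the
    Euclidean norm. *)
Lemma quadratic_le (R : realFieldType) (C V K : R) : 0 <= V -> 0 <= K ->
  (forall s, 2 * s * C <= V + s ^+ 2 * K) -> C ^+ 2 <= V * K.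
Proof.
move=> V0; rewrite le_eqVlt => /predU1P[<-|K0] H.
  have [->|C0] := eqVneq C 0; first by rewrite expr0n mulr0.
  (* For K = 0 the polynomial is linear in s, and C must vanish. *)
  have := H ((V + 1) / C); rewrite mulr0 addr0.
  by rewrite -mulrA divfK//; lra.
have := H (C / K).
have -> : 2 * (C / K) * C = 2 * (C ^+ 2 / K) by rewrite expr2; ring.
have -> : (C / K) ^+ 2 * K = C ^+ 2 / K by field; rewrite gt_eqF.
by move=> {}H; rewrite -ler_pdivrMr//; lra.
Qed.

(** * The covariance with the test variable *)

Section covariance.
Context {R : realType} {d : nat}.
Notation X := 'rV[R]_d.
Notation conf := (configuration R d).
Variables (Q : probability conf R) (Lam : {measure set X -> \bar R}).
Hypothesis QP : poisson_law Q Lam.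
Variables (W : set X) (gW : good_set W).
Variables (f : conf -> R) (b : R).
Hypotheses (mf : measurable_fun setT f) (f0 : forall mu, 0 <= f mu) (fb : forall mu, f mu <= b).

Definition shifted_mean k (I : {set 'I_k}) (x : 'M[R]_(k, d)) : R :=
  \int[Q]_mu f (add_points mu I x).

Lemma measurable_add_points_at k (I : {set 'I_k}) (x : 'M[R]_(k, d)) :
  measurable_fun setT (fun mu : conf => add_points mu I x).
Proof. exact: (measurableT_comp (measurable_add_points _) (@measurable_pair1 _ _ _ _ x)). Qed.

Lemma integrable_shift k (I : {set 'I_k}) (x : 'M[R]_(k, d)) :
  Q.-integrable setT (EFin \o (fun mu => f (add_points mu I x))).
Proof.
apply: (@measurable_bounded_integrable _ _ _ Q) => //.
- exact: (le_lt_trans (probability_le1 Q measurableT) (ltry _)).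
- exact: (measurableT_comp mf (measurable_add_points_at _ _)).
- exists b; split; first exact: num_real.
  by move=> M bM mu _ /=; rewrite ger0_norm//; apply: le_trans (fb _) (ltW bM).
Qed.

Lemma integral_shift k (I : {set 'I_k}) (x : 'M[R]_(k, d)) :
  (\int[Q]_mu (f (add_points mu I x))%:E = (shifted_mean I x)%:E)%E.
Proof.
rewrite /shifted_mean /Rintegral fineK//.
exact: (integrable_fin_num measurableT (integrable_shift I x)).
Qed.

Lemma shifted_mean_ge0 k (I : {set 'I_k}) (x : 'M[R]_(k, d)) : 0 <= shifted_mean I x.
Proof. exact: Rintegral_ge0. Qed.

Lemma shifted_mean_le k (I : {set 'I_k}) (x : 'M[R]_(k, d)) : shifted_mean I x <= b.
Proof.
have ib : Q.-integrable setT (EFin \o (cst b : conf -> R)) by exact: finite_measure_integrable_cst.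
apply: (le_trans (le_Rintegral measurableT (integrable_shift I x) ib _)) => //.
by rewrite (Rintegral_cst Q measurableT) (congr1 fine (probability_setT Q)) mulr1.
Qed.

Lemma measurable_shifted_mean k (I : {set 'I_k}) :
  measurable_fun setT (@shifted_mean k I).
Proof.
apply/measurable_EFinP.
rewrite (_ : EFin \o _ = (fun x => \int[Q]_mu (f (add_points mu I x))%:E)%E); last first.
  by apply/funext => x; rewrite integral_shift.
apply: (measurable_fun_fubini_tonelli_F
    (fun p : 'M[R]_(k, d) * conf => (f (add_points p.2 I p.1))%:E)) => //.
  apply/measurable_EFinP; exact: (measurableT_comp mf (@measurable_add_points R d k I)).
by move=> p; rewrite lee_fin.
Qed.

Variables (T : finType) (D : T -> set X).
Hypotheses (mD : forall s, measurable (D s)) (DW : forall s, D s `<=` W) (tD : trivIset setT D).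
Variables (k : nat) (Psi : {set {ffun 'I_k -> T}}).
Hypothesis Psi_inj : forall i, i \in Psi -> injective i.

Let gD s : good_set (D s) := good_subset (mD s) (DW (s := s)) gW.

Notation nu := (power_measure (window_measure QP gW) k).
Definition cells (i : {ffun 'I_k -> T}) : set 'M[R]_(k, d) := rect (fun a => D (i a)).
Definition cell_union : set 'M[R]_(k, d) := \bigcup_(i in [set i | i \in Psi]) cells i.

Lemma measurable_cells i : measurable (cells i).
Proof. by apply: measurable_rect. Qed.

Lemma trivIset_cells : trivIset setT cells.
Proof.
move=> i i' _ _ [x [xi xi']]; apply/ffunP => a.
by apply: tD => //; exists (row a x); split; [exact: xi|exact: xi'].
Qed.

Lemma nu_cells i : nu (cells i) = (\prod_a mean Lam (D (i a)))%:E.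
Proof.
rewrite [LHS]power_measure_rect//.
transitivity (\prod_a Lam (D (i a)))%E.
  by apply: eq_bigr => a _; exact: window_measureE.
transitivity (\prod_a (mean Lam (D (i a)))%:E)%E.
  by apply: eq_bigr => a _; rewrite (meanE QP).
by rewrite prodEFin.
Qed.

Lemma nu_cell_union : nu cell_union = (cell_mass Lam D Psi)%:E.
Proof.
rewrite [LHS](measure_finite_bigcup nu (mem Psi) measurable_cells trivIset_cells).
rewrite /cell_mass -sumEFin.
by apply: eq_bigr => i _; exact: nu_cells.
Qed.

(** This is [multivariate_mecke]: the counts in the places I add the points of
    these places to the configuration. *)
Lemma mixed_product_mean (I : {set 'I_k}) i : i \in Psi ->
  Q.-integrable setT (EFin \o (fun mu => f mu * mixed_product Lam D I i mu)) /\
  (\int[Q]_mu (f mu * mixed_product Lam D I i mu))%:E =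
  (\int[nu]_(x in cells i) (shifted_mean I x)%:E)%E.
Proof.
move=> iP.
have tDi : trivIset setT (fun a => D (i a)).
  by move=> a a' _ _ /tD h; exact: (Psi_inj iP (h Logic.I Logic.I)).
have mixed_ge0 mu : 0 <= mixed_product Lam D I i mu.
  by apply: prodr_ge0 => a _; case: ifP => _; [exact: npoints_ge0|exact: mean_ge0].
have mmixed : measurable_fun setT (fun mu => f mu * mixed_product Lam D I i mu).
  apply: measurable_funM => //; apply: measurable_prod => a _.
  by case: (a \in I) => //; exact: measurable_npoints.
have e : (\int[Q]_mu (f mu * mixed_product Lam D I i mu)%:E =
    \int[nu]_(x in cells i) (shifted_mean I x)%:E)%E.
  transitivity (\int[nu]_(x in cells i) \int[Q]_mu (f (add_points mu I x))%:E)%E; last first.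
    by apply: eq_integral => x _; exact: integral_shift.
  rewrite (multivariate_mecke QP gW I (B := fun a => D (i a)) (f := EFin \o f))//.
  - rewrite -ge0_integralZr//.
    + apply: eq_integral => mu _ /=.
      rewrite -muleA EFinM; congr (_ * _)%E.
      rewrite /mixed_product -prodEFin (bigID (mem I))/=; congr (_ * _)%E.
        by apply: eq_bigr => a aI; rewrite aI npointsE.
      apply: eq_big => [a|a aI]; first by rewrite inE.
      by rewrite (negbTE aI) (meanE QP).
    + apply: emeasurable_funM; first exact/measurable_EFinP.
      by apply: emeasurable_prod => a; exact: measurable_count.
    + by move=> mu _; rewrite mule_ge0 ?lee_fin// prode_ge0.
    + by apply: prode_ge0.
  - exact/measurable_EFinP.
have fin : (\int[Q]_mu (f mu * mixed_product Lam D I i mu)%:E < +oo)%E.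
  rewrite e; apply: (@le_lt_trans _ _ (\int[nu]_(x in cells i) b%:E)%E).
    apply: ge0_le_integral => //.
    - exact: measurable_cells.
    - by move=> x _; rewrite lee_fin shifted_mean_ge0.
    - apply: measurable_funTS; apply/measurable_EFinP; exact: measurable_shifted_mean.
    - by move=> x _; rewrite lee_fin shifted_mean_le.
  rewrite integral_cst; last exact: measurable_cells.
  by rewrite [X in (_ * X)%E]nu_cells -EFinM ltry.
split.
  apply/integrableP; split; first exact/measurable_EFinP.
  rewrite (eq_integral (fun mu => (f mu * mixed_product Lam D I i mu)%:E))//.
  by move=> mu _ /=; rewrite ger0_norm// mulr_ge0.
rewrite -e /Rintegral fineK// ge0_fin_numE//.
by apply: integral_ge0 => mu _; rewrite lee_fin mulr_ge0.
Qed.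

Variables (I1 I2 : {set 'I_k}).
Notation G := (test_variable Lam D Psi I1 I2).

(** For the law of the process, the expectation in the definition of
    [add_cost_diff] without the absolute value. *)
Definition shift_gap x := shifted_mean I1 x - shifted_mean I2 x.

Lemma shifted_mean_integrable (I : {set 'I_k}) A : measurable A ->
  nu.-integrable A (EFin \o shifted_mean I).
Proof.
move=> mA; apply: (@measurable_bounded_integrable _ _ _ nu) => //.
- by rewrite ltey_eq fin_num_measure.
- apply: measurable_funTS; exact: measurable_shifted_mean.
- exists b; split; first exact: num_real.
  move=> M bM x _ /=; rewrite ger0_norm ?shifted_mean_ge0//.
  exact: le_trans (shifted_mean_le _ _) (ltW bM).
Qed.

Lemma test_variable_covariance :
  Q.-integrable setT (EFin \o (fun mu => f mu * G mu)) /\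
  \int[Q]_mu (f mu * G mu) = \int[nu]_(x in cell_union) shift_gap x.
Proof.
pose h (i : {ffun 'I_k -> T}) mu := f mu * mixed_product Lam D I1 i mu - f mu * mixed_product Lam D I2 i mu.
have ih i : i \in Psi -> Q.-integrable setT (EFin \o h i) /\
    \int[Q]_mu h i mu = \int[nu]_(x in cells i) shift_gap x.
  move=> iP; have [i1 E1] := mixed_product_mean I1 iP.
  have [i2 E2] := mixed_product_mean I2 iP.
  split; first exact: (integrableB measurableT i1 i2).
  rewrite RintegralB// RintegralB.
  - by congr (_ - _); apply: EFin_inj; rewrite ?E1 ?E2 /Rintegral fineK//;
      apply: integrable_fin_num => //; try exact: measurable_cells;
      apply: shifted_mean_integrable; exact: measurable_cells.
  - exact: measurable_cells.
  - apply: shifted_mean_integrable; exact: measurable_cells.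
  - apply: shifted_mean_integrable; exact: measurable_cells.
have -> : (fun mu => f mu * G mu) = (fun mu => \sum_(i in Psi) h i mu).
  apply/funext => mu; rewrite /test_variable mulr_sumr.
  by apply: eq_bigr => i _; rewrite mulrBr.
have [iS ES] := Rintegral_sum (index_enum _) (P := mem Psi) (fun i iP => (ih i iP).1).
split; first exact: iS.
rewrite ES.
have mU : measurable cell_union.
  exact: (measurable_finite_bigcup (mem Psi) measurable_cells).
have U I : \int[nu]_(x in cell_union) shifted_mean I x =
    \sum_(i in Psi) \int[nu]_(x in cells i) shifted_mean I x.
  apply: EFin_inj; rewrite -sumEFin /Rintegral fineK; last first.
    by apply: integrable_fin_num => //; exact: shifted_mean_integrable.
  rewrite (ge0_integral_finite_bigcup nu (mem Psi) measurable_cells trivIset_cells (f := EFin \o shifted_mean I)).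
  - apply: eq_bigr => i _; rewrite fineK//.
    apply: integrable_fin_num => //; first exact: measurable_cells.
    by apply: shifted_mean_integrable; exact: measurable_cells.
  - apply/measurable_EFinP; exact: measurable_shifted_mean.
  - by move=> x; rewrite lee_fin shifted_mean_ge0.
rewrite RintegralB//; try exact: shifted_mean_integrable.
rewrite !U -sumrB; apply: eq_bigr => i iP; rewrite (ih i iP).2 RintegralB//.
- exact: measurable_cells.
- by apply: shifted_mean_integrable; exact: measurable_cells.
- by apply: shifted_mean_integrable; exact: measurable_cells.
Qed.

Variables (K : R).
Hypothesis K0 : 0 <= K.
Hypothesis HK : forall J : {set 'I_k}, J != finset.set0 -> forall i, i \in Psi ->
    \sum_(i' in Psi | i' @: J == i @: J) outer_product Lam D J i' <= K.

(** Duality between the functional and the test variable. As the latter is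
    centred, the functional may be centred at any constant a; this leaves room
    for the truncated functionals, whose means are not known. *)
Lemma discrete_variance_bound (a V : R) :
  \int[Q]_mu ((f mu - a) ^+ 2) <= V ->
  (\int[nu]_(x in cell_union) shift_gap x) ^+ 2 <=
  V * (4 ^+ k * K * cell_mass Lam D Psi).
Proof.
move=> HV.
have [iG EG] := test_variable_mean0 QP gD tD Psi_inj I1 I2.
have [iG2 EG2] := test_variable_second_moment QP gD tD Psi_inj I1 I2 K0 HK.
have [ifG EfG] := test_variable_covariance.
have if2 : Q.-integrable setT (EFin \o (fun mu => (f mu - a) ^+ 2)).
  apply: (@measurable_bounded_integrable _ _ _ Q) => //.
  - exact: (le_lt_trans (probability_le1 Q measurableT) (ltry _)).
  - by apply: measurable_funX; exact: measurable_funB.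
  - exists ((b + `|a|) ^+ 2); split; first exact: num_real.
    move=> M bM mu _ /=; apply: le_trans (ltW bM).
    rewrite normrX lerXn2r ?nnegrE ?addr_ge0//.
      exact: le_trans (f0 mu) (fb mu).
    by apply: (le_trans (ler_normB _ _)); rewrite lerD2r ger0_norm.
have V0 : 0 <= V by apply: le_trans HV; apply: Rintegral_ge0 => mu _; exact: sqr_ge0.
have c0 : 0 <= cell_mass Lam D Psi.
  by apply: sumr_ge0 => i _; apply: prodr_ge0 => j _; exact: mean_ge0.
apply: quadratic_le => //; first by rewrite !mulr_ge0// exprn_ge0.
move=> s; rewrite -EfG.
have iaG := integrableZl measurableT a iG.
have iXG := integrableB measurableT ifG iaG.
have iXGs := integrableZl measurableT (2 * s) iXG.
have iG2s := integrableZl measurableT (s ^+ 2) iG2.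
have e : \int[Q]_mu (f mu * G mu) = \int[Q]_mu (f mu * G mu - a * G mu).
  by rewrite RintegralB// RintegralZl// EG mulr0 subr0.
rewrite e -RintegralZl//.
apply: (@le_trans _ _ (\int[Q]_mu ((f mu - a) ^+ 2 + s ^+ 2 * G mu ^+ 2))).
  apply: le_Rintegral => //; first exact: (integrableD measurableT if2 iG2s).
  by move=> mu _; have := sqr_ge0 ((f mu - a) - s * G mu); nra.
rewrite RintegralD// RintegralZl//; apply: lerD => //.
by rewrite ler_wpM2l ?sqr_ge0.
Qed.

End covariance.

(** * Approximation of sets of tuples by products of cells *)

Lemma ecvg0_near_le (R : realType) (u : (\bar R)^nat) (e : R) :
  u @ \oo --> 0%E -> 0 < e -> \forall n \near \oo, (u n <= e%:E)%E.
Proof.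
move=> u0 e0; apply: (filterS (P := [set n | (u n < e%:E)%E])).
  by move=> n /ltW.
apply: (u0 [set y | (y < e%:E)%E]); apply: open_nbhs_nbhs; split.
  exact: open_ereal_lt_ereal.
by rewrite /= lte_fin.
Qed.

Section approximation.
Context {R : realType} {d k : nat}.
Notation X := 'rV[R]_d.
Notation Y := 'M[R]_(k, d).
Variable nu : {finite_measure set Y -> \bar R}.

Definition symdiff (U : Type) (A B : set U) := (A `\` B) `|` (B `\` A).

Definition measurable_partition (T : finType) (c : X -> T) :=
  forall s, measurable (c @^-1` [set s]).

(** The finite unions of products of cells of the partition given by the fibres
    of c. *)
Definition saturated (T : finType) (c : X -> T) (phi : pred {ffun 'I_k -> T}) : set Y :=
  [set x | phi [ffun a => c (row a x)]].

Lemma measurable_saturated (T : finType) (c : X -> T) phi :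
  measurable_partition c -> measurable (saturated c phi).
Proof.
move=> mc; rewrite [X in measurable X](_ : _ =
    \bigcup_(i in [set i | phi i]) rect (fun a => c @^-1` [set i a])).
  by apply: fin_bigcup_measurable => // i _; apply: measurable_rect => a; exact: mc.
apply/seteqP; split => [x Px|x [i /= Pi] xi].
  by exists [ffun a => c (row a x)] => // a; rewrite /= ffunE.
rewrite /saturated/= (_ : [ffun _ => _] = i)//.
by apply/ffunP => a; rewrite ffunE; exact: xi.
Qed.

Definition approximable (E : set Y) := measurable E /\
  forall e : R, 0 < e -> exists (T : finType) (c : X -> T) phi,
    measurable_partition c /\ (nu (symdiff E (saturated c phi)) <= e%:E)%E.

Lemma measurable_symdiff (A B : set Y) : measurable A -> measurable B -> measurable (symdiff A B).
Proof. by move=> mA mB; apply: measurableU; exact: measurableD. Qed.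

Lemma approximable0 : approximable set0.
Proof.
split => // e e0; exists unit, (fun=> tt), xpred0; split.
  by move=> []; rewrite (_ : _ @^-1` _ = setT)//; apply/seteqP.
rewrite (_ : symdiff _ _ = set0) ?measure0 ?lee_fin ?ltW//.
by apply/seteqP; split => x // [[]|[]].
Qed.

Lemma approximableC E : approximable E -> approximable (~` E).
Proof.
move=> [mE aE]; split => [|e e0]; first exact: measurableC.
have [T [c [phi [mc He]]]] := aE e e0.
exists T, c, (fun i => ~~ phi i); split => //.
rewrite (_ : symdiff _ _ = symdiff E (saturated c phi))//.
apply/seteqP; split => x; rewrite /symdiff /saturated /= => -[[H1 H2]|[H1 H2]].
- by right; split => //; apply/negPn/negP.
- by left; split; [exact: contrapT|exact/negP].
- by right; split => //; exact/negP.
- by left; split => //; rewrite H1.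
Qed.

Lemma approximableU E F : approximable E -> approximable F -> approximable (E `|` F).
Proof.
move=> [mE aE] [mF aF]; split => [|e e0]; first exact: measurableU.
have e2 : 0 < e / 2 by rewrite divr_gt0.
have [T [c [phi [mc He]]]] := aE _ e2.
have [T' [c' [phi' [mc' He']]]] := aF _ e2.
exists (T * T')%type, (fun x => (c x, c' x)).
exists (fun i => phi [ffun a => (i a).1] || phi' [ffun a => (i a).2]); split.
  move=> [s s']; rewrite (_ : _ @^-1` _ = c @^-1` [set s] `&` c' @^-1` [set s']).
    by apply: measurableI; [exact: mc|exact: mc'].
  by apply/seteqP; split => x /= => [[-> ->]|[-> ->]].
rewrite [e]splitr EFinD; apply: le_trans (leeD He He').
apply: le_trans (measureU2 _ _ _); last 2 first.
- by apply: measurable_symdiff => //; exact: measurable_saturated.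
- by apply: measurable_symdiff => //; exact: measurable_saturated.
set S := saturated _ _.
have SE : S = saturated c phi `|` saturated c' phi'.
  have h (x : Y) : ([ffun a => ([ffun a0 => (c (row a0 x), c' (row a0 x))] a).1] = [ffun a => c (row a x)]) *
    ([ffun a => ([ffun a0 => (c (row a0 x), c' (row a0 x))] a).2] = [ffun a => c' (row a x)]).
    by split; apply/ffunP => a; rewrite !ffunE.
  by apply/seteqP; split => x; rewrite /S /saturated /= !h => /orP.
have mS : measurable S by rewrite SE; apply: measurableU; exact: measurable_saturated.
apply: le_measure; rewrite ?inE.
- by apply: measurable_symdiff => //; exact: measurableU.
- by apply: measurableU; apply: measurable_symdiff => //; exact: measurable_saturated.
by rewrite SE => x [[[Ex|Fx] /not_orP[n1 n2]]|[[sx|sx] /not_orP[n1 n2]]];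
  [left; left|right; left|left; right|right; right].
Qed.

Lemma approximable_bigcup (F : (set Y)^nat) : (forall n, approximable (F n)) ->
  approximable (\bigcup_n F n).
Proof.
move=> aF; have mF n : measurable (F n) := (aF n).1.
pose S n := \big[setU/set0]_(i < n) F i.
have aS n : approximable (S n).
  rewrite /S; elim: n => [|n IH]; first by rewrite big_ord0; exact: approximable0.
  by rewrite big_ord_recr/=; exact: approximableU.
have mS n : measurable (S n) := (aS n).1.
have mU : measurable (\bigcup_n F n) by exact: bigcupT_measurable.
split => // e e0; have e2 : 0 < e / 2 by rewrite divr_gt0.
have USF : \bigcup_n S n = \bigcup_n F n.
  apply/seteqP; split => x [n _].
    by rewrite /S -bigcup_mkord => -[i _ Fx]; exists i.
  by move=> Fx; exists n.+1 => //; rewrite /S big_ord_recr; right.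
have ndS : {homo S : n m / (n <= m)%N >-> (n <= m)%O}.
  by move=> n m nm; rewrite subsetEset; exact: subset_bigsetU.
have cv : nu ((\bigcup_n F n) `\` S n) @[n --> \oo] --> 0%E.
  rewrite -(measure0 nu); have <- : \bigcap_n ((\bigcup_n F n) `\` S n) = set0.
    apply/seteqP; split => x // H.
    have [[n _ Fx] _] := H 0%N Logic.I; have [_] := H n.+1 Logic.I; apply.
    by rewrite /S big_ord_recr; right.
  apply: nonincreasing_cvg_mu.
  - by rewrite ltey_eq fin_num_measure//; exact: measurableD.
  - by move=> n; exact: measurableD.
  - by apply: bigcapT_measurable => n; exact: measurableD.
  - by move=> n m nm; rewrite subsetEset; apply: setDS; rewrite -subsetEset; exact: ndS.
have [n _ /(_ n (leqnn n)) /= Hn] := ecvg0_near_le cv e2.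
have [T [c [phi [mc Hc]]]] := (aS n).2 _ e2.
exists T, c, phi; split => //.
have mP := measurable_saturated phi mc.
rewrite [e]splitr EFinD; apply: le_trans (leeD Hn Hc).
apply: le_trans (measureU2 _ _ _); last 2 first.
- exact: measurableD.
- exact: measurable_symdiff.
apply: le_measure; rewrite ?inE.
- exact: measurable_symdiff.
- by apply: measurableU; [exact: measurableD|exact: measurable_symdiff].
move=> x [[Fx nx]|[sx nx]].
  by have [Sx|Sx] := pselect (S n x); [right; left|left].
right; right; split => // Sx; apply: nx.
by rewrite -USF; exists n.
Qed.

(** The approximable sets form a sigma-field: two partitions have a common
    refinement, and a countable union is close to a finite one for a finite
    measure. They contain the events on one coordinate of one point, which
    generate the sigma-field of the tuples. *)
Lemma measurable_approximable E : measurable E -> approximable E.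
Proof.
move=> mE; move: E mE; apply: smallest_sub.
  split; first exact: approximable0.
  - by move=> A; rewrite setTD; exact: approximableC.
  - exact: approximable_bigcup.
move=> _ [[a j] _ [B mB <-]]; rewrite setTI; split.
  by rewrite -[X in measurable X]setTI; exact: measurable_entry.
move=> e e0; exists bool, (fun x : X => x ord0 j \in B), (fun i => i a); split.
  have mBj : measurable ((fun x : X => x ord0 j) @^-1` B).
    by rewrite -[X in measurable X]setTI; exact: measurable_entry.
  case.
    rewrite (_ : _ @^-1` _ = (fun x : X => x ord0 j) @^-1` B)//.
    by apply/seteqP; split => x /=; [move/set_mem|move/mem_set].
  rewrite (_ : _ @^-1` _ = ~` ((fun x : X => x ord0 j) @^-1` B)); first exact: measurableC.
  apply/seteqP; split => x /=; first by move/negbT; rewrite notin_setE.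
  by move=> ?; apply: memNset.
rewrite (_ : symdiff _ _ = set0) ?measure0 ?lee_fin ?ltW//.
apply/seteqP; split => x //.
by rewrite /symdiff /saturated /= ffunE mxE => -[]; rewrite in_setE => -[].
Qed.

End approximation.

(** * Small cells and the diagonals *)

Section fine_partition.
Context {R : realType} {d : nat}.
Notation X := 'rV[R]_d.

(** The cell of x records on which side of the numbers - L + n dl each
    coordinate of x lies. *)
Lemma fine_partition (L dl : R) : 0 < dl ->
  exists (T : finType) (g : X -> T), measurable_partition g /\
  forall x y, box L x -> box L y -> g x = g y -> forall j, `|x ord0 j - y ord0 j| <= dl.
Proof.
move=> dl0; pose N := (Num.truncn (2 * L / dl)).+2.
pose pt (n : 'I_N) := - L + n%:R * dl.
exists {ffun 'I_d * 'I_N -> bool}.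
exists (fun x => [ffun p => x ord0 p.1 <= pt p.2]); split.
  move=> s; rewrite (_ : _ @^-1` _ = \bigcap_(p in [set: 'I_d * 'I_N])
     (fun x : X => x ord0 p.1) @^-1` [set r | (r <= pt p.2) = s p]); last first.
    apply/seteqP; split => [x /= <- p _ /=|x H]; first by rewrite ffunE.
    by apply/ffunP => p; rewrite ffunE; exact: H.
  apply: fin_bigcap_measurable => // p _.
  rewrite -[X in measurable X]setTI; apply: measurable_entry => //.
  have -> : [set r | (r <= pt p.2) = s p] = if s p then [set` `]-oo, pt p.2]] else ~` [set` `]-oo, pt p.2]].
    case: (s p); apply/seteqP; split => r /=; rewrite in_itv//=.
      by move=> ->.
    by move/negP/negbTE.
  by case: (s p); [|apply: measurableC]; exact: measurable_itv.
have key (x y : X) : box L x -> box L y ->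
    [ffun p : 'I_d * 'I_N => x ord0 p.1 <= pt p.2] = [ffun p => y ord0 p.1 <= pt p.2] ->
    forall j, y ord0 j - x ord0 j <= dl.
  move=> Lx Ly gxy j; rewrite leNgt; apply/negP => xy.
  have xL : 0 <= x ord0 j + L by have := Lx ord0 j; rewrite ler_norml; lra.
  have xL2 : x ord0 j + L <= 2 * L by have := Lx ord0 j; rewrite ler_norml; lra.
  set q := (x ord0 j + L) / dl.
  have q0 : 0 <= q by rewrite divr_ge0// ltW.
  have qN : (Num.truncn q < (Num.truncn (2 * L / dl)).+1)%N.
    rewrite ltnS; apply: le_truncn.
    by rewrite ler_pM2r// invr_gt0.
  have nN : ((Num.truncn q).+1 < N)%N by [].
  have := congr1 (fun h : {ffun 'I_d * 'I_N -> bool} => h (j, Ordinal nN)) gxy.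
  rewrite !ffunE /= /pt /=.
  have /andP[t1 t2] := truncn_itv q0.
  have t1' : (Num.truncn q)%:R * dl <= x ord0 j + L by rewrite -ler_pdivlMr.
  have t2' : x ord0 j + L < (Num.truncn q).+1%:R * dl by rewrite -ltr_pdivrMr.
  have -> : x ord0 j <= - L + (Num.truncn q).+1%:R * dl by lra.
  move=> /esym; rewrite -natr1 mulrDl mul1r => H; lra.
move=> x y Lx Ly gxy j; rewrite ler_norml.
have h1 := key x y Lx Ly gxy j; have h2 := key y x Ly Lx (esym gxy) j; lra.
Qed.

End fine_partition.

Section diagonal.
Context {R : realType} {d : nat}.
Notation X := 'rV[R]_d.
Variable m : {finite_measure set X -> \bar R}.
Hypothesis m_point : forall x : X, m [set x] = 0%E.

Lemma measurable_rV_set1 (x : X) : measurable [set x].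
Proof.
rewrite [X in measurable X](_ : _ = \bigcap_(j in [set: 'I_d])
    ((fun y : X => y ord0 j) @^-1` [set x ord0 j])); last first.
  apply/seteqP; split => [y /= -> //|y H].
  by apply/rowP => j; exact: H.
apply: fin_bigcap_measurable => // j _.
by rewrite -[X in measurable X]setTI; exact: measurable_entry.
Qed.

Definition close_rows k (a b : 'I_k) (dl : R) : set 'M[R]_(k, d) :=
  [set x | forall j, `|x a j - x b j| <= dl].

Lemma measurable_close_rows k (a b : 'I_k) dl : measurable (close_rows a b dl).
Proof.
rewrite [X in measurable X](_ : _ = \bigcap_(j in [set: 'I_d])
    ((fun x : 'M[R]_(k, d) => x a j - x b j) @^-1` [set` `[- dl, dl]])); last first.
  apply/seteqP; split => [x /= Bx j _ /=|x /= Bx j].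
    by rewrite in_itv /= -ler_norml.
  by have := Bx j Logic.I; rewrite /= in_itv/= -ler_norml.
apply: fin_bigcap_measurable => // j _.
rewrite -[X in measurable X]setTI.
have mf : measurable_fun setT (fun x : 'M[R]_(k, d) => x a j - x b j).
  by apply: measurable_funB; exact: measurable_entry.
exact: mf.
Qed.

Lemma close_rowsE k (a b : 'I_k) (x : 'M[R]_(k, d)) : close_rows a b 0 x <-> row a x = row b x.
Proof.
split=> [H|H j].
  apply/rowP => j; rewrite !mxE; apply/eqP; rewrite -subr_eq0 -normr_le0; exact: H.
by have := congr1 (fun v : 'rV_d => v ord0 j) H; rewrite !mxE => ->; rewrite subrr normr0.
Qed.

(** By Fubini: for a given first point, a tuple with that point in another
    place lies in a product with a singleton factor. Two places after the first
    are dealt with by induction. *)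
Lemma diagonal_null k (a b : 'I_k) : a != b -> power_measure m k (close_rows a b 0) = 0%E.
Proof.
elim: k a b => [[]//|k IH] a b ab.
have e (mu : {measure set 'M[R]_(k.+1, d) -> \bar R}) A : measurable A ->
    mu A = (\int[mu]_x (\1_A x)%:E)%E.
  by move=> mA; rewrite integral_indic// setIT.
have e' (mu : {measure set 'M[R]_(k, d) -> \bar R}) A : measurable A ->
    mu A = (\int[mu]_x (\1_A x)%:E)%E.
  by move=> mA; rewrite integral_indic// setIT.
have mC := measurable_close_rows a b 0.
rewrite e// ge0_integral_power; last 2 first.
- by apply/measurable_EFinP; exact: measurable_indic.
- by move=> x; rewrite lee_fin.
apply: integral0_eq => x _.
have ms (c : 'I_k) : measurable [set y : 'M[R]_(k, d) | row c y = x].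
  rewrite -[X in measurable X]setTI.
  exact: (measurable_row c measurableT (measurable_rV_set1 x)).
have single (c : 'I_k) : (\int[power_measure m k]_y (\1_[set y | row c y = x] y)%:E = 0)%E.
  rewrite -e'// (_ : [set y | _] = rect (fun i => if i == c then [set x] else setT)).
    rewrite [LHS]power_measure_rect.
      by rewrite (bigD1 c)//= eqxx m_point mul0e.
    by move=> i; case: ifP => // _; exact: measurable_rV_set1.
  apply/seteqP; split => [y /= yc i|y /(_ c)]; last by rewrite eqxx.
  by case: eqVneq => [->|].
have red (A : set 'M[R]_(k, d)) : measurable A ->
    (forall y, close_rows a b 0 (rows_cons (x, y)) <-> A y) ->
    (\int[power_measure m k]_y (\1_A y)%:E = 0)%E ->
    (\int[power_measure m k]_y (\1_(close_rows a b 0) (rows_cons (x, y)))%:E = 0)%E.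
  move=> mA HA <-; apply: eq_integral => y _; rewrite !indicE; congr (_%:R%:E).
  by congr nat_of_bool; apply/idP/idP; rewrite !inE HA.
have [a' ea | ea] := unliftP ord0 a; have [b' eb | eb] := unliftP ord0 b.
- apply: (red (close_rows a' b' 0)); first exact: measurable_close_rows.
    by move=> y; rewrite !close_rowsE ea eb !row_consS.
  have ab' : a' != b' by apply: contraNneq ab => ab'; rewrite ea eb ab'.
  by rewrite -e'; [exact: IH|exact: measurable_close_rows].
- apply: (red [set y | row a' y = x]) => //.
  by move=> y; rewrite close_rowsE ea eb row_consS row_cons0.
- apply: (red [set y | row b' y = x]) => //.
  by move=> y; rewrite close_rowsE ea eb row_consS row_cons0 /=; split => ->.
- by move: ab; rewrite ea eb eqxx.
Qed.

(** The sets of tuples with two close rows decrease to a diagonal. *)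
Lemma close_rows_small k (e : R) : 0 < e ->
  exists2 dl : R, 0 < dl & forall a b : 'I_k, a != b ->
  (power_measure m k (close_rows a b dl) <= e%:E)%E.
Proof.
move=> e0.
have : \forall n \near \oo, forall p : 'I_k * 'I_k, p.1 != p.2 ->
    (power_measure m k (close_rows p.1 p.2 n.+1%:R^-1) <= e%:E)%E.
  apply: filter_forall => -[a b] /=.
  have [->|ab] := eqVneq a b; first by apply: nearW.
  have cv : power_measure m k (close_rows a b n.+1%:R^-1) @[n --> \oo] --> 0%E.
    rewrite -(diagonal_null ab).
    have -> : close_rows a b 0 = \bigcap_n close_rows a b n.+1%:R^-1.
      apply/seteqP; split => [x Hx n _ j|x Hx j].
        by apply: (le_trans (Hx j)); rewrite invr_ge0.
      apply/ler_addgt0Pl => h h0; rewrite addr0.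
      have := Hx (Num.truncn h^-1) Logic.I j; move/le_trans; apply.
      rewrite invf_ple ?posrE ?ltr0n//.
      by apply/ltW; rewrite truncnS_gt.
    apply: nonincreasing_cvg_mu.
    - by rewrite ltey_eq fin_num_measure//; exact: measurable_close_rows.
    - by move=> n; exact: measurable_close_rows.
    - by apply: bigcapT_measurable => n; exact: measurable_close_rows.
    - move=> n n' nn; rewrite subsetEset => x Hx j; apply: (le_trans (Hx j)).
      by rewrite lef_pV2 ?posrE ?ltr0n// ler_nat.
  by apply: filterS (ecvg0_near_le cv e0).
move=> [n _ /(_ n (leqnn n)) Hn]; exists n.+1%:R^-1; first by rewrite invr_gt0.
by move=> a b ab; exact: (Hn (a, b)).
Qed.

End diagonal.

Lemma measure_finite_bigcup_le dY (Y : measurableType dY) (R : realType)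
    (nu : {measure set Y -> \bar R}) (T : finType) (P : pred T) (F : T -> set Y) :
  (forall s, measurable (F s)) ->
  (nu (\bigcup_(s in [set s | P s]) F s) <= \sum_(s | P s) nu (F s))%E.
Proof.
move=> mF.
have -> : \bigcup_(s in [set s | P s]) F s = \big[setU/set0]_(s | P s) F s.
  apply/seteqP; split => [x [s /= Ps Fx]|x].
    by rewrite (bigD1 s)//=; left.
  by elim/big_ind: _ => // [A B HA HB [/HA|/HB]//|s Ps Fx]; exists s.
suff [] : measurable (\big[setU/set0]_(s | P s) F s) /\
  (nu (\big[setU/set0]_(s | P s) F s) <= \sum_(s | P s) nu (F s))%E by [].
apply: (big_ind2 (fun A r => measurable A /\ (nu A <= r)%E)).
- by rewrite measure0.
- move=> A r B r' [mA Ar] [mB Br]; split; first exact: measurableU.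
  by apply: le_trans (measureU2 nu mA mB) _; exact: leeD.
- by [].
Qed.

Section cell_approximation.
Context {R : realType} {d : nat}.
Notation X := 'rV[R]_d.
Variables (m : {finite_measure set X -> \bar R}) (W : set X) (L : R).
Hypotheses (m_point : forall x : X, m [set x] = 0%E) (mW : measurable W) (WL : W `<=` box L).

(** The cells are the common refinement of a partition that approximates E and
    of a fine one. Of the products in the approximation, those which miss E are
    dropped at no cost. Those with a repeated cell consist of tuples with two
    close rows, and their total measure is small by [close_rows_small]. *)
Lemma cell_approximation k (E : set 'M[R]_(k, d)) (e dl : R) :
  measurable E -> E `<=` rect (fun=> W) -> 0 < e -> 0 < dl ->
  exists (T : finType) (D : T -> set X) (Psi : {set {ffun 'I_k -> T}}),
  [/\ [/\ forall s, measurable (D s), forall s, D s `<=` W & trivIset setT D],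
     forall s x y, D s x -> D s y -> forall j, `|x ord0 j - y ord0 j| <= dl,
     forall i, i \in Psi -> injective i /\ (cells D i `&` E) !=set0 &
     (power_measure m k (symdiff E (cell_union D Psi)) <= e%:E)%E].
Proof.
move=> mE EW e0 dl0.
have e2 : 0 < e / 2 by rewrite divr_gt0.
have [T1 [c [phi [mc Hc]]]] := (measurable_approximable (power_measure m k) mE).2 _ e2.
pose e3 := e / 2 / (#|{: 'I_k * 'I_k}|.+1%:R).
have e30 : 0 < e3 by rewrite divr_gt0// ltr0n.
have [dl' dl'0 Hdl'] := close_rows_small m_point k e30.
pose dl2 := Num.min dl dl'.
have dl20 : 0 < dl2 by rewrite lt_min dl0.
have [T2 [g [mg Hg]]] := @fine_partition R d L dl2 dl20.
pose D (s : T1 * T2) := W `&` [set x | c x = s.1 /\ g x = s.2].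
have mD s : measurable (D s).
  apply: measurableI => //.
  rewrite (_ : [set x | _] = c @^-1` [set s.1] `&` g @^-1` [set s.2]).
    by apply: measurableI; [exact: mc|exact: mg].
  by apply/seteqP; split.
have tD : trivIset setT D.
  by move=> [s1 s2] [t1 t2] _ _ [x [[_ /= [<- <-]] [_ /= [<- <-]]]].
pose idx (x : 'M[R]_(k, d)) : {ffun 'I_k -> T1 * T2} := [ffun a => (c (row a x), g (row a x))].
pose Psi := [set i : {ffun 'I_k -> T1 * T2} |
  [&& phi [ffun a => (i a).1], injectiveb i & `[< (cells D i `&` E) !=set0 >]]]%SET.
have PsiP i : i \in Psi -> injective i /\ (cells D i `&` E) !=set0.
  by rewrite inE => /and3P[_ /injectiveP ? /asboolP].
exists ((T1 * T2)%type : finType), D, Psi; split => //.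
- by split => // s x [].
- move=> s x y [Wx [_ gx]] [Wy [_ gy]] j.
  apply: (@le_trans _ _ dl2); last by rewrite ge_min lexx.
  by apply: Hg; [exact: WL|exact: WL|rewrite gx gy].
pose P := [pred p : 'I_k * 'I_k | p.1 != p.2].
pose Diag := \bigcup_(p in [set p | P p]) close_rows p.1 p.2 dl2 : set 'M[R]_(k, d).
have mDiag : measurable Diag.
  by apply: fin_bigcup_measurable => // p _; exact: measurable_close_rows.
have mC := measurable_saturated phi mc.
have mU : measurable (cell_union D Psi).
  by apply: fin_bigcup_measurable => // i _; exact: measurable_cells.
apply: (@le_trans _ _ (power_measure m k (symdiff E (saturated c phi)) + power_measure m k Diag)%E).
  apply: le_trans (measureU2 _ _ _) => //; last exact: measurable_symdiff.
  apply: le_measure; rewrite ?inE.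
  - exact: measurable_symdiff.
  - by apply: measurableU => //; exact: measurable_symdiff.
  move=> x [[Ex nx]|[[i /= iP xi] nx]]; last first.
    left; right; split => //; rewrite /saturated /=.
    have : phi [ffun a => (i a).1] by move: iP; rewrite inE => /and3P[].
    rewrite (_ : [ffun a => (i a).1] = [ffun a => c (row a x)])//.
    by apply/ffunP => a; rewrite !ffunE; have [_ [<-]] := xi a.
  have xidx : cells D (idx x) x.
    by move=> a; rewrite ffunE; split; [exact: EW Ex a|].
  have [px|px] := boolP (phi [ffun a => c (row a x)]); last first.
    by left; left; split => //; exact/negP.
  right; apply: contrapT => nD; apply: nx; exists (idx x) => //=.
  rewrite inE; apply/and3P; split; last by apply/asboolP; exists x.
    by rewrite (_ : [ffun a => (idx x a).1] = [ffun a => c (row a x)])//;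
      apply/ffunP => a; rewrite !ffunE.
  apply/injectiveP => a b; rewrite !ffunE => -[_ gab]; apply/eqP.
  apply: contrapT => /negP ab; apply: nD; exists (a, b) => //= j.
  have := Hg _ _ (WL (EW _ Ex a)) (WL (EW _ Ex b)) gab j; rewrite !mxE.
  by [].
rewrite [e]splitr EFinD; apply: leeD => //.
apply: (le_trans (measure_finite_bigcup_le _ _ _)).
  by move=> p; exact: measurable_close_rows.
apply: (@le_trans _ _ (\sum_(p : 'I_k * 'I_k | P p) e3%:E)%E).
  apply: lee_sum => -[a b] /= ab; apply: le_trans (Hdl' a b ab).
  apply: le_measure; rewrite ?inE; [exact: measurable_close_rows|exact: measurable_close_rows|].
  by move=> x Hx j; apply: (le_trans (Hx j)); rewrite ge_min lexx orbT.
rewrite sumEFin lee_fin sumr_const -[X in X <= _]mulr_natl /e3.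
rewrite mulrA ler_pdivrMr ?ltr0n// mulrC ler_pM2l// ler_nat.
exact: leq_trans (max_card _) (leqnSn _).
Qed.

End cell_approximation.

(** * The variance of bounded functionals *)

(** Only the limit e --> 0 matters; an explicit e avoids limits. *)
Lemma le_of_small_error (R : realFieldType) (A B X Y : R) : 0 < A -> 0 <= B -> 0 <= Y ->
  (forall e, 0 < e -> B * e <= A -> (A - B * e) ^+ 2 <= X + Y * e) -> A ^+ 2 <= X.
Proof.
move=> A0 B0 Y0 H; apply/ler_addgt0Pr => h h0.
pose Z := Y + 2 * A * B + 1.
have Z0 : 0 < Z by rewrite /Z ltr_wpDl// addr_ge0// !mulr_ge0// ltW.
pose e := Num.min (A / (B + 1)) (h / Z).
have B1 : 0 < B + 1 by rewrite ltr_wpDl.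
have e0 : 0 < e by rewrite lt_min !divr_gt0.
have eA : B * e <= A.
  apply: (@le_trans _ _ ((B + 1) * e)); first by rewrite ler_wpM2r ?lerDl// ltW.
  by rewrite mulrC -ler_pdivlMr// ge_min lexx.
have eh : Z * e <= h by rewrite mulrC -ler_pdivlMr// ge_min lexx orbT.
have := H e e0 eA.
have -> : (A - B * e) ^+ 2 = A ^+ 2 - 2 * A * B * e + (B * e) ^+ 2 by ring.
have := sqr_ge0 (B * e); move: eh; rewrite /Z !mulrDl mul1r; lra.
Qed.

Section bounded_core.
Context {R : realType} {d : nat}.
Notation X := 'rV[R]_d.
Notation conf := (configuration R d).
Variables (Q : probability conf R) (Lam : {measure set X -> \bar R}).
Hypothesis QP : poisson_law Q Lam.
Hypothesis Lam_point : forall x : X, Lam [set x] = 0%E.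
Variables (W : set X) (gW : good_set W) (L : R).
Hypothesis WL : W `<=` box L.

Section bounded.
Variables (f : conf -> R) (b : R).
Hypotheses (mf : measurable_fun setT f) (f0 : forall mu, 0 <= f mu) (fb : forall mu, f mu <= b).
Variables (k : nat) (I1 I2 : {set 'I_k}).
Notation nu := (power_measure (window_measure QP gW) k).
Variables (E : set 'M[R]_(k, d)) (dl M K c a V : R).
Hypotheses (mE : measurable E) (EW : E `<=` rect (fun=> W)) (dl0 : 0 < dl).
Hypothesis spread : forall (i j : 'I_k) (p : X) (S : set X), measurable S -> S `<=` W ->
  (forall w, S w -> exists x, [/\ E x, forall l, `|w ord0 l - x i l| <= dl &
    forall l, `|p ord0 l - x j l| <= dl]) -> (Lam S <= M%:E)%E.
Hypotheses (M0 : 0 <= M) (MK : forall j, (0 < j <= k)%N -> M ^+ (k - j) <= K) (K0 : 0 <= K).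
Hypotheses (c0 : 0 <= c) (gapE : forall x, E x -> c <= shift_gap Q f I1 I2 x).
Hypothesis HV : \int[Q]_mu ((f mu - a) ^+ 2) <= V.

Let b0 : 0 <= b. Proof. exact: le_trans (f0 point) (fb point). Qed.

Let V0 : 0 <= V.
Proof. by apply: le_trans HV; apply: Rintegral_ge0 => mu _; exact: sqr_ge0. Qed.

Let window_point (x : X) : window_measure QP gW [set x] = 0%E.
Proof.
apply/eqP; rewrite -measure_le0 -(Lam_point x); apply: le_measure; rewrite ?inE.
- by apply: measurableI; [exact: measurable_rV_set1|exact: gW.1].
- exact: measurable_rV_set1.
- by move=> y [].
Qed.

(** The cells of [cell_approximation] turn [discrete_variance_bound] into a bound
    for E, up to errors of order e on both sides. The hypothesis [spread] says
    that the points that can stand in place i of a tuple near to E, when place j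
    is near to p, have measure at most M; its tolerance dl is the size of the
    cells, so that it bounds the total mass of the cells near to a given one. *)
Lemma bounded_variance_bound :
  c ^+ 2 * fine (nu E) <= V * (4 ^+ k * (k`!%:R * K)).
Proof.
set Kc := 4 ^+ k * _.
have Kc0 : 0 <= Kc by rewrite !mulr_ge0// exprn_ge0.
pose v := fine (nu E).
have vE : nu E = v%:E by rewrite fineK// fin_num_measure.
have v0 : 0 <= v by rewrite fine_ge0.
have [cv0|cv0] := eqVneq (c * v) 0.
  by rewrite expr2 -mulrA cv0 mulr0 mulr_ge0.
have cvp : 0 < c * v by rewrite lt_neqAle eq_sym cv0 mulr_ge0.
have vp : 0 < v by rewrite lt_neqAle v0 andbT; apply: contraNneq cv0 => <-; rewrite mulr0.
suff H : (c * v) ^+ 2 <= V * Kc * v.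
  by rewrite -(ler_pM2r vp); move: H; rewrite -/v; congr (_ <= _); ring.
apply: (@le_of_small_error _ _ (c + b) _ (V * Kc)) => //; [exact: addr_ge0|exact: mulr_ge0|].
move=> e e0 eA.
have [T [D [Psi [[mD DW tD] diam PsiP He]]]] := cell_approximation window_point gW.1 WL mE EW e0 dl0.
set U := cell_union D Psi in He.
have Psi_inj i : i \in Psi -> injective i by move=> /PsiP[].
have gD s : good_set (D s) := good_subset (mD s) (DW s) gW.
have mU : measurable U.
  by apply: fin_bigcup_measurable => // i _; exact: measurable_cells.
(* Cells are near if some tuple in E has its places i and j in them. *)
pose near i j s' s := `[< exists x, [/\ E x, D s' (row i x) & D s (row j x)] >].
have nearP i a' b' : i \in Psi -> near a' b' (i a') (i b').
  by move=> /PsiP[_ [x [Cx Ex]]]; apply/asboolP; exists x; split => //; exact: Cx.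
have nearM a' b' s : \sum_(s' | near a' b' s' s) mean Lam (D s') <= M.
  have [[p Dp]|nD] := pselect (exists p, D s p); last first.
    rewrite big1// => s' /asboolP[x [_ _ Dx]]; exfalso; apply: nD.
    by exists (row b' x).
  rewrite -lee_fin -sumEFin (eq_bigr (fun s' => Lam (D s'))); last first.
    by move=> s' _; rewrite (meanE QP).
  rewrite -(measure_finite_bigcup Lam (near a' b' ^~ s) mD tD).
  apply: (@spread a' b' p).
  - exact: (measurable_finite_bigcup (near a' b' ^~ s) mD).
  - by move=> w [s' _]; exact: DW.
  - move=> w [s' /= /asboolP[x [Ex Dx Dx']] Dw]; exists x; split => // l.
      by have := diam _ _ _ Dw Dx l; rewrite !mxE.
    by have := diam _ _ _ Dp Dx' l; rewrite !mxE.
have HK J : J != finset.set0 -> forall i, i \in Psi ->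
    \sum_(i' in Psi | i' @: J == i @: J) outer_product Lam D J i' <= k`!%:R * K.
  move=> J0 i iP; apply: (fibre_sum_le _ Psi_inj nearP M0 nearM MK) => //.
  by move=> s; exact: mean_ge0.
have kK0 : 0 <= k`!%:R * K by rewrite mulr_ge0.
have := discrete_variance_bound QP gW mf f0 fb mD DW tD Psi_inj I1 I2 kK0 HK HV.
rewrite -/U -/Kc; set C := \int[_]_(x in _) _; set u := cell_mass _ _ _.
have uE : nu U = u%:E := nu_cell_union QP gW mD DW tD Psi.
move=> HC.
have ve : (nu (E `\` U) <= e%:E)%E.
  apply: le_trans He; apply: le_measure; rewrite ?inE.
  - exact: measurableD.
  - exact: measurable_symdiff.
  - by move=> x; left.
have ue : (nu (U `\` E) <= e%:E)%E.
  apply: le_trans He; apply: le_measure; rewrite ?inE.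
  - exact: measurableD.
  - exact: measurable_symdiff.
  - by move=> x; right.
have mUE : measurable (U `\` E) by exact: measurableD.
have mIE : measurable (U `&` E) by exact: measurableI.
have uv : u <= v + e.
  rewrite -lee_fin -uE EFinD -vE.
  apply: (@le_trans _ _ (nu (E `|` (U `\` E)))).
    apply: le_measure; rewrite ?inE//; first exact: measurableU.
    by move=> x Ux; have [Ex|Ex] := pselect (E x); [left|right].
  by apply: (le_trans (measureU2 nu mE mUE)); exact: leeD.
have igap A : measurable A -> nu.-integrable A (EFin \o shift_gap Q f I1 I2).
  move=> mA; have i1 := shifted_mean_integrable QP gW mf f0 fb I1 mA.
  have i2 := shifted_mean_integrable QP gW mf f0 fb I2 mA.
  have i12 := integrableB mA i1 i2; exact: i12.
have icst r A : measurable A -> nu.-integrable A (EFin \o cst r).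
  by move=> mA; apply: finite_measure_integrable_cst.
(* The gap is at least c on E, and at least - b on the part of the union of
   the cells outside E, whose measure is at most e. *)
have Cge : c * v - (c + b) * e <= C.
  have -> : C = \int[nu]_(x in U `&` E) shift_gap Q f I1 I2 x +
      \int[nu]_(x in U `\` E) shift_gap Q f I1 I2 x.
    rewrite -Rintegral_setU//.
    - by congr (Rintegral _ _ _); rewrite setUIDK.
    - by apply: igap; exact: measurableU.
    - by rewrite disj_set2E; apply/eqP/seteqP; split => x // [[_ Ex] [_ /(_ Ex)]].
  have l1 : c * (v - e) <= \int[nu]_(x in U `&` E) shift_gap Q f I1 I2 x.
    apply: (@le_trans _ _ (\int[nu]_(x in U `&` E) cst c x)).
      rewrite Rintegral_cst// ler_wpM2l// lerBlDr -lee_fin EFinD !fineK ?fin_num_measure//.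
      apply: (@le_trans _ _ (nu ((U `&` E) `|` (E `\` U)))).
        apply: le_measure; rewrite ?inE//.
          by apply: measurableU => //; exact: measurableD.
        by move=> x Ex; have [Ux|Ux] := pselect (U x); [left|right].
      have mEU : measurable (E `\` U) by exact: measurableD.
      by apply: (le_trans (measureU2 nu mIE mEU)); exact: leeD.
    apply: le_Rintegral; rewrite ?igap ?icst//.
    by move=> x [_ Ex]; exact: gapE.
  have l2 : - (b * e) <= \int[nu]_(x in U `\` E) shift_gap Q f I1 I2 x.
    apply: (@le_trans _ _ (\int[nu]_(x in U `\` E) cst (- b) x)).
      rewrite Rintegral_cst// mulNr lerN2 ler_wpM2l// -lee_fin fineK ?fin_num_measure//.
    apply: le_Rintegral; rewrite ?igap ?icst//.
    move=> x _; rewrite /shift_gap /=.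
    have := shifted_mean_ge0 Q f0 I1 x; have := shifted_mean_le Q mf f0 fb I2 x; lra.
  by move: l1 l2; rewrite mulrBr mulrDl; lra.
apply: (@le_trans _ _ (C ^+ 2)).
  rewrite ler_sqr ?nnegrE//; first by rewrite subr_ge0.
  by apply: le_trans Cge; rewrite subr_ge0.
apply: (le_trans HC); rewrite -!mulrA -!mulrDr.
by do 4 (rewrite ler_wpM2l ?exprn_ge0 ?ler0n//).
Qed.

End bounded.
End bounded_core.

(** * The Poisson process and its intensity measure *)

Section intensity.
Context {R : realType} {d : nat}.
Notation X := 'rV[R]_d.
Variables (t : R) (t0 : 0 <= t) (H : set X) (mH : measurable H).

Definition intensity : {measure set X -> \bar R} := mscale (NngNum t0) (mrestr (lebesgue_rV d) mH).

Lemma intensityE B : intensity B = (t%:E * lebesgue_rV d (B `&` H))%E.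
Proof. by []. Qed.

Lemma lebesgue_box (L : R) : lebesgue_rV d (box L : set X) \is a fin_num.
Proof.
rewrite (_ : box L = [set x : X | forall i, [set` `[- L, L]] (x ord0 i)]).
  rewrite (lebesgue_rV_prod (B := fun=> [set` `[- L, L]]))//.
  by apply: prode_fin_num => i _; rewrite lebesgue_measure_itv /=; case: ifP.
apply/seteqP; split => x /= Bx.
  by move=> i; rewrite in_itv/= -ler_norml.
by move=> i j; rewrite (ord1 i); have := Bx j; rewrite in_itv/= -ler_norml.
Qed.

Lemma bounded_setP (B : set X) : bounded_set B -> exists L, B `<=` box L.
Proof.
move=> [M [_ HM]]; exists (M + 1) => x Bx i j.
apply: le_trans (HM (M + 1) _ x Bx); last by rewrite ltrDl.
rewrite /Num.norm/= mx_normrE.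
exact: (le_bigmax _ (fun ij : 'I_1 * 'I_d => `|x ij.1 ij.2|) (i, j)).
Qed.

Lemma lebesgue_good (B : set X) : good_set B -> (lebesgue_rV d B < +oo)%E.
Proof.
move=> [mB /bounded_setP[L BL]]; apply: (@le_lt_trans _ _ (lebesgue_rV d (box L))).
  by apply: le_measure; rewrite ?inE//; exact: measurable_box.
by rewrite ltey_eq lebesgue_box.
Qed.

Lemma intensity_good B : good_set B -> (intensity B < +oo)%E.
Proof.
move=> gB; rewrite intensityE lte_mul_pinfty ?lee_fin//.
apply: lebesgue_good; apply: (good_subset _ _ gB); last by move=> x [].
by apply: measurableI => //; exact: gB.1.
Qed.

Lemma lebesgue_rV_set1 (x : X) : (0 < d)%N -> lebesgue_rV d [set x] = 0%E.
Proof.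
move=> d0; rewrite (_ : [set x] = [set y : X | forall i, [set x ord0 i] (y ord0 i)]).
  rewrite (lebesgue_rV_prod (B := fun i => [set x ord0 i]))//.
  by rewrite (bigD1 (Ordinal d0))//= lebesgue_measure_set1 mul0e.
apply/seteqP; split => [y -> //|y /= H'].
by apply/rowP.
Qed.

Lemma intensity_set1 (x : X) : (0 < d)%N -> intensity [set x] = 0%E.
Proof.
move=> d0; rewrite intensityE.
rewrite (_ : lebesgue_rV d _ = 0%E) ?mule0//; apply/eqP; rewrite -measure_le0.
rewrite -(lebesgue_rV_set1 x d0); apply: le_measure; rewrite ?inE.
- by apply: measurableI => //; exact: measurable_rV_set1.
- exact: measurable_rV_set1.
- by move=> y [].
Qed.

Context dO (Omega : measurableType dO) (P : probability Omega R).
Variable eta : {RV P >-> configuration R d}.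
Hypothesis eta_poisson :
  poisson_process H (fun B => t%:E * lebesgue_rV d (B `&` H))%E eta.

(** The law of the process satisfies the product formula because the counts of
    disjoint sets are independent and Poisson distributed. *)
Lemma poisson_process_law : poisson_law (distribution P eta) intensity.
Proof.
split=> [|T D v gD tD]; first exact: intensity_good.
have [_ pd ind] := eta_poisson.
have mD s : measurable (D s) := (gD s).1.
pose B (i : 'I_#|T|) := D (enum_val i).
have tB : trivIset setT B.
  by move=> i j _ _ /tD h; apply: enum_val_inj; exact: h.
have := ind _ B (fun i => mD _) tB (fun i => [set (v (enum_val i))%:R%:E]) (fun=> emeasurable_set1 _).
rewrite /distribution /pushforward.
have -> : \bigcap_i ((fun w => eta w (B i)) @^-1` [set (v (enum_val i))%:R%:E]) =
    eta @^-1` counts_event D v.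
  apply/seteqP; split => w /=.
    by move=> h s; have := h (enum_rank s) Logic.I; rewrite /B /= enum_rankK.
  by move=> h i _; exact: h.
move=> HP; rewrite -prodEFin; apply: (eq_trans HP).
transitivity (\prod_s P ((fun w => eta w (D s)) @^-1` [set (v s)%:R%:E]))%E.
  by rewrite [RHS]big_enum_val.
apply: eq_bigr => s _; have := pd _ (mD s).
rewrite /poisson_distributed -intensityE -[intensity (D s)]fineK; last first.
  by rewrite ge0_fin_numE// intensity_good.
by move=> /(_ (v s)) ->.
Qed.

End intensity.

(** * Truncation of functionals *)

Section clamp.
Context {R : realType}.
Implicit Types (n y z : R).

(** The shift by n makes the truncation nonnegative, as is required for the
    Mecke formula. *)
Definition clamp n y := Num.max (- n) (Num.min y n) + n.

Lemma clamp_ge0 n y : 0 <= clamp n y.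
Proof. by rewrite /clamp -lerBlDr sub0r le_max lexx. Qed.

Lemma clamp_le n y : 0 <= n -> clamp n y <= n + n.
Proof. by move=> n0; rewrite /clamp lerD2r ge_max ge_min lexx orbT andbT; lra. Qed.

Lemma clamp_lipschitz n y z : `|clamp n y - clamp n z| <= `|y - z|.
Proof.
rewrite /clamp opprD addrACA subrr addr0.
rewrite ler_norml; have := ler_norm (y - z); have := ler_norm (- (y - z)); rewrite normrN => h1 h2.
rewrite /Num.max /Num.min; do ! case: ifPn; rewrite -?leNgt => *; lra.
Qed.

Lemma clampB n y z : `|y| <= n -> `|z| <= n -> clamp n y - clamp n z = y - z.
Proof.
rewrite !ler_norml => /andP[y1 y2] /andP[z1 z2].
rewrite /clamp (min_idPl y2) (min_idPl z2) (max_idPr y1) (max_idPr z1); ring.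
Qed.

Lemma measurable_clamp n : measurable_fun setT (clamp n).
Proof.
apply: measurable_funD => //; apply: measurable_maxr => //; exact: measurable_minr.
Qed.

End clamp.

(** The value 0 of [fine] at the infinities makes a nonzero value a proof of
    integrability. This is how positivity of g yields the integrability of the
    difference in its definition. *)
Lemma fine_integral_neq0 dT (T : measurableType dT) (R : realType)
    (m : {measure set T -> \bar R}) (h : T -> R) : measurable_fun setT h ->
  fine (\int[m]_x (h x)%:E)%E != 0 -> m.-integrable setT (EFin \o h).
Proof.
move=> mh h0; apply/integrableP; split; first exact/measurable_EFinP.
rewrite [X in (X < _)%E](_ : _ = \int[m]_x `|(h x)%:E|)%E//.
rewrite integral_fin_num_abs//.
by move: h0; case: (\int[m]_x (h x)%:E)%E => //=; rewrite eqxx.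
Qed.

Section truncation.
Context {R : realType} {d : nat}.
Notation X := 'rV[R]_d.
Notation conf := (configuration R d).
Variables (H : set X) (mH : measurable H).
Context dO (Omega : measurableType dO) (P : probability Omega R).
Variable eta : {RV P >-> configuration R d}.
Hypothesis etaH : forall w, configurations_in H (eta w).
Variable f : conf -> R.
Hypothesis mf : measurable_fun (configurations_in H) f.
Notation Q := (distribution P eta).

Lemma measurable_configurations_in : measurable (configurations_in H : set conf).
Proof.
rewrite (_ : configurations_in H = (fun mu : conf => mu (~` H)) @^-1` [set 0%E])//.
by rewrite -[X in measurable X]setTI; apply: measurable_count => //; exact: measurableC.
Qed.

Lemma add_points_in k (mu : conf) (I : {set 'I_k}) x : configurations_in H mu ->
  points_in k H x -> configurations_in H (add_points mu I x).
Proof.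
move=> Hmu Hx; rewrite /configurations_in/= add_pointsE Hmu add0e big1// => i _.
by rewrite diracE memNset//= => /(_ (Hx i)).
Qed.

(** Only the values of f on the configurations in H are meaningful; f is
    replaced by 0 elsewhere, which makes it measurable on all configurations. *)
Definition truncated (n : nat) (mu : conf) : R :=
  clamp n%:R ((f \_ (configurations_in H)) mu).

Lemma measurable_truncated n : measurable_fun setT (truncated n).
Proof.
apply: (measurableT_comp (measurable_clamp n%:R)).
by apply/(measurable_restrictT _ measurable_configurations_in).
Qed.

Lemma truncated_ge0 n mu : 0 <= truncated n mu. Proof. exact: clamp_ge0. Qed.

Lemma truncated_le n mu : truncated n mu <= n%:R + n%:R.
Proof. exact: clamp_le. Qed.

Lemma shifted_mean_truncated n k (I : {set 'I_k}) x :
  shifted_mean Q (truncated n) I x = \int[P]_w truncated n (add_points (eta w) I x).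
Proof.
rewrite /shifted_mean /Rintegral ge0_integral_distribution//.
  apply/measurable_EFinP; apply: (measurableT_comp (measurable_truncated n)).
  exact: measurable_add_points_at.
by move=> mu; rewrite lee_fin truncated_ge0.
Qed.

(** Dominated convergence: clamping is a contraction, so that the difference of
    the truncated values is dominated by the difference of the values. The sign
    of the limit s may depend on x. *)
Lemma shift_gap_truncated_cvg k (I1 I2 : {set 'I_k}) x : points_in k H x ->
  0 < add_cost_diff f eta I1 I2 x ->
  exists2 s : R, `|s| = add_cost_diff f eta I1 I2 x &
  shift_gap Q (truncated n) I1 I2 x @[n --> \oo] --> s.
Proof.
move=> Hx g0; set s := fine 'E_P[fun w => f (add_points (eta w) I1 x) - f (add_points (eta w) I2 x)].
exists s => //.
pose h w := f (add_points (eta w) I1 x) - f (add_points (eta w) I2 x).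
have fE I mu : configurations_in H mu -> f (add_points mu I x) = (f \_ (configurations_in H)) (add_points mu I x).
  by move=> Hmu; rewrite patchE mem_set//; exact: add_points_in.
have madd I : measurable_fun setT (fun w => add_points (eta w) I x).
  exact: (measurableT_comp (measurable_add_points_at I x)).
have mh : measurable_fun setT h.
  rewrite (_ : h = fun w => (f \_ (configurations_in H)) (add_points (eta w) I1 x) -
      (f \_ (configurations_in H)) (add_points (eta w) I2 x)); last first.
    by apply/funext => w; rewrite /h !fE.
  have mft : measurable_fun setT (f \_ (configurations_in H)).
    by apply/(measurable_restrictT _ measurable_configurations_in).
  by apply: measurable_funB; exact: (measurableT_comp mft).
have ih : P.-integrable setT (EFin \o h).
  apply: fine_integral_neq0 => //; move: g0; rewrite /add_cost_diff unlock normr_gt0.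
  by [].
pose hn n w := truncated n (add_points (eta w) I1 x) - truncated n (add_points (eta w) I2 x).
have itr n I : P.-integrable setT (EFin \o (fun w => truncated n (add_points (eta w) I x))).
  apply: (@measurable_bounded_integrable _ _ _ P) => //.
  - exact: (le_lt_trans (probability_le1 P measurableT) (ltry _)).
  - exact: (measurableT_comp (measurable_truncated n)).
  - exists (n%:R + n%:R); split; first exact: num_real.
    move=> M bM mu _ /=; rewrite ger0_norm ?truncated_ge0//.
    exact: le_trans (truncated_le _ _) (ltW bM).
have hE n : shift_gap Q (truncated n) I1 I2 x = fine (\int[P]_w (hn n w)%:E)%E.
  by rewrite /shift_gap !shifted_mean_truncated -RintegralB.
under eq_fun do rewrite hE.
have sE : s%:E = (\int[P]_w (h w)%:E)%E.
  rewrite /s unlock fineK//; exact: (integrable_fin_num measurableT ih).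
have mhn n : measurable_fun setT (hn n).
  by apply: measurable_funB; exact: (measurableT_comp (measurable_truncated n)).
apply: fine_cvg; rewrite sE.
have cv w : (fun n => (hn n w)%:E) @ \oo --> (h w)%:E.
  apply: cvg_EFin; first by apply: nearW.
  apply: cvg_near_cst.
  pose u1 := (f \_ (configurations_in H)) (add_points (eta w) I1 x).
  pose u2 := (f \_ (configurations_in H)) (add_points (eta w) I2 x).
  have [N _ HN] : \forall n \near \oo, Num.max `|u1| `|u2| <= n%:R.
    exact: nbhs_infty_ger.
  exists N => // n Nn; have := HN n Nn; rewrite /= ge_max => /andP[n1 n2].
  by rewrite /hn /truncated clampB// /h !fE.
have dom w n : (`|(hn n w)%:E| <= (abse \o (EFin \o h)) w)%E.
  by rewrite /= lee_fin /h !fE//; exact: clamp_lipschitz.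
have mhnE n : measurable_fun setT (fun w => (hn n w)%:E) by exact/measurable_EFinP.
have mhE : measurable_fun setT (fun w => (h w)%:E) by exact/measurable_EFinP.
have cvae : {ae P, forall w, setT w -> (fun n => (hn n w)%:E) @ \oo --> (h w)%:E}.
  by apply: aeW => w _; exact: cv.
have domae : {ae P, forall w n, setT w -> (`|(hn n w)%:E| <= (abse \o (EFin \o h)) w)%E}.
  by apply: aeW => w n _; exact: dom.
by have [] := dominated_convergence measurableT mhnE mhE cvae (integrable_abse ih) domae.
Qed.

End truncation.

(** * The variance of square integrable functionals *)

Section unbounded_core.
Context {R : realType} {d : nat}.
Notation X := 'rV[R]_d.
Notation conf := (configuration R d).
Hypothesis d_gt0 : (0 < d)%N.
Variables (t : R) (t0 : 0 <= t) (H : set X) (mH : measurable H).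
Context dO (Omega : measurableType dO) (P : probability Omega R).
Variable eta : {RV P >-> configuration R d}.
Hypothesis eta_poisson :
  poisson_process H (fun B => t%:E * lebesgue_rV d (B `&` H))%E eta.
Variables (F : Omega -> R) (F_L2 : F \in Lfun P 2%:E).
Variable f : conf -> R.
Hypothesis mf : measurable_fun (configurations_in H) f.
Hypothesis f_repr : {ae P, forall w, F w = f (eta w)}.

Notation Q := (distribution P eta).
Notation Lam := (intensity t0 mH).
Let QP : poisson_law Q Lam := poisson_process_law t0 mH eta_poisson.
Let etaH : forall w, configurations_in H (eta w).
Proof. by case: eta_poisson. Qed.

Let m := fine ('E_P[F])%E.

(** Clamping is a contraction, so that the second moment around the clamped mean
    of F is at most the variance of F. *)
Lemma truncated_variance n :
  \int[Q]_mu ((truncated H f n mu - clamp n%:R m) ^+ 2) <= fine ('V_P[F])%E.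
Proof.
have mtr := measurable_truncated mH mf n.
have e : (\int[Q]_mu ((truncated H f n mu - clamp n%:R m) ^+ 2)%:E =
    \int[P]_w ((truncated H f n (eta w) - clamp n%:R m) ^+ 2)%:E)%E.
  rewrite ge0_integral_distribution//.
    apply/measurable_EFinP; apply: measurable_funX; exact: measurable_funB.
  by move=> mu; rewrite lee_fin sqr_ge0.
rewrite /Rintegral e -lee_fin (fineK (variance_fin_num F_L2)).
have V : ('V_P[F] = \int[P]_w ((F w - m) ^+ 2)%:E)%E.
  have E (Y : Omega -> R) : ('E_P[Y] = \int[P]_w (Y w)%:E)%E by rewrite unlock.
  by rewrite /variance covariance.unlock -/m E.
have mF : measurable_fun setT F.
  by have := F_L2; rewrite inE => /andP[]; rewrite inE.
have le : (\int[P]_w ((truncated H f n (eta w) - clamp n%:R m) ^+ 2)%:E <= 'V_P[F])%E.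
  rewrite V; apply: ae_ge0_le_integral => //.
  - by move=> w _; rewrite lee_fin sqr_ge0.
  - apply/measurable_EFinP; apply: measurable_funX; apply: measurable_funB => //.
    exact: (measurableT_comp mtr).
  - by move=> w _; rewrite lee_fin sqr_ge0.
  - by apply/measurable_EFinP; apply: measurable_funX; exact: measurable_funB.
  apply: filterS f_repr => w Fw _; rewrite lee_fin.
  rewrite -[X in X <= _]real_normK ?num_real// -[X in _ <= X]real_normK ?num_real//.
  rewrite lerXn2r ?nnegrE// Fw /truncated patchE mem_set//.
  exact: clamp_lipschitz.
rewrite fineK// ge0_fin_numE; last by apply: integral_ge0 => w _; rewrite lee_fin sqr_ge0.
by apply: le_lt_trans le _; rewrite ltey_eq variance_fin_num.
Qed.

Variables (W : set X) (gW : good_set W) (L : R).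
Hypothesis WL : W `<=` box L.
Variables (k : nat) (I1 I2 : {set 'I_k}).
Notation nu := (power_measure (window_measure QP gW) k).
Notation g := (add_cost_diff f eta I1 I2).
Variables (U : set 'M[R]_(k, d)) (dl M K c : R).
Hypotheses (mU : measurable U) (UW : U `<=` rect (fun=> W)) (dl0 : 0 < dl).
Hypothesis UH : U `<=` points_in k H.
Hypothesis spread : forall (i j : 'I_k) (p : X) (S : set X), measurable S -> S `<=` W ->
  (forall w, S w -> exists x, [/\ U x, forall l, `|w ord0 l - x i l| <= dl &
    forall l, `|p ord0 l - x j l| <= dl]) -> (Lam S <= M%:E)%E.
Hypotheses (M0 : 0 <= M) (MK : forall j, (0 < j <= k)%N -> M ^+ (k - j) <= K) (K0 : 0 <= K).
Hypotheses (c0 : 0 < c) (gU : forall x, U x -> c < g x).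

Let spreadS (E : set 'M[R]_(k, d)) : E `<=` U ->
  forall (i j : 'I_k) (p : X) (S : set X), measurable S -> S `<=` W ->
  (forall w, S w -> exists x, [/\ E x, forall l, `|w ord0 l - x i l| <= dl &
    forall l, `|p ord0 l - x j l| <= dl]) -> (Lam S <= M%:E)%E.
Proof.
move=> EU i j p S mS SW h; apply: (@spread i j p) => // w /h[x [Ex h1 h2]].
by exists x; split => //; exact: EU.
Qed.

Let gap n x := shift_gap Q (truncated H f n) I1 I2 x.

Let mgap n : measurable_fun setT (gap n).
Proof.
have mtr := measurable_truncated mH mf n.
by apply: measurable_funB; apply: (measurable_shifted_mean Q mtr (@truncated_ge0 _ _ H f n) (@truncated_le _ _ H f n)).
Qed.

(** U is exhausted by sets on which the signed gap of all later truncations is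
    at least c, or at most - c. [bounded_variance_bound] applies to the former
    sets, and to the latter ones with I1 and I2 exchanged; the factor 2 is the
    price for adding the two bounds. *)
Lemma variance_bound :
  ((c ^+ 2)%:E * nu U <= 2%:E * 'V_P[F] * (4 ^+ k * (k`!%:R * K))%:E)%E.
Proof.
pose Ep n := U `&` \bigcap_(j in [set j | (n <= j)%N]) [set x | c <= gap j x].
pose En n := U `&` \bigcap_(j in [set j | (n <= j)%N]) [set x | c <= - gap j x].
set Kc := 4 ^+ k * _; set V := fine ('V_P[F])%E.
have VE : ('V_P[F] = V%:E)%E by rewrite fineK// variance_fin_num.
have mgap_ge j : measurable [set x | c <= gap j x].
  rewrite (_ : [set x | _] = gap j @^-1` [set` `[c, +oo[]); last first.
    by apply/seteqP; split => x /=; rewrite in_itv/= andbT.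
  by rewrite -[X in measurable X]setTI; apply: mgap => //; exact: measurable_itv.
have mgap_le j : measurable [set x | c <= - gap j x].
  rewrite (_ : [set x | _] = gap j @^-1` [set` `]-oo, (- c)]]); last first.
    by apply/seteqP; split => x /=; rewrite in_itv/= lerNr.
  by rewrite -[X in measurable X]setTI; apply: mgap => //; exact: measurable_itv.
have mEp n : measurable (Ep n).
  by apply: measurableI => //; apply: bigcap_measurable => //; exists n => /=.
have mEn n : measurable (En n).
  by apply: measurableI => //; apply: bigcap_measurable => //; exists n => /=.
have bp n : c ^+ 2 * fine (nu (Ep n)) <= V * Kc.
  apply: (bounded_variance_bound QP (fun x => intensity_set1 t0 mH x d_gt0) gW WL
    (measurable_truncated mH mf n) (@truncated_ge0 _ _ H f n) (@truncated_le _ _ H f n)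
    (I1 := I1) (I2 := I2) (mEp n) _ dl0 (@spreadS (Ep n) _) M0 MK K0 (ltW c0) _ (truncated_variance n)).
  - by move=> x [/UW].
  - by move=> x [].
  - by move=> x [_ /(_ n)]; apply; rewrite /=.
have bn n : c ^+ 2 * fine (nu (En n)) <= V * Kc.
  apply: (bounded_variance_bound QP (fun x => intensity_set1 t0 mH x d_gt0) gW WL
    (measurable_truncated mH mf n) (@truncated_ge0 _ _ H f n) (@truncated_le _ _ H f n)
    (I1 := I2) (I2 := I1) (mEn n) _ dl0 (@spreadS (En n) _) M0 MK K0 (ltW c0) _ (truncated_variance n)).
  - by move=> x [/UW].
  - by move=> x [].
  - move=> x [_ /(_ n)] /= h; have := h (leqnn n).
    by rewrite /gap /shift_gap opprB.
have cv : nu (Ep n `|` En n) @[n --> \oo] --> nu U.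
  have -> : U = \bigcup_n (Ep n `|` En n).
    apply/seteqP; split => [x Ux|x [n _ [[]|[]]] //].
    have [|s sE cv] := shift_gap_truncated_cvg mH etaH mf (UH Ux) (I1 := I1) (I2 := I2).
      exact: lt_trans (gU Ux).
    have := gU Ux; rewrite -sE; have [s0|s0] := leP 0 s.
      rewrite ger0_norm// => cs.
      have [N _ HN] : \forall n \near \oo, c <= gap n x by exact: cvgr_ge cs.
      by exists N => //; left; split => // j /= Nj; exact: HN.
    rewrite ltr0_norm// => cs; have cs' : s < - c by rewrite ltrNr.
    have [N _ HN] : \forall n \near \oo, gap n x <= - c by exact: cvgr_le cs'.
    by exists N => //; right; split => // j /= Nj; rewrite lerNr; exact: HN.
  apply: nondecreasing_cvg_mu.
  - by move=> n; exact: measurableU.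
  - by apply: bigcupT_measurable => n; exact: measurableU.
  - move=> n n' nn; rewrite subsetEset => x [[Ux h]|[Ux h]].
      by left; split => // j /= nj; apply: h; exact: leq_trans nj.
    by right; split => // j /= nj; apply: h; exact: leq_trans nj.
have le n : (nu (Ep n `|` En n) <= (2 * V * Kc / c ^+ 2)%:E)%E.
  apply: (le_trans (measureU2 nu (mEp n) (mEn n))).
  apply: (@le_trans _ _ (fine (nu (Ep n)) + fine (nu (En n)))%:E).
    by rewrite EFinD; apply: leeD; rewrite fineK ?fin_num_measure.
  rewrite lee_fin ler_pdivlMr ?exprn_gt0//.
  have h1 := bp n; have h2 := bn n; rewrite mulrC mulrDr.
  by apply: (le_trans (lerD h1 h2)); rewrite -mulrA mulr2n mulrDl !mul1r.
have nuU : (nu U <= (2 * V * Kc / c ^+ 2)%:E)%E.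
  rewrite -(cvg_lim _ cv)//; apply: lime_le; first by apply/cvg_ex; exists (nu U).
  by apply: nearW => n; exact: le.
rewrite VE -!EFinM -[X in (_ <= X)%E](_ : ((c ^+ 2)%:E * (2 * V * Kc / c ^+ 2)%:E = _)%E); last first.
  by rewrite -EFinM mulrC divfK// expf_neq0// gt_eqF.
by apply: lee_wpmul2l => //; rewrite lee_fin sqr_ge0.
Qed.

End unbounded_core.

(** * Lebesgue measure under affine maps, and Euclidean balls *)

Definition pushforward_measure d1 d2 (T1 : measurableType d1) (T2 : measurableType d2)
    (R : realType) (m : {measure set T1 -> \bar R}) (f : T1 -> T2)
    (mf : measurable_fun setT f) : {measure set T2 -> \bar R}.
Proof.
refine (pushforward m f : {measure set T2 -> \bar R}); exact: mf.
Defined.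

Lemma lebesgue_measure_affine (R : realType) (c r : R) (r0 : 0 < r) (E : set R) :
  measurable E ->
  (r%:E * lebesgue_measure ((fun x : R => c + r * x)%R @^-1` E) = lebesgue_measure E)%E.
Proof.
move=> mE; have maff : measurable_fun setT (fun x : measurableTypeR R => (c + r * x : measurableTypeR R)).
  by apply: measurable_funD => //; exact: measurable_funM.
pose m1 : {measure set (measurableTypeR R) -> \bar R} :=
  mscale (NngNum (ltW r0)) (pushforward_measure lebesgue_measure maff).
rewrite [RHS](@lebesgue_measure_unique R m1)// => _ [[a b]] _ <-.
rewrite /m1 /= /mscale /= /pushforward.
rewrite [X in (_ = _ * lebesgue_measure X)%E](_ : _ = `](a - c) / r, (b - c) / r]%classic); last first.
  apply/seteqP; split => x /=; rewrite !in_itv/= ltr_pdivrMr// ler_pdivlMr// => /andP[h1 h2];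
    apply/andP; split; lra.
rewrite !lebesgue_measure_itv/= !lte_fin ltr_pM2r ?invr_gt0// ltrD2r.
case: ifP => ab; last by rewrite mule0.
by rewrite -EFinM; congr EFin; field; rewrite gt_eqF.
Qed.

Section affine.
Context {R : realType}.

Definition affine n (c : 'rV[R]_n) (r : R) (x : 'rV[R]_n) := c + r *: x.

Lemma measurable_affine n c r : measurable_fun setT (@affine n c r).
Proof.
apply: measurable_fun_matrixP => i j.
under eq_fun do rewrite /affine !mxE.
apply: measurable_funD => //; apply: measurable_funM => //; exact: measurable_entry.
Qed.

(** Induction on n, by uniqueness of the product measure. *)
Lemma lebesgue_rV_affine n (c : 'rV[R]_n) (r : R) (E : set 'rV[R]_n) : 0 < r ->
  measurable E ->
  ((r ^+ n)%:E * lebesgue_rV n (affine c r @^-1` E) = lebesgue_rV n E)%E.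
Proof.
move=> r0; elim: n c E => [|n IH] c E mE.
  rewrite expr0 mul1e; congr (lebesgue_rV 0 _); apply/seteqP; split => x /=;
    by rewrite (thinmx0 x) (thinmx0 (affine _ _ _)).
pose c0 := c ord0 ord0; pose c' : 'rV[R]_n := \row_j c ord0 (lift ord0 j).
pose A (p : R * 'rV[R]_n) : R * 'rV[R]_n := (c0 + r * p.1, affine c' r p.2).
have mA : measurable_fun setT (A : measurableTypeR R * 'rV[R]_n -> measurableTypeR R * 'rV[R]_n).
  apply/measurable_fun_pairP; split => /=.
    by apply: measurable_funD => //; apply: measurable_funM => //; exact: measurable_fst.
  exact: (measurableT_comp (measurable_affine c' r) measurable_snd).
have mE' : measurable (@rV_cons R n @^-1` E).
  by rewrite -[X in measurable X]setTI; apply: measurable_rV_cons.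
pose m1 : {measure set (measurableTypeR R * 'rV[R]_n) -> \bar R} :=
  mscale (NngNum (exprn_ge0 n.+1 (ltW r0)))
   (pushforward_measure (lebesgue_measure \x lebesgue_rV n)%E mA).
have := @product_measure_unique _ _ _ _ _ lebesgue_measure (lebesgue_rV n) m1 _ _ mE'.
have H B C : measurable B -> measurable C -> m1 (B `*` C) = (lebesgue_measure B * lebesgue_rV n C)%E.
  move=> mB mC; rewrite /m1 /= /mscale /= /pushforward.
  rewrite (_ : A @^-1` (B `*` C) = ((fun x => c0 + r * x) @^-1` B) `*` (affine c' r @^-1` C))//.
  rewrite product_measure1E; last 2 first.
  - have maff : measurable_fun setT (fun x : measurableTypeR R => (c0 + r * x : measurableTypeR R)).
      by apply: measurable_funD => //; exact: measurable_funM.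
    by rewrite -[X in measurable X]setTI; exact: maff.
  - by rewrite -[X in measurable X]setTI; exact: measurable_affine.
  rewrite -(lebesgue_measure_affine c0 r0 mB) -(IH c' C mC).
  by rewrite exprS EFinM muleACA.
move=> /(_ H) e; rewrite [RHS]e /m1 /= /mscale /= /pushforward; congr (_ * _)%E.
rewrite /lebesgue_rVS /pushforward; congr (_ _).
have cons x v : rV_cons (A (x, v)) = affine c r (rV_cons (x, v)).
  apply/rowP => j; transitivity (c ord0 j + r * rV_cons (x, v) ord0 j); last by rewrite !mxE.
  have [j' ->|->] := unliftP ord0 j; last by rewrite !rV_cons0.
  by rewrite !rV_consS /= /affine !mxE.
by apply/seteqP; split => -[x v] /=; rewrite cons.
Qed.

End affine.

Section euclid.
Context {R : realType} {d : nat}.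
Notation X := 'rV[R]_d.
Implicit Types x y v : X.

Lemma sqr_eucl_norm x : eucl_norm x ^+ 2 = \sum_(i < d) x ord0 i ^+ 2.
Proof. by rewrite sqr_sqrtr// sumr_ge0// => i _; exact: sqr_ge0. Qed.

Lemma eucl_norm_ge0 x : 0 <= eucl_norm x.
Proof. exact: sqrtr_ge0. Qed.

Lemma eucl_norm0 : eucl_norm (0 : X) = 0.
Proof. by rewrite /eucl_norm big1 ?sqrtr0// => i _; rewrite mxE expr0n. Qed.

Lemma eucl_normZ (r : R) x : 0 <= r -> eucl_norm (r *: x) = r * eucl_norm x.
Proof.
move=> r0; rewrite /eucl_norm (eq_bigr (fun i => r ^+ 2 * x ord0 i ^+ 2)); last first.
  by move=> i _; rewrite mxE exprMn.
by rewrite -mulr_sumr sqrtrM ?sqr_ge0// sqrtr_sqr ger0_norm.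
Qed.

Lemma eucl_normN x : eucl_norm (- x) = eucl_norm x.
Proof. by rewrite /eucl_norm; congr Num.sqrt; apply: eq_bigr => i _; rewrite mxE sqrrN. Qed.

Lemma eucl_normD x y : eucl_norm (x + y) <= eucl_norm x + eucl_norm y.
Proof.
pose C := \sum_(i < d) x ord0 i * y ord0 i.
have CS : C ^+ 2 <= eucl_norm x ^+ 2 * eucl_norm y ^+ 2.
  apply: quadratic_le; rewrite ?sqr_ge0// => s.
  rewrite !sqr_eucl_norm !mulr_sumr -big_split/=; apply: ler_sum => i _.
  have := sqr_ge0 (x ord0 i - s * y ord0 i); nra.
have C1 : C <= eucl_norm x * eucl_norm y.
  apply: (le_trans (ler_norm _)).
  by rewrite -ler_sqr ?nnegrE ?mulr_ge0 ?eucl_norm_ge0// real_normK ?num_real// exprMn.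
rewrite -ler_sqr ?nnegrE ?addr_ge0 ?eucl_norm_ge0//.
have -> : eucl_norm (x + y) ^+ 2 = eucl_norm x ^+ 2 + 2 * C + eucl_norm y ^+ 2.
  rewrite !sqr_eucl_norm mulr_sumr -!big_split/=; apply: eq_bigr => i _.
  rewrite !mxE; ring.
by rewrite sqrrD; lra.
Qed.

Lemma coord_le_eucl_norm x i : `|x ord0 i| <= eucl_norm x.
Proof.
rewrite /eucl_norm -sqrtr_sqr ler_wsqrtr// (bigD1 i)//= lerDl.
by apply: sumr_ge0 => j _; exact: sqr_ge0.
Qed.

(** The constant d instead of its square root is enough for controlling the
    size of cells. *)
Lemma eucl_norm_le_coord x (e : R) : (forall i, `|x ord0 i| <= e) -> 0 <= e ->
  eucl_norm x <= d%:R * e.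
Proof.
move=> H e0; rewrite -ler_sqr ?nnegrE ?eucl_norm_ge0 ?mulr_ge0//.
rewrite sqr_eucl_norm; apply: (@le_trans _ _ (\sum_(i < d) e ^+ 2)).
  by apply: ler_sum => i _; rewrite -[X in X <= _]real_normK ?num_real// ler_sqr ?nnegrE.
rewrite sumr_const card_ord exprMn -[X in X <= _]mulr_natl ler_wpM2r ?sqr_ge0//.
by rewrite -natrX ler_nat -mulnn; case: (d) => // n; rewrite leq_pmulr.
Qed.

Definition ball_at v (r : R) : set X := [set x | eucl_norm (x - v) <= r].

Lemma measurable_ball_at v r : measurable (ball_at v r).
Proof.
have -> : ball_at v r = affine (- v) 1 @^-1` (eucl_ball d r).
  by apply/seteqP; split => x; rewrite /ball_at /eucl_ball /affine /= scale1r addrC.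
by rewrite -[X in measurable X]setTI; apply: measurable_affine => //; exact: measurable_eucl_ball.
Qed.

Lemma lebesgue_ball_at v r : 0 < r ->
  lebesgue_rV d (ball_at v r) = (unit_ball_volume d * r ^+ d)%:E.
Proof.
move=> r0; rewrite -(lebesgue_rV_affine v r0 (measurable_ball_at v r)).
rewrite (_ : affine v r @^-1` _ = eucl_ball d 1).
  by rewrite /unit_ball_volume mulrC EFinM fineK// eucl_ball_fin_num.
apply/seteqP; split => x; rewrite /ball_at /affine /eucl_ball /= addrC addKr eucl_normZ ?(ltW r0)//.
  by rewrite -[X in _ <= X -> _]mulr1 ler_pM2l.
by move=> h; rewrite -[X in _ <= X]mulr1 ler_pM2l.
Qed.

Lemma lebesgue_rV_translate v (E : set X) : measurable E ->
  lebesgue_rV d ((fun x => x - v) @^-1` E) = lebesgue_rV d E.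
Proof.
move=> mE; rewrite -[RHS](lebesgue_rV_affine (- v) ltr01 mE) expr1n mul1e.
congr (_ _); apply/seteqP; split => x; rewrite /affine /= scale1r addrC//.
Qed.

End euclid.

(** * Clusters of points and their measure *)

Section cluster.
Context {R : realType} {d : nat}.
Notation X := 'rV[R]_d.
Notation conf := (configuration R d).
Variables (k : nat) (xhat : 'M[R]_(k.+1, d)) (A : set X) (r : R).
Hypotheses (mA : measurable A) (r0 : 0 < r).

(** The displacement of the points of x from the translate of [xhat] that has
    the same first point as x. *)
Definition offsets (x : 'M[R]_(k.+1, d)) : 'M[R]_(k.+1, d) :=
  \matrix_i (row i x - row i xhat - (row ord0 x - row ord0 xhat)).

Definition point_cluster : set 'M[R]_(k.+1, d) :=
  [set x | A (row ord0 x - row ord0 xhat) /\ forall i, eucl_norm (row i (offsets x)) <= r].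

Lemma row_offsets x i : row i (offsets x) = row i x - row i xhat - (row ord0 x - row ord0 xhat).
Proof. by apply/rowP => j; rewrite !mxE. Qed.

Lemma offsets_perturbation x : point_cluster x -> perturbations k.+1 d r (offsets x).
Proof.
move=> [_ H] i; case: eqP => [i0|_]; last exact: H.
by rewrite row_offsets (_ : i = ord0) ?subrr//; exact/val_inj.
Qed.

Lemma translate_offsets x : translate (xhat + offsets x) (row ord0 x - row ord0 xhat) = x.
Proof. by apply/matrixP => i j; rewrite !mxE; ring. Qed.

Lemma cluster_rows x y : point_cluster (rows_cons (x, y)) <->
  A (x - row ord0 xhat) /\
  rect (fun i => ball_at (row (lift ord0 i) xhat + (x - row ord0 xhat)) r) y.
Proof.
have e i : row (lift ord0 i) (offsets (rows_cons (x, y))) =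
    row i y - (row (lift ord0 i) xhat + (x - row ord0 xhat)).
  by rewrite row_offsets row_consS row_cons0 /= [in RHS]opprD [in RHS]addrA.
split=> [[]|[Ax H]].
  rewrite row_cons0 /= => Ax H; split => // i; rewrite /ball_at /= -e; exact: H.
split; first by rewrite row_cons0.
move=> i; have [j ->|->] := unliftP ord0 i; first by rewrite e; exact: H.
by rewrite row_offsets subrr eucl_norm0 ltW.
Qed.

Lemma measurable_point_cluster : measurable point_cluster.
Proof.
have msh : measurable_fun setT offsets.
  apply: measurable_fun_matrixP => i j; under eq_fun do rewrite !mxE.
  by apply: measurable_funB; apply: measurable_funB => //; exact: measurable_entry.
have mz : measurable_fun setT (fun x : 'M[R]_(k.+1, d) => row ord0 x - row ord0 xhat).
  apply: measurable_fun_matrixP => i j; under eq_fun do rewrite !mxE.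
  by apply: measurable_funB => //; exact: measurable_entry.
rewrite (_ : point_cluster = (fun x => row ord0 x - row ord0 xhat) @^-1` A `&`
    \bigcap_(i in [set: 'I_k.+1]) (fun x => row i (offsets x)) @^-1` eucl_ball d r); last first.
  apply/seteqP; split => x /= [Ax H]; split => //; first by move=> i _; exact: H.
  by move=> i; exact: H.
apply: measurableI; first by rewrite -[X in measurable X]setTI; exact: mz.
apply: fin_bigcap_measurable => // i _; rewrite -[X in measurable X]setTI.
have ms : measurable_fun setT (fun x => row i (offsets x)).
  exact: (measurableT_comp (measurable_row i) msh).
by apply: ms => //; exact: measurable_eucl_ball.
Qed.

Variables (t : R) (t0 : 0 <= t) (H : set X) (mH : measurable H).
Notation Lam := (intensity t0 mH).
Hypothesis clusterH : forall z y, A z -> perturbations k.+1 d r y ->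
  points_in k.+1 H (translate (xhat + y) z).

Lemma cluster_in : point_cluster `<=` points_in k.+1 H.
Proof.
move=> x Ux; rewrite -(translate_offsets x); apply: clusterH; first by case: Ux.
exact: offsets_perturbation.
Qed.

Variables (Q : probability conf R) (QP : poisson_law Q Lam).
Variables (W : set X) (gW : good_set W).
Hypothesis UW : point_cluster `<=` rect (fun=> W).

Let kap := unit_ball_volume d : R.

(** By Fubini: for a given first point, the other points vary independently in
    balls of radius r. *)
Lemma cluster_measure : (power_measure (window_measure QP gW) k.+1 point_cluster =
  t%:E * lebesgue_rV d A * ((t * (kap * r ^+ d)) ^+ k)%:E)%E.
Proof.
pose mm := window_measure QP gW.
have e : power_measure mm k.+1 point_cluster = (\int[power_measure mm k.+1]_x (\1_point_cluster x)%:E)%E.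
  by rewrite integral_indic ?setIT//; exact: measurable_point_cluster.
rewrite [LHS]e ge0_integral_power; last 2 first.
- by apply/measurable_EFinP; apply: measurable_indic; exact: measurable_point_cluster.
- by move=> x; rewrite lee_fin.
pose B x i := ball_at (row (lift ord0 i) xhat + (x - row ord0 xhat)) r : set X.
have mB x i : measurable (B x i) by exact: measurable_ball_at.
pose A' := (fun x => x - row ord0 xhat) @^-1` A.
have mA' : measurable A'.
  have -> : A' = affine (- row ord0 xhat) 1 @^-1` A.
    by apply/seteqP; split => x; rewrite /A' /affine /= scale1r addrC.
  by rewrite -[X in measurable X]setTI; exact: measurable_affine.
have full x y : A' x -> rect (B x) y -> point_cluster (rows_cons (x, y)).
  by move=> Ax By; apply/cluster_rows.
(* Any point of the ball is the i-th point of a tuple in the cluster. *)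
have BHW x i : A' x -> B x i `<=` H `&` W.
  move=> Ax w Bw.
  pose y : 'M[R]_(k, d) := \matrix_j (if j == i then w else row (lift ord0 j) xhat + (x - row ord0 xhat)).
  have yi : row i y = w by apply/rowP => l; rewrite !mxE eqxx.
  have Uy : point_cluster (rows_cons (x, y)).
    apply: full => // j; rewrite /B /ball_at /=.
    have -> : row j y = if j == i then w else row (lift ord0 j) xhat + (x - row ord0 xhat).
      by apply/rowP => l; rewrite !mxE.
    by case: eqP => [->//|_]; rewrite subrr eucl_norm0 ltW.
  have h1 := cluster_in Uy (lift ord0 i); have h2 : W (row (lift ord0 i) (rows_cons (x, y))) by exact: (UW Uy).
  by move: h1 h2; rewrite row_consS /= yi.
have A'HW : A' `<=` H `&` W.
  move=> x Ax; pose y : 'M[R]_(k, d) := \matrix_j (row (lift ord0 j) xhat + (x - row ord0 xhat)).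
  have Uy : point_cluster (rows_cons (x, y)).
    apply: full => // j; rewrite /B /ball_at /= (_ : row j y = row (lift ord0 j) xhat + (x - row ord0 xhat)).
      by rewrite subrr eucl_norm0 ltW.
    by apply/rowP => l; rewrite !mxE.
  have h1 := cluster_in Uy ord0; have h2 : W (row ord0 (rows_cons (x, y))) by exact: (UW Uy).
  by move: h1 h2; rewrite row_cons0.
have LamE S : S `<=` H `&` W -> mm S = (t%:E * lebesgue_rV d S)%E.
  move=> SHW; rewrite [LHS]window_measureE; last by move=> x /SHW[].
  rewrite intensityE (_ : S `&` H = S)//; apply/setIidPl => x /SHW[] //.
have inner x : (\int[power_measure mm k]_y (\1_point_cluster (rows_cons (x, y)))%:E =
    (\1_A' x)%:E * ((t * (kap * r ^+ d)) ^+ k)%:E)%E.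
  rewrite indicE; have [Ax|Ax] := boolP (x \in A'); last first.
    rewrite mul0e integral0_eq// => y _; rewrite indicE memNset//.
    by move=> /cluster_rows[]; move/negP: Ax; rewrite inE.
  rewrite inE in Ax; rewrite mul1e.
  transitivity (power_measure mm k (rect (B x))).
    rewrite -[RHS]mul1e -integral_cst; last by apply: measurable_rect => i; exact: mB.
    rewrite [RHS]integral_mkcond; apply: eq_integral => y _.
    rewrite patchE indicE; case: ifPn; rewrite ?inE ?notin_setE => h.
      by rewrite mem_set//; exact: full.
    by rewrite memNset// => /cluster_rows[].
  rewrite [LHS]power_measure_rect; last by move=> i; exact: mB.
  transitivity (\prod_(i < k) (t * (kap * r ^+ d))%:E)%E.
    apply: eq_bigr => i _; transitivity (t%:E * lebesgue_rV d (B x i))%E.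
      by apply: LamE; exact: BHW.
    by rewrite lebesgue_ball_at// EFinM.
  by rewrite prodEFin prodr_const card_ord.
under eq_integral do rewrite inner.
rewrite ge0_integralZr//; last 2 first.
- by apply/measurable_EFinP; exact: measurable_indic.
- rewrite lee_fin exprn_ge0// mulr_ge0// mulr_ge0 ?exprn_ge0 ?(ltW r0)//.
  by rewrite /kap /unit_ball_volume fine_ge0.
rewrite integral_indic// setIT; congr (_ * _)%E.
rewrite [LHS](LamE A' A'HW); congr (_ * _)%E; exact: lebesgue_rV_translate.
Qed.

End cluster.

(** * The variance bound on bounded clusters *)

Section cluster_variance.
Context {R : realType} {d : nat}.
Notation X := 'rV[R]_d.
Notation conf := (configuration R d).
Hypothesis d_gt0 : (0 < d)%N.
Variables (t : R) (t0 : 0 <= t) (H : set X) (mH : measurable H).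
Context dO (Omega : measurableType dO) (P : probability Omega R).
Variable eta : {RV P >-> configuration R d}.
Hypothesis eta_poisson :
  poisson_process H (fun B => t%:E * lebesgue_rV d (B `&` H))%E eta.
Variables (F : Omega -> R) (F_L2 : F \in Lfun P 2%:E).
Variable f : conf -> R.
Hypothesis mf : measurable_fun (configurations_in H) f.
Hypothesis f_repr : {ae P, forall w, F w = f (eta w)}.
Variables (k : nat) (I1 I2 : {set 'I_k.+1}) (xhat : 'M[R]_(k.+1, d)).
Notation g := (add_cost_diff f eta I1 I2).
Notation kap := (unit_ball_volume d : R).
Variables (A : set X) (r tau c K : R).
Hypotheses (mA : measurable A) (r0 : 0 < r) (rtau : r < tau) (c0 : 0 < c).
Hypothesis clusterH : forall z y, A z -> perturbations k.+1 d r y ->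
  points_in k.+1 H (translate (xhat + y) z).
Hypothesis clusterg : forall z y, A z -> perturbations k.+1 d r y ->
  c < g (translate (xhat + y) z).
Hypotheses (K0 : 0 <= K).
Hypothesis MK : forall j, (0 < j <= k.+1)%N ->
  (t * (kap * (2 * tau) ^+ d)) ^+ (k.+1 - j) <= K.

Let kap0 : 0 <= kap. Proof. by rewrite /unit_ball_volume fine_ge0. Qed.

(** In a cluster, the difference of two points deviates from that of the same
    points of [xhat] by at most 2 r. The tolerance dl adds at most
    2 (tau - r). *)
Lemma cluster_spread (dl : R) : 0 < dl -> r + d%:R * dl <= tau ->
  forall (i j : 'I_k.+1) (p : X) (S : set X), measurable S ->
  (forall w, S w -> exists x, [/\ point_cluster xhat A r x, forall l, `|w ord0 l - x i l| <= dl &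
    forall l, `|p ord0 l - x j l| <= dl]) ->
  (intensity t0 mH S <= (t * (kap * (2 * tau) ^+ d))%:E)%E.
Proof.
move=> dl0 rdl i j p S mS HS; pose v := row i xhat - row j xhat + p.
have tau0 : 0 < tau := lt_trans r0 rtau.
have Sv : S `<=` ball_at v (2 * tau).
  move=> w /HS[x [[Ax sx] wx px]]; rewrite /ball_at /=.
  have -> : w - v = (w - row i x) + row i (offsets xhat x) - row j (offsets xhat x) + (- (p - row j x)).
    by rewrite /v !row_offsets; apply/rowP => l; rewrite !mxE; ring.
  have n1 : eucl_norm (w - row i x) <= d%:R * dl.
    by apply: eucl_norm_le_coord; [move=> l; rewrite !mxE; exact: wx|exact: ltW].
  have n2 : eucl_norm (p - row j x) <= d%:R * dl.
    by apply: eucl_norm_le_coord; [move=> l; rewrite !mxE; exact: px|exact: ltW].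
  have n3 := sx i; have n4 := sx j.
  have h1 := eucl_normD (w - row i x + row i (offsets xhat x) - row j (offsets xhat x)) (- (p - row j x)).
  have h2 := eucl_normD (w - row i x + row i (offsets xhat x)) (- row j (offsets xhat x)).
  have h3 := eucl_normD (w - row i x) (row i (offsets xhat x)).
  rewrite !eucl_normN in h1 h2; lra.
rewrite intensityE EFinM -(lebesgue_ball_at v); last by rewrite mulr_gt0.
apply: lee_wpmul2l; first by rewrite lee_fin.
apply: le_measure; rewrite ?inE; [exact: measurableI|exact: measurable_ball_at|].
by move=> x [/Sv].
Qed.

Lemma bounded_cluster_variance LA : A `<=` box LA ->
  ((c ^+ 2)%:E * (t%:E * lebesgue_rV d A * ((t * (kap * r ^+ d)) ^+ k)%:E) <=
   2%:E * 'V_P[F] * (4 ^+ k.+1 * (k.+1`!%:R * K))%:E)%E.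
Proof.
move=> ALA.
have [N _ xN] : (\bigcup_n box n%:R) xhat by rewrite bigcup_box.
pose L : R := N%:R + LA + r; pose W : set X := box L.
have gW : good_set W by split; [exact: measurable_box|exact: bounded_box].
have UW : point_cluster xhat A r `<=` rect (fun=> W).
  move=> x [Ax sx] i a l; rewrite (ord1 a) => {a}.
  have -> : row i x ord0 l = xhat i l + (row ord0 x - row ord0 xhat) ord0 l + row i (offsets xhat x) ord0 l.
    by rewrite !mxE; ring.
  apply: (le_trans (ler_normD _ _)); apply: lerD; last first.
    exact: le_trans (coord_le_eucl_norm _ _) (sx i).
  by apply: (le_trans (ler_normD _ _)); apply: lerD; [exact: xN|exact: ALA].
(* The cells are so small that their size, in the Euclidean norm, is absorbed
   by the difference between r and tau. *)
pose dl := (tau - r) / d%:R.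
have dR0 : (0 : R) < d%:R by rewrite ltr0n.
have dl0 : 0 < dl by rewrite divr_gt0// subr_gt0.
have rdl : r + d%:R * dl <= tau.
  by rewrite /dl mulrC divfK ?gt_eqF// addrC subrK.
have tau0 : 0 < tau := lt_trans r0 rtau.
have M0 : 0 <= t * (kap * (2 * tau) ^+ d).
  by rewrite !mulr_ge0// exprn_ge0// mulr_ge0// ltW.
have := @variance_bound R d d_gt0 t t0 H mH dO Omega P eta eta_poisson F F_L2 f mf f_repr
  W gW L (@subset_refl _ W) k.+1 I1 I2 (point_cluster xhat A r) dl (t * (kap * (2 * tau) ^+ d)) K c
  (measurable_point_cluster xhat r mA) UW dl0 (cluster_in clusterH) _ M0 MK K0 c0 _.
rewrite cluster_measure//; apply.
- by move=> i j p S mS SW; exact: cluster_spread.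
- move=> x Ux; rewrite -(translate_offsets xhat x); apply: clusterg; first by case: Ux.
  exact: (offsets_perturbation Ux).
Qed.

End cluster_variance.

(** * The radius, the constant and the theorem *)

Lemma perturbations_le (R : realType) k d (r r' : R) : r <= r' ->
  perturbations k d r `<=` perturbations k d r'.
Proof.
move=> rr y Hy i; have := Hy i; case: ifP => // _ h; exact: le_trans h rr.
Qed.

(** Continuity of g at x within S, read in terms of Euclidean balls. *)
Lemma perturbation_radius_gt0 (R : realType) (k d : nat) (S : set 'M[R]_(k, d))
    (g : 'M[R]_(k, d) -> R) (x : 'M[R]_(k, d)) (a eps : R) :
  g y @[y --> within S (nbhs x)] --> g x -> a < g x -> 0 < eps ->
  (forall y, perturbations k d eps y -> S (x + y)) ->
  exists r, 0 < r < eps /\ forall y, perturbations k d r y -> a < g (x + y).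
Proof.
move=> gc ax eps0 HS.
have : \forall y \near within S (nbhs x), a < g y by exact: cvgr_gt ax.
rewrite near_withinE => /nbhs_ballP[e /= e0 He].
exists (Num.min eps e / 2); have m0 : 0 < Num.min eps e by rewrite lt_min eps0.
have me : Num.min eps e <= eps by rewrite ge_min lexx.
have me' : Num.min eps e <= e by rewrite ge_min lexx orbT.
split; first by apply/andP; split; lra.
move=> y Hy; apply: He; last by apply/HS/(perturbations_le _ Hy); lra.
split=> // i j; rewrite /ball/= mxE opprD addNKr normrN.
suff h : `|y i j| <= Num.min eps e / 2 by apply: le_lt_trans h _; lra.
have e1 : y i j = row i y ord0 j by rewrite mxE.
rewrite e1; have := Hy i; case: ifP => [_ ->|_ h]; first by rewrite mxE normr0; lra.
exact: le_trans (coord_le_eucl_norm _ _) h.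
Qed.

(** Bernoulli's inequality for a radius that is slightly smaller than tau. *)
Lemma almost_full_power (R : realFieldType) (tau : R) (n : nat) : 0 < tau ->
  exists r, [/\ 0 < r, r < tau & tau ^+ n <= 2 * r ^+ n].
Proof.
move=> tau0; have n1 : 0 < 2 * n%:R + 2 :> R by rewrite ltr_wpDl// mulr_ge0.
pose e : R := (2 * n%:R + 2)^-1.
have e0 : 0 < e by rewrite invr_gt0.
have en : (2 * n%:R + 2) * e = 1 by rewrite mulfV// gt_eqF.
have ne0 : 0 <= n%:R * e by rewrite mulr_ge0// ltW.
have e1 : e < 1 by lra.
have bern j : 1 - j%:R * e <= (1 - e) ^+ j.
  elim: j => [|j IH]; first by rewrite mul0r subr0 expr0.
  have j0 : 0 <= j%:R * e ^+ 2 by rewrite mulr_ge0// sqr_ge0.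
  rewrite exprS; apply: (@le_trans _ _ ((1 - e) * (1 - j%:R * e))).
    rewrite -natr1 mulrDl mul1r; move: j0; rewrite expr2; nra.
  by rewrite ler_wpM2l// subr_ge0 ltW.
exists (tau * (1 - e)); split.
- by rewrite mulr_gt0// subr_gt0.
- by rewrite -[X in _ < X]mulr1 ltr_pM2l// ltrBlDr ltrDl.
rewrite exprMn mulrCA -[X in X <= _]mulr1 ler_wpM2l ?exprn_ge0 ?(ltW tau0)//.
have := bern n; lra.
Qed.

(** The two factors 2 in the hypotheses and the square of c / 2 amount to
    16 * 4^(k+1), which is at most 4 * 8^(k+2). *)
Lemma variance_constant (R : realFieldType) (c u B Y V q : R) (k : nat) :
  0 < q -> 0 < B -> 0 <= u -> 0 <= V -> B <= 2 * Y ->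
  (c / 2) ^+ 2 * (u * Y) <= 2 * V * (4 ^+ k.+1 * (k.+1`!%:R * (B / q))) ->
  c ^+ 2 / (4 * 8 ^+ k.+2 * k.+1`!%:R) * q * u <= V.
Proof.
move=> q0 B0 u0 V0 BY h.
have N0 : 0 < k.+1`!%:R :> R by rewrite ltr0n fact_gt0.
have p8 : 4 ^+ k.+1 <= 8 ^+ k.+1 :> R by rewrite lerXn2r ?nnegrE//; lra.
have e0 : 0 < 8 ^+ k.+1 :> R by rewrite exprn_gt0.
have h1 : c ^+ 2 * q * u * B <= 16 * V * 4 ^+ k.+1 * k.+1`!%:R * B.
  have h2 : c ^+ 2 * u * B <= 2 * (c ^+ 2 * (u * Y)).
    have := ler_wpM2l (mulr_ge0 (sqr_ge0 c) u0) BY; lra.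
  have h3 : c ^+ 2 * u * B <= 16 * V * 4 ^+ k.+1 * k.+1`!%:R * (B / q).
    by move: h; rewrite expr_div_n; lra.
  have := ler_wpM2l (ltW q0) h3.
  rewrite [X in _ <= X](_ : _ = 16 * V * 4 ^+ k.+1 * k.+1`!%:R * B); first by lra.
  by field; rewrite gt_eqF.
rewrite (mulrAC _ _ q) (mulrAC _ _ u) ler_pdivrMr ?mulr_gt0 ?exprn_gt0//.
rewrite ler_pM2r// in h1; apply: (le_trans h1).
have h4 : V * k.+1`!%:R * 4 ^+ k.+1 <= V * k.+1`!%:R * 8 ^+ k.+1.
  by rewrite ler_wpM2l// mulr_ge0// ltW.
have h5 : 0 <= V * k.+1`!%:R * 8 ^+ k.+1 by rewrite !mulr_ge0// ltW.
rewrite [8 ^+ k.+2]exprS; lra.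
Qed.

Theorem theorem5p3 (R : realType) (d : nat) (d_gt0 : (0 < d)%N)
    (t : R) (t_gt0 : 0 < t) (H : set 'rV[R]_d) (mH : measurable H)
    (dO : measure_display) (Omega : measurableType dO) (P : probability Omega R)
    (eta : {RV P >-> configuration R d})
    (eta_poisson :
      poisson_process H (fun B => t%:E * lebesgue_rV d (B `&` H))%E eta)
    (F : Omega -> R) (F_L2 : F \in Lfun P 2%:E)
    (f : configuration R d -> R)
    (mf : measurable_fun (configurations_in H) f)
    (f_repr : {ae P, forall w, F w = f (eta w)})
    (k : nat) (k_gt0 : (0 < k)%N)
    (I1 I2 : {set 'I_k}) (I12 : (I1 :|: I2)%SET = [set: 'I_k]%SET) :
  let g := add_cost_diff f eta I1 I2 in
  forall (xhat : 'M[R]_(k, d)) (c : R),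
    points_in k H xhat ->
    g x @[x --> within (points_in k H) (nbhs xhat)] --> g xhat ->
    0 < c -> c <= g xhat ->
  forall (A : set 'rV[R]_d) (eps : R), measurable A -> 0 < eps ->
    (forall y, perturbations k d eps y -> points_in k H (xhat + y)) ->
    (forall z y, A z -> perturbations k d eps y ->
      points_in k H (translate (xhat + y) z) /\
      g (translate (xhat + y) z) = g (xhat + y)) ->
  let tau := sup [set r | 0 < r < eps /\
    forall y, perturbations k d r y -> c / 2 < g (xhat + y)] in
  0 < tau /\
  ((c ^+ 2 / (4 * 8 ^+ k.+1 * k`!%:R))%:E *
   \big[Order.min/+oo]_(1 <= j < k.+1)
     (2 ^- (d * (k - j)) * (t * unit_ball_volume d * tau ^+ d) ^+ j.-1)%:E *
   (t%:E * lebesgue_rV d A) <= 'V_P[F])%E.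
Proof.
case: k k_gt0 I1 I2 I12 => [//|k] _ I1 I2 _ g xhat c xhatH gc c0 cg A eps mA eps0 Heps HA tau.
pose S := [set r | 0 < r < eps /\
  forall y, perturbations k.+1 d r y -> c / 2 < g (xhat + y)].
have c20 : 0 < c / 2 by rewrite divr_gt0.
have [r1 Sr1] : exists r, S r.
  by apply: (perturbation_radius_gt0 gc) => //; lra.
have supS : has_sup S.
  by split; [exists r1|exists eps => r [/andP[_ /ltW]]].
have tau0 : 0 < tau.
  have [/andP[r10 _] _] := Sr1.
  exact: (lt_le_trans r10 (ub_le_sup supS.2 Sr1)).
have taulow r : r < tau -> exists2 r', S r' & r < r'.
  move=> rtau; have tr : 0 < tau - r by rewrite subr_gt0.
  have [r' Sr' h] := sup_adherent tr supS; exists r' => //.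
  by move: h; rewrite -/tau; lra.
split => //.
set q := \big[_/_]_(_ <= _ < _) _.
pose kap : R := unit_ball_volume d.
have kap0 : 0 <= kap by rewrite /kap /unit_ball_volume fine_ge0.
pose T := t * kap * tau ^+ d.
have T0 : 0 <= T by rewrite !mulr_ge0 ?exprn_ge0// ltW.
have term_ge0 j : 0 <= 2 ^- (d * (k.+1 - j)) * T ^+ j.-1.
  by rewrite mulr_ge0 ?exprn_ge0// invr_ge0 exprn_ge0.
have q0 : (0 <= q)%E.
  by apply: le_bigmin => // j _; rewrite lee_fin; exact: term_ge0.
have qle j : (0 < j <= k.+1)%N -> (q <= (2 ^- (d * (k.+1 - j)) * T ^+ j.-1)%:E)%E.
  case: j => // j; rewrite ltnS => /= jk.
  by rewrite /q big_add1 /= big_mkord; exact: (bigmin_le _ (Ordinal (jk : (j < k.+1)%N))).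
have [qr qE] : exists qr, q = qr%:E.
  exists (fine q); rewrite fineK// ge0_fin_numE//.
  by apply: le_lt_trans (qle 1%N isT) _; rewrite ltry.
have V0 := variance_ge0 P F.
have VE := variance_fin_num F_L2.
rewrite qE in q0 qle *; rewrite lee_fin in q0.
have [qr0|qrn] := eqVneq qr 0; first by rewrite qr0 mule0 mul0e.
have qrp : 0 < qr by rewrite lt_neqAle eq_sym qrn.
have Tk : qr <= T ^+ k.
  have := qle k.+1 (leqnn _ : (0 < k.+1 <= k.+1)%N); rewrite lee_fin subnn muln0 expr0 invr1 mul1r.
  by [].
have Tkp : 0 < T ^+ k := lt_le_trans qrp Tk.
(* By definition of the minimum qr, this K bounds the factors (2^d T)^(k+1-j),
   where T^k is the part of the measure of the cluster that comes from the
   points after the first. *)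
pose K := T ^+ k / qr.
have K0 : 0 <= K by rewrite divr_ge0 ?ltW.
have qle' j : (0 < j <= k.+1)%N -> qr <= 2 ^- (d * (k.+1 - j)) * T ^+ j.-1.
  by move=> /qle; rewrite lee_fin.
have MK j : (0 < j <= k.+1)%N -> (t * (kap * (2 * tau) ^+ d)) ^+ (k.+1 - j) <= K.
  move=> jk; rewrite /K ler_pdivlMr//.
  have -> : t * (kap * (2 * tau) ^+ d) = 2 ^+ d * T by rewrite /T exprMn; ring.
  apply: (le_trans (ler_wpM2l _ (qle' j jk))); first by rewrite exprn_ge0// mulr_ge0// exprn_ge0.
  rewrite exprMn -exprM mulrACA mulfV ?mul1r; last by rewrite expf_neq0.
  rewrite -exprD; case: j jk => // j /andP[_]; rewrite subSS /= => jk.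
  by rewrite subnK.
(* The radius r must be smaller than tau because of the size of the cells; a
   factor 2 is lost. *)
have [r [r0 rtau rfull]] := almost_full_power (d * k) tau0.
have [r' Sr' rr'] := taulow r rtau.
have [/andP[_ r'eps] gr'] := Sr'.
have pert y : perturbations k.+1 d r y -> perturbations k.+1 d eps y.
  by apply: perturbations_le; exact: ltW (lt_trans rr' r'eps).
(* A is exhausted by bounded sets. *)
have key n : ((c ^+ 2 / (4 * 8 ^+ k.+2 * (k.+1)`!%:R) * qr)%:E * (t%:E * lebesgue_rV d (A `&` box n%:R)) <= 'V_P[F])%E.
  have gA := good_setI_box n%:R mA.
  have LA0 := measure_ge0 (lebesgue_rV d) (A `&` box n%:R).
  have LAE : lebesgue_rV d (A `&` box n%:R) \is a fin_num.
    by rewrite ge0_fin_numE//; exact: lebesgue_good gA.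
  have clusterH z y : (A `&` box n%:R) z -> perturbations k.+1 d r y ->
      points_in k.+1 H (translate (xhat + y) z).
    by move=> [Az _] /pert Hy; exact: (HA z y Az Hy).1.
  have clusterg z y : (A `&` box n%:R) z -> perturbations k.+1 d r y ->
      c / 2 < g (translate (xhat + y) z).
    move=> [Az _] Hy; rewrite (HA z y Az (pert y Hy)).2; apply: gr'.
    exact: perturbations_le (ltW rr') _ Hy.
  have := bounded_cluster_variance d_gt0 (ltW t_gt0) mH eta_poisson F_L2 mf f_repr
    gA.1 r0 rtau c20 clusterH clusterg K0 MK (@subIsetr _ _ _).
  rewrite -(fineK LAE) -(fineK VE) -!EFinM !lee_fin => h.
  apply: (variance_constant qrp Tkp _ _ _ h).
  - by rewrite mulr_ge0 ?fine_ge0// ltW.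
  - exact: fine_ge0.
  rewrite /T !exprMn -!exprM; move: rfull.
  have : 0 <= t ^+ k * kap ^+ k by rewrite mulr_ge0// exprn_ge0// ltW.
  set u := t ^+ k * kap ^+ k; move=> u0 /(ler_wpM2l u0).
  by rewrite /u; lra.
rewrite -EFinM; set C := (_ * qr)%R in key *.
have cvC : (C%:E * (t%:E * lebesgue_rV d (A `&` box n%:R)))%E @[n --> \oo] -->
    (C%:E * (t%:E * lebesgue_rV d A))%E.
  by do 2! apply: cvgeZl => //; exact: cvg_measure_box.
rewrite -(cvg_lim _ cvC)//; apply: lime_le; first by apply/cvg_ex; eexists; exact: cvC.
exact: nearW.
Qed.
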